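(* Let $\Bbbk$ be a field and let $R$ be a standard graded $\Bbbk$-algebra of dimension at least two satisfying Serre's condition $(S_2)$, with graded maximal ideal $\mathfrak m$. Set $\ell=\min\{j\ge0:\mathfrak m^j\subseteq\operatorname{tr}_R(\omega_R)\}$ and assume that $\ell<\infty$. Then, for every integer $d\ge1$, $$\mathfrak m_d^{\,1+\lceil(\ell-1)/d\rceil}\subseteq\operatorname{tr}_{R^{(d)}}(\omega_{R^{(d)}})\subseteq\mathfrak m_d^{\,\lceil-a(R)/d\rceil+\lceil b(R)/d\rceil},$$ where $\mathfrak m_d$ denotes the graded maximal ideal of the Veronese subalgebra $R^{(d)}$.
   Context: A standard graded $\Bbbk$-algebra is a (commutative) Noetherian graded algebra $R=\bigoplus_{i\ge0}R_i$ with $R_0=\Bbbk$, generated as a $\Bbbk$-algebra by $R_1$. For $d\ge1$, $R^{(d)}=\bigoplus_{i\ge0}R_{id}$ is the $d$-th Veronese subalgebra, with $R_{id}$ placed in degree $i$. For finite graded $R$-modules $M,N$, $\operatorname{Hom}_R(M,N)$ is graded by $\operatorname{Hom}_R(M,N)_j=\{\varphi:\varphi(M_i)\subseteq N_{i+j}\text{ for all }i\}$. For a finite graded module $N$, $\operatorname{indeg}N=\min\{j\in\mathbb Z:N_j\ne0\}$, with $\operatorname{indeg}0=\infty$. The graded canonical module $\omega_R$ is the graded $\Bbbk$-dual of top local cohomology: $[\omega_R]_j=\operatorname{Hom}_\Bbbk([H^{\dim R}_{\mathfrak m}(R)]_{-j},\Bbbk)$. Set $a(R)=-\operatorname{indeg}\omega_R$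 and $b(R)=\operatorname{indeg}\operatorname{Hom}_R(\omega_R,R)$. The trace of a finite graded $R$-module $M$ is the ideal $\operatorname{tr}_R(M)=\sum_{\varphi\in\operatorname{Hom}_R(M,R)}\varphi(M)$. Powers of $\mathfrak m_d$ with exponent $\le 0$ are understood to be $R^{(d)}$. *)

(* Defs.v *)
From HB Require Import structures.
From mathcomp Require Import all_boot all_order all_algebra.
From mathcomp Require Import generic_quotient ring_quotient ring.
From mathcomp Require Import boolp classical_sets functions.
From mathcomp Require Import constructive_ereal.

Set Implicit Arguments.
Unset Strict Implicit.
Unset Printing Implicit Defensive.

Import Order.TTheory GRing.Theory Num.Theory.
Local Open Scope classical_set_scope.
Local Open Scope ring_scope.
Local Open Scope quotient_scope.

Section Localization.
Variables (A : comNzRingType) (S : mulrClosed A).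

Definition denominator : Type := {s : A | s \in S}.
HB.instance Definition _ := SubChoice.on denominator.

(* The numerator comes first: (a, s) stands for a / s. *)
Definition fraction : Type := (A * denominator)%type.
HB.instance Definition _ := Choice.on fraction.
Implicit Types u v w : fraction.

Definition loc_equiv u v : bool :=
  `[< exists2 s : A, s \in S & s * (u.1 * sval v.2 - v.1 * sval u.2) = 0 >].

Lemma loc_equiv_is_equiv : equiv_class_of loc_equiv.
Proof.
split=> [u|u v|v u w].
- by apply/asboolP; exists 1; rewrite ?rpred1 // subrr mulr0.
- by apply: asbool_equiv_eq; split=> -[s Ss e]; exists s => //;
    rewrite -opprB mulrN e oppr0.
- move=> /asboolP[s Ss es] /asboolP[t St et]; apply/asboolP.
  exists (s * t * sval v.2); first by rewrite !rpredM //; exact: (valP v.2).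
  rewrite (_ : _ * _ = (t * sval w.2) * (s * (u.1 * sval v.2 - v.1 * sval u.2)) +
    (s * sval u.2) * (t * (v.1 * sval w.2 - w.1 * sval v.2))); last by ring.
  by rewrite es et !mulr0 addr0.
Qed.

Canonical loc_equiv_equiv := EquivRelPack loc_equiv_is_equiv.
Canonical loc_equiv_encModRel := defaultEncModRel loc_equiv.

Definition loc := {eq_quot loc_equiv}.
HB.instance Definition _ : EqQuotient fraction loc_equiv loc :=
  EqQuotient.on loc.
HB.instance Definition _ := Choice.on loc.

Lemma locW (P : loc -> Prop) : (forall u, P (\pi_loc u)) -> forall x, P x.
Proof. by move=> Pu x; rewrite -[x]reprK. Qed.

Lemma loc_eqP u v :
  \pi_loc u = \pi_loc v <->
  exists2 s : A, s \in S & s * (u.1 * sval v.2 - v.1 * sval u.2) = 0.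
Proof.
by split=> [/eqP|e]; [rewrite piE => /asboolP | apply/eqP; rewrite piE; apply/asboolP].
Qed.

Definition den1 : denominator := Sub 1 (rpred1 S).
Definition denM (s t : denominator) : denominator :=
  Sub (sval s * sval t) (rpredM (valP s) (valP t)).

Definition frac_add u v : fraction :=
  (u.1 * sval v.2 + v.1 * sval u.2, denM u.2 v.2).
Definition frac_mul u v : fraction := (u.1 * v.1, denM u.2 v.2).

Definition frac_of (a : A) (s : denominator) : loc := \pi_loc (a, s).
Definition loc0 : loc := \pi_loc (0, den1).
Definition loc1 : loc := \pi_loc (1, den1).
Definition loc_add (x y : loc) : loc := \pi_loc (frac_add (repr x) (repr y)).
Definition loc_opp (x : loc) : loc := \pi_loc (- (repr x).1, (repr x).2).
Definition loc_mul (x y : loc) : loc := \pi_loc (frac_mul (repr x) (repr y)).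
Definition loc_scale (a : A) (x : loc) : loc :=
  \pi_loc (a * (repr x).1, (repr x).2).

Lemma loc_addE u v : loc_add (\pi_loc u) (\pi_loc v) = \pi_loc (frac_add u v).
Proof.
apply/loc_eqP; rewrite /=.
have /loc_eqP[s Ss es] : \pi_loc (repr (\pi_loc u)) = \pi_loc u by rewrite reprK.
have /loc_eqP[t St et] : \pi_loc (repr (\pi_loc v)) = \pi_loc v by rewrite reprK.
exists (s * t); first by rewrite rpredM.
set u' := repr _ in es *; set v' := repr _ in et *.
rewrite (_ : _ * _ = (t * sval v.2 * sval v'.2) * (s * (u'.1 * sval u.2 - u.1 * sval u'.2)) +
  (s * sval u'.2 * sval u.2) * (t * (v'.1 * sval v.2 - v.1 * sval v'.2))); last by ring.
by rewrite es et !mulr0 addr0.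
Qed.

Lemma loc_mulE u v : loc_mul (\pi_loc u) (\pi_loc v) = \pi_loc (frac_mul u v).
Proof.
apply/loc_eqP; rewrite /=.
have /loc_eqP[s Ss es] : \pi_loc (repr (\pi_loc u)) = \pi_loc u by rewrite reprK.
have /loc_eqP[t St et] : \pi_loc (repr (\pi_loc v)) = \pi_loc v by rewrite reprK.
exists (s * t); first by rewrite rpredM.
set u' := repr _ in es *; set v' := repr _ in et *.
rewrite (_ : _ * _ = (t * v'.1 * sval v.2) * (s * (u'.1 * sval u.2 - u.1 * sval u'.2)) +
  (s * sval u'.2 * u.1) * (t * (v'.1 * sval v.2 - v.1 * sval v'.2))); last by ring.
by rewrite es et !mulr0 addr0.
Qed.

Lemma loc_scaleE a u : loc_scale a (\pi_loc u) = \pi_loc (a * u.1, u.2).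
Proof.
apply/loc_eqP; rewrite /=.
have /loc_eqP[s Ss es] : \pi_loc (repr (\pi_loc u)) = \pi_loc u by rewrite reprK.
exists s => //; set u' := repr _ in es *.
rewrite (_ : _ * _ = a * (s * (u'.1 * sval u.2 - u.1 * sval u'.2))); last by ring.
by rewrite es mulr0.
Qed.

Lemma loc_oppE u : loc_opp (\pi_loc u) = \pi_loc (- u.1, u.2).
Proof.
apply/loc_eqP; rewrite /=.
have /loc_eqP[s Ss es] : \pi_loc (repr (\pi_loc u)) = \pi_loc u by rewrite reprK.
exists s => //; set u' := repr _ in es *.
rewrite (_ : _ * _ = - (s * (u'.1 * sval u.2 - u.1 * sval u'.2))); last by ring.
by rewrite es oppr0.
Qed.

Lemma loc_eq u v : u.1 * sval v.2 = v.1 * sval u.2 -> \pi_loc u = \pi_loc v.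
Proof. by move=> e; apply/loc_eqP; exists 1; rewrite ?rpred1 // e subrr mulr0. Qed.

Lemma loc_addA : associative loc_add.
Proof.
by elim/locW=> x; elim/locW=> y; elim/locW=> z; rewrite !loc_addE; apply: loc_eq => /=; ring.
Qed.
Lemma loc_addC : commutative loc_add.
Proof. by elim/locW=> x; elim/locW=> y; rewrite !loc_addE; apply: loc_eq => /=; ring. Qed.
Lemma loc_add0 : left_id loc0 loc_add.
Proof. by elim/locW=> x; rewrite !loc_addE; apply: loc_eq => /=; ring. Qed.
Lemma loc_addN : left_inverse loc0 loc_opp loc_add.
Proof. by elim/locW=> x; rewrite loc_oppE !loc_addE; apply: loc_eq => /=; ring. Qed.
HB.instance Definition _ :=
  GRing.isZmodule.Build loc loc_addA loc_addC loc_add0 loc_addN.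

Lemma loc_addrE u v : \pi_loc u + \pi_loc v = \pi_loc (frac_add u v).
Proof. exact: loc_addE. Qed.

Lemma loc_mulA : associative loc_mul.
Proof.
by elim/locW=> x; elim/locW=> y; elim/locW=> z; rewrite !loc_mulE; apply: loc_eq => /=; ring.
Qed.
Lemma loc_mulC : commutative loc_mul.
Proof. by elim/locW=> x; elim/locW=> y; rewrite !loc_mulE; apply: loc_eq => /=; ring. Qed.
Lemma loc_mul1 : left_id loc1 loc_mul.
Proof. by elim/locW=> x; rewrite !loc_mulE; apply: loc_eq => /=; ring. Qed.
Lemma loc_mulDl : left_distributive loc_mul +%R.
Proof.
elim/locW=> x; elim/locW=> y; elim/locW=> z.
by rewrite !(loc_addrE, loc_mulE); apply: loc_eq => /=; ring.
Qed.
HB.instance Definition _ :=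
  GRing.Zmodule_isComPzRing.Build loc loc_mulA loc_mulC loc_mul1 loc_mulDl.

Lemma loc_scaleA a b x : loc_scale a (loc_scale b x) = loc_scale (a * b) x.
Proof. by elim/locW: x => x; rewrite !loc_scaleE; apply: loc_eq => /=; ring. Qed.
Lemma loc_scale1 : left_id 1 loc_scale.
Proof. by elim/locW=> x; rewrite loc_scaleE; apply: loc_eq => /=; ring. Qed.
Lemma loc_scaleDr : right_distributive loc_scale +%R.
Proof.
move=> a; elim/locW=> x; elim/locW=> y.
by rewrite !(loc_addrE, loc_scaleE); apply: loc_eq => /=; ring.
Qed.
Lemma loc_scaleDl x : {morph loc_scale^~ x : a b / a + b}.
Proof.
move=> a b; elim/locW: x => x.
by rewrite !(loc_addrE, loc_scaleE); apply: loc_eq => /=; ring.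
Qed.
HB.instance Definition _ := GRing.Zmodule_isLmodule.Build A loc
  loc_scaleA loc_scale1 loc_scaleDr loc_scaleDl.

End Localization.

Section LocalizationMap.
Variables (A : comNzRingType) (S T : mulrClosed A) (ST : {subset S <= T}).

Definition den_map (s : denominator S) : denominator T :=
  Sub (sval s) (ST (valP s)).

Definition loc_map (x : loc S) : loc T :=
  frac_of (repr x).1 (den_map (repr x).2).

Lemma loc_mapE a s : loc_map (frac_of a s) = frac_of a (den_map s).
Proof.
have /loc_eqP[t St et] : \pi_(loc S) (repr (frac_of a s)) = \pi_(loc S) (a, s).
  by rewrite reprK.
by apply/loc_eqP; exists t; rewrite ?ST.
Qed.

Lemma loc_map_is_linear : linear loc_map.
Proof.
move=> c; elim/locW=> -[a s]; elim/locW=> -[b t].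
have E u : \pi_(loc S) u = frac_of u.1 u.2 by case: u.
have Z (U : mulrClosed A) (d : A) a1 s1 :
  d *: frac_of a1 s1 = frac_of (d * a1) s1 :> loc U := loc_scaleE d (a1, s1).
have D (U : mulrClosed A) a1 s1 a2 s2 :
  frac_of a1 s1 + frac_of a2 s2 =
  frac_of (a1 * sval s2 + a2 * sval s1) (denM s1 s2) :> loc U := loc_addrE _ _.
rewrite !E /= Z D !loc_mapE Z D /frac_of.
by apply: loc_eq => /=.
Qed.

HB.instance Definition _ :=
  GRing.isLinear.Build A (loc S) (loc T) *:%R loc_map loc_map_is_linear.

End LocalizationMap.

Section Ideals.
Variable A : comPzRingType.
Implicit Types (I J P : set A) (s : seq A).

Definition is_ideal I : Prop :=
  [/\ I 0, forall a b, I a -> I b -> I (a + b) & forall a b, I b -> I (a * b)].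

Definition is_prime P : Prop :=
  [/\ is_ideal P, ~ P 1 & forall a b, P (a * b) -> P a \/ P b].

Definition ideal_of s : set A :=
  [set a | exists c : nat -> A, a = \sum_(i < size s) c i * s`_i].

Definition noetherian : Prop := forall I, is_ideal I -> exists s, I = ideal_of s.

Definition ideal_mul I J : set A :=
  [set a | exists n (b c : nat -> A),
     [/\ forall i, I (b i), forall i, J (c i) & a = \sum_(i < n) b i * c i]].

Fixpoint ideal_exp I (n : nat) : set A :=
  if n is m.+1 then ideal_mul I (ideal_exp I m) else setT.

(* Extended exponents, as sums of values of indeg may a priori be infinite.
   Exponents at most 0, including -oo, give the unit ideal; +oo gives the
   intersection of all powers. *)
Definition ideal_expe I (e : \bar int) : set A :=
  match e with
  | (Posz n)%:E%E => ideal_exp I n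
  | (Negz _)%:E%E => setT
  | +oo%E => \bigcap_n ideal_exp I n
  | -oo%E => setT
  end.

Definition prime_chain (n : nat) : Prop :=
  exists P : nat -> set A,
    (forall i, (i <= n)%N -> is_prime (P i)) /\
    (forall i, (i < n)%N -> P i `<` P i.+1).

Definition krull_dim : \bar int :=
  supremum -oo%E [set (n%:Z)%:E%E | n in prime_chain].

Definition regular_seq s : Prop :=
  ~ ideal_of s 1 /\
  forall i a, (i < size s)%N ->
    ideal_of (take i s) (s`_i * a) -> ideal_of (take i s) a.

(* Meaningful for a local ring, whose maximal ideal is the set of nonunits. *)
Definition depth : \bar int :=
  supremum -oo%E [set ((size s)%:Z)%:E%E | s in
    [set s : seq A |
       (forall a, a \in s -> forall b, a * b <> 1) /\ regular_seq s]].

End Ideals.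

Section PrimeLocalization.
Variables (A : comNzRingType) (P : set A).

Definition prime_compl of is_prime P : {pred A} := [pred a | a \notin P].

Variable primeP : is_prime P.

Lemma prime_compl_mulr_closed : mulr_closed (prime_compl primeP).
Proof.
have [_ P1 PM] := primeP; split=> [|a b]; rewrite !inE.
  by apply/negP; rewrite inE.
move=> /negP Pa /negP Pb; apply/negP; rewrite inE => /PM[] Pc.
  by apply: Pa; rewrite inE.
by apply: Pb; rewrite inE.
Qed.

HB.instance Definition _ :=
  GRing.isMulClosed.Build A (prime_compl primeP) prime_compl_mulr_closed.

Definition loc_at : comPzRingType := loc (prime_compl primeP).

End PrimeLocalization.

Definition serre (A : comNzRingType) (n : nat) : Prop :=
  forall (P : set A) (primeP : is_prime P),
    (Order.min (n%:Z)%:E (krull_dim (loc_at primeP)) <= depth (loc_at primeP))%E.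

Section DependentProduct.
Variables (A : pzRingType) (I : Type) (M : I -> lmodType A).

Definition dprod : Type := forall i, M i.
HB.instance Definition _ := gen_eqMixin dprod.
HB.instance Definition _ := gen_choiceMixin dprod.

Definition dprod_add (f g : dprod) : dprod := fun i => f i + g i.
Definition dprod_opp (f : dprod) : dprod := fun i => - f i.
Definition dprod_scale a (f : dprod) : dprod := fun i => a *: f i.

Lemma dprod_addA : associative dprod_add.
Proof. by move=> f g h; apply/functional_extensionality_dep=> i; exact: addrA. Qed.
Lemma dprod_addC : commutative dprod_add.
Proof. by move=> f g; apply/functional_extensionality_dep=> i; exact: addrC. Qed.
Lemma dprod_add0 : left_id (fun=> 0) dprod_add.
Proof. by move=> f; apply/functional_extensionality_dep=> i; exact: add0r. Qed.
Lemma dprod_addN : left_inverse (fun=> 0) dprod_opp dprod_add.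
Proof. by move=> f; apply/functional_extensionality_dep=> i; exact: addNr. Qed.
HB.instance Definition _ :=
  GRing.isZmodule.Build dprod dprod_addA dprod_addC dprod_add0 dprod_addN.

Lemma dprod_scaleA a b f : dprod_scale a (dprod_scale b f) = dprod_scale (a * b) f.
Proof. by apply/functional_extensionality_dep=> i; exact: scalerA. Qed.
Lemma dprod_scale1 : left_id 1 dprod_scale.
Proof. by move=> f; apply/functional_extensionality_dep=> i; exact: scale1r. Qed.
Lemma dprod_scaleDr : right_distributive dprod_scale +%R.
Proof. by move=> a f g; apply/functional_extensionality_dep=> i; exact: scalerDr. Qed.
Lemma dprod_scaleDl f : {morph dprod_scale^~ f : a b / a + b}.
Proof. by move=> a b; apply/functional_extensionality_dep=> i; exact: scalerDl. Qed.
HB.instance Definition _ := GRing.Zmodule_isLmodule.Build A dprod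
  dprod_scaleA dprod_scale1 dprod_scaleDr dprod_scaleDl.

End DependentProduct.

Section Cech.
Variables (A : comNzRingType) (n : nat) (x : 'I_n -> A).
Implicit Types I J : {set 'I_n}.

(* Inverting the x_i, i in I, amounts to inverting their product. *)
Definition monomials I : {pred A} :=
  [pred a | `[< exists e : 'I_n -> nat, a = \prod_(i in I) x i ^+ e i >]].

Lemma monomials_mulr_closed I : mulr_closed (monomials I).
Proof.
split=> [|a b]; rewrite !inE; first by exists (fun=> 0%N); rewrite big1.
move=> [e ->] [f ->]; exists (fun i => e i + f i)%N.
by rewrite -big_split; apply: eq_bigr => i _; rewrite exprD.
Qed.
HB.instance Definition _ I :=
  GRing.isMulClosed.Build A (monomials I) (monomials_mulr_closed I).

Lemma monomialsS I J : I \subset J -> {subset monomials I <= monomials J}.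
Proof.
move=> IJ a; rewrite !inE => -[e ->].
exists (fun i => if i \in I then e i else 0%N).
rewrite [RHS](bigID (mem I)) /= [X in _ * X]big1 ?mulr1; last first.
  by move=> i /andP[_ /negbTE ->].
apply: eq_big => [i|i ->//]; rewrite andbC.
by case: (boolP (i \in I)) => // /(fintype.subsetP IJ) ->.
Qed.

(* The direct sum over all I of A localized at the x_i, i in I; the summand of
   I sits in cohomological degree #|I|. *)
Definition cech : Type := dprod (fun I => loc (monomials I)).
HB.instance Definition _ := GRing.Lmodule.on cech.
Implicit Types c : cech.

Definition cech_diff c : cech := fun J =>
  \sum_(j in J) (-1) ^+ #|[pred i in J | (i < j)%N]| *:
     loc_map (monomialsS (subD1set J j)) (c (J :\ j)).

Lemma cech_diff_is_linear : linear cech_diff.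
Proof.
move=> a c d; apply/functional_extensionality_dep => J.
rewrite -[RHS]/(a *: cech_diff c J + cech_diff d J) /cech_diff.
rewrite scaler_sumr -big_split; apply: eq_bigr => j _ /=.
rewrite -[(a *: c + d) _]/(a *: c (J :\ j) + d (J :\ j)) linearP scalerDr.
by rewrite !scalerA mulrC.
Qed.
HB.instance Definition _ :=
  GRing.isLinear.Build A cech cech *:%R cech_diff cech_diff_is_linear.

Definition cech_deg (p : nat) : set cech :=
  [set c | forall I, #|I| != p -> c I = 0].

Variable p : nat.

Definition cocycle : {pred cech} :=
  [pred c | `[< cech_deg p c /\ cech_diff c = 0 >]].

Lemma cocycle_submod_closed : submod_closed cocycle.
Proof.
split=> [|a c d]; rewrite !inE; first by split=> //; rewrite linear0.
move=> [c0 dc] [d0 dd]; split=> [I Ip|]; last by rewrite linearP /= dc dd scaler0 addr0.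
by rewrite -[LHS]/(a *: c I + d I) c0// d0// scaler0 addr0.
Qed.
HB.instance Definition _ :=
  GRing.isSubmodClosed.Build A cech cocycle cocycle_submod_closed.

Definition cocycles : Type := {c : cech | c \in cocycle}.
HB.instance Definition _ := SubChoice.on cocycles.
HB.instance Definition _ := [SubChoice_isSubLmodule of cocycles by <:].

(* For p = 0 the condition on b forces b = 0. *)
Definition coboundary : {pred cocycles} :=
  [pred z | `[< exists2 b : cech,
      forall I, #|I|.+1 != p -> b I = 0 & val z = cech_diff b >]].

Lemma coboundary_submod_closed : submod_closed coboundary.
Proof.
split=> [|a u v]; rewrite !inE; first by exists 0; rewrite ?linear0.
move=> [b b0 ub] [c c0 vc]; exists (a *: b + c) => [I Ip|].
  by rewrite -[LHS]/(a *: b I + c I) b0// c0// scaler0 addr0.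
by rewrite linearP linearP /= ub vc.
Qed.
HB.instance Definition _ :=
  GRing.isSubmodClosed.Build A cocycles coboundary coboundary_submod_closed.

Definition cohomology : Type := Quotient.quot coboundary.
HB.instance Definition _ := GRing.Zmodule.on cohomology.

Definition coho_class (z : cocycles) : cohomology :=
  \pi_(Quotient.quot coboundary) z.

Lemma cohoW (P : cohomology -> Prop) :
  (forall z, P (coho_class z)) -> forall h, P h.
Proof. by move=> Pz h; rewrite -[h](@reprK _ (Quotient.quot coboundary)). Qed.

Lemma coho_eqP z1 z2 :
  coho_class z1 = coho_class z2 <-> z1 - z2 \in coboundary.
Proof.
by rewrite Quotient.idealrBE; split=> [/eqP|/eqP].
Qed.

Definition coho_rep (h : cohomology) : cocycles :=
  repr (h : Quotient.quot coboundary).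

Lemma coho_repK h : coho_class (coho_rep h) = h.
Proof. exact: reprK. Qed.

Lemma coho_classD z1 z2 : coho_class (z1 + z2) = coho_class z1 + coho_class z2.
Proof. exact: raddfD. Qed.

Definition coho_scale (a : A) (h : cohomology) : cohomology :=
  coho_class (a *: coho_rep h).

Lemma coho_scaleE a z : coho_scale a (coho_class z) = coho_class (a *: z).
Proof.
apply/coho_eqP; rewrite -scalerBr; apply: rpredZ.
by apply/coho_eqP; rewrite coho_repK.
Qed.

Lemma coho_scaleA a b h : coho_scale a (coho_scale b h) = coho_scale (a * b) h.
Proof. by elim/cohoW: h => z; rewrite !coho_scaleE scalerA. Qed.
Lemma coho_scale1 : left_id 1 coho_scale.
Proof. by elim/cohoW=> z; rewrite coho_scaleE scale1r. Qed.
Lemma coho_scaleDr : right_distributive coho_scale +%R.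
Proof.
move=> a; elim/cohoW=> z1; elim/cohoW=> z2.
by rewrite !coho_scaleE -!coho_classD coho_scaleE scalerDr.
Qed.
Lemma coho_scaleDl h : {morph coho_scale^~ h : a b / a + b}.
Proof.
by move=> a b; elim/cohoW: h => z; rewrite !coho_scaleE -coho_classD scalerDl.
Qed.
HB.instance Definition _ := GRing.Zmodule_isLmodule.Build A cohomology
  coho_scaleA coho_scale1 coho_scaleDr coho_scaleDl.

Lemma coho_classZ a z : coho_class (a *: z) = a *: coho_class z.
Proof. exact/esym/coho_scaleE. Qed.

End Cech.

Record gradedAlg (k : fieldType) := GradedAlg {
  galg :> comAlgType k;
  gr : nat -> set galg;
  gr_0 : forall i, gr i 0;
  gr_D : forall i a b, gr i a -> gr i b -> gr i (a + b);
  gr_Z : forall i (c : k) a, gr i a -> gr i (c *: a);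
  gr_1 : gr 0 1;
  gr_M : forall i j a b, gr i a -> gr j b -> gr (i + j)%N (a * b);
  gr_span : forall a, exists n (f : nat -> galg),
    (forall i, gr i (f i)) /\ a = \sum_(i < n) f i;
  gr_direct : forall n (f : nat -> galg), (forall i, gr i (f i)) ->
    \sum_(i < n) f i = 0 -> forall i, (i < n)%N -> f i = 0
}.
Arguments gr {k} R i a : rename.

Record standard_graded (k : fieldType) (R : gradedAlg k) : Prop := {
  std_noetherian : noetherian R;
  std_gr0 : forall a, gr R 0 a -> exists c : k, a = c%:A;
  std_gen : forall B : {pred R}, subalg_closed B ->
    (forall a, gr R 1 a -> a \in B) -> forall a, a \in B
}.

Section GradedAlgebra.
Variables (k : fieldType) (R : gradedAlg k).

Definition grz (j : int) : set R := if j is Posz i then gr R i else [set 0].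

Lemma grz_0 j : grz j 0.
Proof. by case: j => // i; exact: gr_0. Qed.

Lemma grz_M (i : nat) j a b : gr R i a -> grz j b -> grz (i%:Z + j) (a * b).
Proof.
case: j => j /=; first by move=> Ra Rb; exact: gr_M.
by move=> _ ->; rewrite mulr0; exact: grz_0.
Qed.

(* The graded maximal ideal when the degree 0 part is k. *)
Definition irrelevant : set R :=
  [set a | exists n (f : nat -> R),
     (forall i, gr R i.+1 (f i)) /\ a = \sum_(i < n) f i].

Variable d : nat.

Definition veronese_pred : {pred R} :=
  [pred a | `[< exists n (f : nat -> R),
     (forall i, gr R (i * d) (f i)) /\ a = \sum_(i < n) f i >]].

Lemma veronese_predP a : reflect (exists n (f : nat -> R),
     (forall i, gr R (i * d) (f i)) /\ a = \sum_(i < n) f i)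
  (a \in veronese_pred).
Proof. exact: asboolP. Qed.

Lemma veronese_hom i a : gr R (i * d) a -> a \in veronese_pred.
Proof.
move=> Ra; apply/veronese_predP.
exists i.+1, (fun j => if j == i then a else 0); split=> [j|].
  by case: eqP => [->|_]//; exact: gr_0.
by rewrite big_ord_recr/= eqxx big1 ?add0r// => j _; rewrite ltn_eqF.
Qed.

Lemma veronese_D a b : a \in veronese_pred -> b \in veronese_pred ->
  a + b \in veronese_pred.
Proof.
have E n m (f : nat -> R) : \sum_(i < n) f i =
    \sum_(i < n + m) if (i < n)%N then f i else 0.
  rewrite big_split_ord /= [X in _ + X]big1 ?addr0; last first.
    by move=> i _; rewrite ltnNge leq_addr.
  by apply: eq_bigr => i _; rewrite ltn_ord.
move=> /veronese_predP[n [f [Rf ->]]] /veronese_predP[m [g [Rg ->]]].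
apply/veronese_predP; exists (n + m)%N, (fun i => (if (i < n)%N then f i else 0) +
  (if (i < m)%N then g i else 0)); split=> [i|].
  by apply: gr_D; case: ifP => // _; exact: gr_0.
by rewrite big_split/= -E addnC -E.
Qed.

Lemma veronese_0 : 0 \in veronese_pred.
Proof. by apply: (veronese_hom (i := 0)); exact: gr_0. Qed.

Lemma veronese_sum (I : Type) (r : seq I) (F : I -> R) :
  (forall i, F i \in veronese_pred) -> \sum_(i <- r) F i \in veronese_pred.
Proof.
by move=> VF; elim/big_ind: _ => //; [exact: veronese_0 | exact: veronese_D].
Qed.

Lemma veronese_subalg_closed : subalg_closed veronese_pred.
Proof.
split=> [|c a b|a b].
- by apply: (veronese_hom (i := 0)); rewrite mul0n; exact: gr_1.
- move=> /veronese_predP[n [f [Rf ->]]] Vb; apply: veronese_D => //.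
  apply/veronese_predP; exists n, (fun i => c *: f i); split=> [i|].
    exact: gr_Z.
  by rewrite scaler_sumr.
- move=> /veronese_predP[n [f [Rf ->]]] /veronese_predP[m [g [Rg ->]]].
  rewrite mulr_suml; apply: veronese_sum => i; rewrite mulr_sumr.
  apply: veronese_sum => j; apply: (veronese_hom (i := i + j)).
  by rewrite mulnDl; exact: gr_M.
Qed.
HB.instance Definition _ :=
  GRing.isSubalgClosed.Build k R veronese_pred veronese_subalg_closed.

Definition veronese_type : Type := {a : R | a \in veronese_pred}.
HB.instance Definition _ := SubChoice.on veronese_type.
HB.instance Definition _ := [SubChoice_isSubAlgebra of veronese_type by <:].
HB.instance Definition _ :=
  [SubNzRing_isSubComNzRing of veronese_type by <:].

Definition veronese_gr (i : nat) : set veronese_type :=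
  [set a | gr R (i * d) (val a)].

Variable d_gt0 : (0 < d)%N.

Lemma veronese_span a : exists n (f : nat -> veronese_type),
  (forall i, veronese_gr i (f i)) /\ a = \sum_(i < n) f i.
Proof.
have /veronese_predP[n [f [Rf e]]] := valP a.
exists n, (fun i => Sub (f i) (veronese_hom (Rf i))); split=> [i|].
  exact: Rf.
by apply: val_inj; rewrite [RHS]raddf_sum.
Qed.

Lemma veronese_direct n (f : nat -> veronese_type) :
  (forall i, veronese_gr i (f i)) -> \sum_(i < n) f i = 0 ->
  forall i, (i < n)%N -> f i = 0.
Proof.
move=> Rf f0 i ltin; apply: val_inj; rewrite [RHS]raddf0.
pose g j := if (d %| j)%N then val (f (j %/ d)%N) else 0.
have -> : val (f i) = g (i * d)%N by rewrite /g dvdn_mull// mulnK.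
apply: (@gr_direct _ R (n * d)%N g); last by rewrite ltn_pmul2r.
  move=> j; rewrite /g; case: ifP => [dj|_]; last exact: gr_0.
  by rewrite -[X in gr R X](divnK dj); exact: Rf.
have := congr1 val f0; rewrite raddf_sum raddf0 /= => {2}<-.
elim: n {ltin f0} => [|n IHn]; first by rewrite mul0n !big_ord0.
rewrite mulSnr big_split_ord big_ord_recr /= IHn; congr (_ + _).
rewrite (bigD1 (Ordinal d_gt0)) //= big1 ?addr0; last first.
  move=> j j0; rewrite /g dvdn_addr ?dvdn_mull// gtnNdvd//.
  by rewrite lt0n -(inj_eq val_inj) in j0 *.
by rewrite /g addn0 dvdn_mull// mulnK.
Qed.

Definition veronese : gradedAlg k.
Proof.
apply: (@GradedAlg k veronese_type veronese_gr).
- by move=> i; exact: gr_0.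
- by move=> i a b; exact: gr_D.
- by move=> i c a; exact: gr_Z.
- by rewrite /veronese_gr mul0n; exact: gr_1.
- by move=> i j a b Ra Rb; rewrite /veronese_gr /= mulnDl; exact: gr_M.
- exact: veronese_span.
- exact: veronese_direct.
Defined.

End GradedAlgebra.
Arguments irrelevant {k} R _.
Arguments veronese {k} R {d} d_gt0.

Section GradedDual.
Variables (k : fieldType) (R : gradedAlg k) (H : lmodType R).
Variable Hgr : int -> set H.
Variable Hgr_M : forall (i : nat) j r h,
  gr R i r -> Hgr j h -> Hgr (i%:Z + j) (r *: h).

(* The direct sum over j of Hom_k(H_{-j}, k), as the k-linear forms on H that
   vanish on all but finitely many graded pieces. *)
Definition gdual_pred : {pred H -> k} :=
  [pred f : H -> k | `[<
    [/\ forall u v, f (u + v) = f u + f v,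
        forall (c : k) u, f (c%:A *: u) = c * f u &
        exists s : seq int, forall j h, j \notin s -> Hgr j h -> f h = 0] >]].

Lemma gdual_predP f : reflect
    [/\ forall u v, f (u + v) = f u + f v,
        forall (c : k) u, f (c%:A *: u) = c * f u &
        exists s : seq int, forall j h, j \notin s -> Hgr j h -> f h = 0]
  (f \in gdual_pred).
Proof. exact: asboolP. Qed.

Lemma gdual_zmod_closed : zmod_closed gdual_pred.
Proof.
split=> [|f g].
  apply/gdual_predP; split=> [u v|c u|]; last by exists [::].
    by rewrite -[RHS]/(0 + 0) addr0.
  by rewrite -[RHS]/(c * 0) mulr0.
move=> /gdual_predP[fD fZ [s sf]] /gdual_predP[gD gZ [t tg]].
have E u : (f - g) u = f u - g u by [].
apply/gdual_predP; split=> [u v|c u|].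
- by rewrite !E fD gD; ring.
- by rewrite !E fZ gZ; ring.
- exists (s ++ t) => j h; rewrite mem_cat negb_or => /andP[js jt] hj.
  by rewrite E (sf j)// (tg j)// subr0.
Qed.
HB.instance Definition _ :=
  GRing.isZmodClosed.Build (H -> k) gdual_pred gdual_zmod_closed.

Definition gdual of (forall (i : nat) j r h,
  gr R i r -> Hgr j h -> Hgr (i%:Z + j) (r *: h)) : Type :=
  {f : H -> k | f \in gdual_pred}.
Notation D := (gdual Hgr_M).
HB.instance Definition _ := SubChoice.on D.
HB.instance Definition _ := [SubChoice_isSubZmodule of D by <:].

Lemma gdual_scale_subproof (r : R) (f : D) :
  (fun h => val f (r *: h)) \in gdual_pred.
Proof.
have /gdual_predP[fD fZ [s sf]] := valP f.
apply/gdual_predP; split=> [u v|c u|].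
- by rewrite scalerDr fD.
- by rewrite scalerA mulrC -scalerA fZ.
- have f0 : val f 0 = 0 by rewrite -[X in val f X](scaler0 _ 0%:A) fZ mul0r.
  have [n [g [Rg ->]]] := gr_span r.
  exists [seq j - i%:Z | j <- s, i <- iota 0 n] => j h js hj.
  rewrite scaler_suml.
  have fS m (F : 'I_m -> H) : val f (\sum_i F i) = \sum_i val f (F i).
    by elim/big_ind2: _ => // u a v b <- <-; rewrite fD.
  rewrite fS big1// => i _; apply: (sf (i%:Z + j)); last exact: Hgr_M.
  apply: contra js => ijs; apply/allpairsP; exists (i%:Z + j, i : nat).
  by rewrite /= mem_iota ltn_ord; split=> //; rewrite addrAC subrr add0r.
Qed.

Definition gdual_scale (r : R) (f : D) : D :=
  Sub (fun h => val f (r *: h)) (gdual_scale_subproof r f).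

Lemma gdual_scaleA r s f : gdual_scale r (gdual_scale s f) = gdual_scale (r * s) f.
Proof. by apply/val_inj/funext => h /=; rewrite scalerA mulrC. Qed.
Lemma gdual_scale1 : left_id 1 gdual_scale.
Proof. by move=> f; apply/val_inj/funext => h /=; rewrite scale1r. Qed.
Lemma gdual_scaleDr : right_distributive gdual_scale +%R.
Proof. by move=> r f g; apply/val_inj/funext. Qed.
Lemma gdual_scaleDl f : {morph gdual_scale^~ f : r s / r + s}.
Proof.
move=> r s; apply/val_inj/funext => h /=; rewrite scalerDl.
by have /gdual_predP[-> _ _] := valP f.
Qed.
HB.instance Definition _ := GRing.Zmodule_isLmodule.Build R D
  gdual_scaleA gdual_scale1 gdual_scaleDr gdual_scaleDl.

Definition gdual_gr (j : int) : set D :=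
  [set f | forall i h, i != - j -> Hgr i h -> val f h = 0].

End GradedDual.

Section CechGrading.
Variables (k : fieldType) (R : gradedAlg k) (n : nat) (x : 'I_n -> R) (p : nat).

Definition loc_gr (S : mulrClosed R) (j : int) : set (loc S) :=
  [set u | exists e a s,
     [/\ gr R e (sval s), grz (j + e%:Z) a & u = frac_of a s]].

Definition coho_gr (j : int) : set (cohomology x p) :=
  [set h | exists2 z : cocycles x p,
     forall I, loc_gr j (val z I) & h = coho_class z].

Lemma coho_gr_M (i : nat) j r h :
  gr R i r -> coho_gr j h -> coho_gr (i%:Z + j) (r *: h).
Proof.
move=> Rr [z zj ->]; exists (r *: z); last by rewrite coho_classZ.
move=> I; have [e [a [s [Rs Ra E]]]] := zj I.
exists e, (r * a), s; split=> //; first by rewrite -addrA; exact: grz_M.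
by rewrite [LHS]/(r *: val z I) E; exact: loc_scaleE.
Qed.

End CechGrading.

Section Canonical.
Variables (k : fieldType) (R : gradedAlg k).

(* Forms of degree one generating the graded maximal ideal. Local cohomology is
   computed by the Cech complex on them; up to graded isomorphism it does not
   depend on their choice. *)
Definition generators : seq R :=
  xget [::] [set s : seq R | (forall a, a \in s -> gr R 1 a) /\
                     irrelevant R = ideal_of s].

Definition local_cohomology (p : nat) : lmodType R :=
  cohomology (fun i : 'I_(size generators) => generators`_i) p.

Definition dim_index : nat := `|fine (krull_dim R)|%N.

Definition canonical_module : lmodType R :=
  gdual (@coho_gr_M k R _ (fun i : 'I_(size generators) => generators`_i)
           dim_index).

Definition canonical_gr : int -> set canonical_module := @gdual_gr _ _ _ _ _.

Definition hom_gr (M : lmodType R) (Mgr : int -> set M) (j : int) :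
    set {linear M -> R^o} :=
  [set phi | forall i m, Mgr i m -> grz (i + j) (phi m)].

Definition trace (M : lmodType R) : set R :=
  [set a | exists n (phi : 'I_n -> {linear M -> R^o}) (m : 'I_n -> M),
     a = \sum_i phi i (m i)].

End Canonical.

(* [nonzero j] says that the component of degree j is nonzero. The value is
   +oo for the zero module, and -oo if the degrees are not bounded below. *)
Definition indeg (nonzero : set int) : \bar int :=
  infimum +oo%E [set j%:E%E | j in nonzero].

Section Invariants.
Variables (k : fieldType) (R : gradedAlg k).

Definition a_inv : \bar int :=
  oppe (indeg [set j | exists2 w : canonical_module R, canonical_gr j w & w <> 0]).

Definition b_inv : \bar int :=
  indeg [set j | exists2 phi, hom_gr (@canonical_gr k R) j phi &
                              exists w, phi w <> 0].

End Invariants.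

Definition ceil_div (d : nat) (z : int) : int :=
  Num.ceil (z%:~R / d%:R : rat).

(* Main.v *)
Require Import Defs.
From HB Require Import structures.
From mathcomp Require Import all_boot all_order all_algebra.
From mathcomp Require Import generic_quotient ring zify.
From mathcomp Require Import boolp classical_sets constructive_ereal.

Set Implicit Arguments.
Unset Strict Implicit.
Unset Printing Implicit Defensive.

Import Order.TTheory GRing.Theory Num.Theory.
Local Open Scope classical_set_scope.
Local Open Scope ring_scope.

(** Write A for the Veronese subalgebra R^(d), m for the irrelevant ideal of R
    and w for its canonical module.

    The canonical module of A is the Veronese part of w. Indeed A and R have
    the same dimension, since R is a finite A-module
    ([krull_dim_finite_extension]), and the local cohomology of A is the part
    of that of R in degrees divisible by d. For the latter, Cech cohomology
    depends only on the radical of the ideal generated by the chosen elements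
    ([closed_on_extend], [bound_on_extend]): a cocycle becomes a coboundary
    after multiplication by powers of the elements ([radical_torsion]), so
    adjoining an element of the radical changes nothing. The Cech complex of
    A on generators of its irrelevant ideal is the Veronese part of the
    complex of R on the same elements, and these generate m up to radical
    ([coho_compare], [canonical_veronese]).

    The lower inclusion follows by adjusting degrees. An element of degree l
    is a sum of values of homogeneous homomorphisms from w to R, by the
    choice of l. In an element of R of degree t * d at least l + d - 1, the
    d - 1 additional degrees leave room to multiply each homomorphism by a
    form that makes its degree divisible by d, after which it restricts to
    the Veronese parts ([trace_contains_gr]).

    For the upper inclusion, every homogeneous homomorphism of degree j from
    the canonical module of A to A extends to a homomorphism of degree j * d
    from w to R ([hom_extend]). So a nonzero component of the trace of A has
    degree j + i, where j * d is at least b(R) and i * d at least -a(R). The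
    extension exists because m has grade at least two: a compatible family of
    products with all forms of a given degree comes from an element of R
    ([grade_hom]). Condition (S2) gives this grade at the localization of R
    at m, provided that this localization has dimension at least two; for
    this, a chain of three primes of R is replaced by a chain of three
    homogeneous ones ending at m ([chain_in_irrelevant]). *)

(** * Gradings presented by projections *)

Lemma big_supp_eq (I : eqType) (V : nmodType) (s t : seq I) (f : I -> V) :
  uniq s -> uniq t -> (forall i, i \notin s -> f i = 0) ->
  (forall i, i \notin t -> f i = 0) -> \sum_(i <- s) f i = \sum_(i <- t) f i.
Proof.
have E (r r' : seq I) : (forall i, i \notin r' -> f i = 0) ->
    \sum_(i <- r) f i = \sum_(i <- [seq i <- r | i \in r']) f i.
  move=> off; rewrite big_filter [LHS](bigID (mem r')) /=.
  by rewrite [X in _ + X]big1 ?addr0 // => i /off.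
move=> us ut fs ft; rewrite (E s t ft) (E t s fs); apply: perm_big.
apply: uniq_perm; rewrite ?filter_uniq // => i.
by rewrite !mem_filter andbC.
Qed.

(** Gradings are presented by their projections rather than by direct sum
    decompositions. Localizations, complexes, cohomology and duals each have
    an evident candidate for the projections, and the independence of the
    graded pieces follows from them. *)
Record grading (M : zmodType) (G : int -> set M) := Grading {
  pr : int -> M -> M;
  prD : forall j u v, pr j (u + v) = pr j u + pr j v;
  pr_in : forall j u, G j (pr j u);
  pr_id : forall j u, G j u -> pr j u = u;
  pr_ne : forall i j u, G i u -> i <> j -> pr j u = 0;
  pr_fin : forall u, exists s : seq int, uniq s /\ u = \sum_(j <- s) pr j u }.

Section GradingTheory.
Variables (M : zmodType) (G : int -> set M) (D : grading G).
Implicit Types (u v : M).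

Lemma pr0 j : pr D j 0 = 0.
Proof. by apply: (addrI (pr D j 0)); rewrite -prD !addr0. Qed.

Lemma prN j u : pr D j (- u) = - pr D j u.
Proof. by apply: (addrI (pr D j u)); rewrite -prD !subrr pr0. Qed.

Lemma prB j u v : pr D j (u - v) = pr D j u - pr D j v.
Proof. by rewrite prD prN. Qed.

Lemma pr_sum I (r : seq I) (P : pred I) (F : I -> M) j :
  pr D j (\sum_(i <- r | P i) F i) = \sum_(i <- r | P i) pr D j (F i).
Proof. exact: (big_morph (pr D j) (prD D j) (pr0 j)). Qed.

Lemma gr_prE j u : G j u <-> pr D j u = u.
Proof. by split=> [/pr_id|<-]; [exact | exact: pr_in]. Qed.

Lemma gr0_mem j : G j 0. Proof. by rewrite gr_prE pr0. Qed.

Lemma grD_mem j u v : G j u -> G j v -> G j (u + v).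
Proof. by rewrite !gr_prE prD => -> ->. Qed.

Lemma gr_sum_mem I (r : seq I) (P : pred I) (F : I -> M) j :
  (forall i, P i -> G j (F i)) -> G j (\sum_(i <- r | P i) F i).
Proof.
by move=> FG; elim/big_ind: _ => //; [exact: gr0_mem | move=> ? ?; exact: grD_mem].
Qed.

Lemma pr_pr i j u : pr D i (pr D j u) = if i == j then pr D j u else 0.
Proof.
case: eqP => [->|ij]; first by rewrite pr_id //; exact: pr_in.
by apply: (pr_ne D (pr_in D j u)) => e; apply: ij.
Qed.

Lemma pr_supp s u : uniq s -> u = \sum_(j <- s) pr D j u ->
  forall j, j \notin s -> pr D j u = 0.
Proof.
move=> us uE j js; rewrite uE pr_sum big_seq big1 // => i si.
by rewrite pr_pr; case: eqP => // ji; rewrite ji si in js.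
Qed.

Definition supp u : seq int := sval (cid (pr_fin D u)).

Lemma supp_uniq u : uniq (supp u).
Proof. by rewrite /supp; case: cid => s []. Qed.

Lemma suppE u : u = \sum_(j <- supp u) pr D j u.
Proof. by rewrite /supp; case: cid => s []. Qed.

Lemma notin_supp u j : j \notin supp u -> pr D j u = 0.
Proof. exact: (pr_supp (supp_uniq u) (suppE u)). Qed.

Lemma pr_sumE s u : uniq s -> (forall j, j \notin s -> pr D j u = 0) ->
  u = \sum_(j <- s) pr D j u.
Proof.
move=> us us0; rewrite {1}(suppE u); apply: big_supp_eq => //.
  exact: supp_uniq.
exact: notin_supp.
Qed.

Lemma grading_ind (P : M -> Prop) : P 0 ->
  (forall u v, P u -> P v -> P (u + v)) -> (forall j u, G j u -> P u) ->
  forall u, P u.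
Proof.
move=> P0 PD PG u; rewrite (suppE u); elim/big_ind: _ => // j _.
exact: PG (pr_in D j u).
Qed.

Lemma pr_inj u v : (forall j, pr D j u = pr D j v) -> u = v.
Proof.
move=> e; apply/eqP; rewrite -subr_eq0 (suppE (u - v)) big1 // => j _.
by rewrite prB e subrr.
Qed.

Section Total.
Variables (N : zmodType) (F : int -> M -> N).
Hypothesis FD : forall j u v, F j (u + v) = F j u + F j v.

(** The additive map glued from the restrictions of the maps F j to the pieces
    of degree j. *)
Definition glue u : N := \sum_(j <- supp u) F j (pr D j u).

Let F0 j : F j 0 = 0.
Proof. by apply: (addrI (F j 0)); rewrite -FD !addr0. Qed.

Lemma glueE s u : uniq s -> (forall j, j \notin s -> pr D j u = 0) ->
  glue u = \sum_(j <- s) F j (pr D j u).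
Proof.
move=> us us0; apply: big_supp_eq => //; first exact: supp_uniq.
  by move=> j /notin_supp ->.
by move=> j /us0 ->.
Qed.

Lemma glueD u v : glue (u + v) = glue u + glue v.
Proof.
pose s := undup (supp u ++ supp v).
have us : uniq s by exact: undup_uniq.
have s0 j : j \notin s -> pr D j u = 0 /\ pr D j v = 0.
  by rewrite mem_undup mem_cat negb_or => /andP[/notin_supp -> /notin_supp ->].
rewrite !(glueE us) => [|j /s0[]//|j /s0[]//|j /s0[uj vj]].
  by rewrite -big_split; apply: eq_bigr => j _; rewrite prD FD.
by rewrite prD uj vj addr0.
Qed.

Lemma glue_hom j u : G j u -> glue u = F j u.
Proof.
move=> Gu; rewrite (@glueE [:: j]) ?big_seq1 ?pr_id // => i.
by rewrite inE => /eqP ij; apply: (pr_ne D Gu) => ji; apply: ij.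
Qed.

End Total.

End GradingTheory.

(** Injectivity of f keeps distinct degrees apart. For the inclusion of a
    Veronese subalgebra, f is the multiplication by d. *)
Lemma pr_graded_map (M : zmodType) (G : int -> set M) (D : grading G)
    (N : zmodType) (G' : int -> set N) (D' : grading G')
    (T : M -> N) (f : int -> int) : injective f ->
  (forall u v, T (u + v) = T u + T v) ->
  (forall j u, G j u -> G' (f j) (T u)) ->
  forall j u, pr D' (f j) (T u) = T (pr D j u).
Proof.
move=> increasing_inj TD TG j.
have T0 : T 0 = 0 by apply: (addrI (T 0)); rewrite -TD !addr0.
apply: (grading_ind D) => [|u v IHu IHv|i u Gu]; first by rewrite pr0 T0 pr0.
  by rewrite TD !prD IHu IHv TD.
have [ij|/eqP ij] := eqVneq i j.
  by rewrite -ij !pr_id //; exact: TG.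
by rewrite (pr_ne D Gu) // (pr_ne D' (TG _ _ Gu)) ?T0 // => /increasing_inj.
Qed.

Lemma pr_shift (M : zmodType) (G : int -> set M) (D : grading G)
    (T : M -> M) (i : int) :
  (forall u v, T (u + v) = T u + T v) ->
  (forall j u, G j u -> G (i + j) (T u)) ->
  forall j u, pr D (i + j) (T u) = T (pr D j u).
Proof. by apply: pr_graded_map => j l; exact: addrI. Qed.

(** * Homogeneous components of a graded algebra *)

Section RingGrading.
Variables (k : fieldType) (R : gradedAlg k).
Implicit Types (a b : R).

Lemma gr_N i a : gr R i a -> gr R i (- a).
Proof. by move=> Ra; rewrite -scaleN1r; exact: gr_Z. Qed.

Lemma gr_C (c : k) : gr R 0 c%:A.
Proof. by apply: gr_Z; exact: gr_1. Qed.

Lemma gr_X i m a : gr R i a -> gr R (m * i) (a ^+ m).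
Proof.
move=> Ra; elim: m => [|m IHm]; first by rewrite expr0; exact: gr_1.
by rewrite exprS mulSn; exact: gr_M.
Qed.

Definition is_decomposition a (f : nat -> R) : Prop :=
  (forall i, gr R i (f i)) /\
  exists n, a = \sum_(i < n) f i /\ forall i, (n <= i)%N -> f i = 0.

Lemma decomposition_ex a : exists f, is_decomposition a f.
Proof.
have [n [f [Rf ->]]] := gr_span a.
exists (fun i => if (i < n)%N then f i else 0); split=> [i|].
  by case: ifP => // _; exact: gr_0.
exists n; split=> [|i]; last by rewrite leqNgt => /negbTE ->.
by apply: eq_bigr => i _; rewrite ltn_ord.
Qed.

Lemma decomposition_widen a (f : nat -> R) n m : a = \sum_(i < n) f i ->
  (forall i, (n <= i)%N -> f i = 0) -> (n <= m)%N -> a = \sum_(i < m) f i :> R.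
Proof.
move=> -> fn nm; rewrite -(subnKC nm) big_split_ord /= [X in _ + X]big1 ?addr0 //.
by move=> i _; rewrite fn // leq_addr.
Qed.

Lemma decomposition_uniq a f g :
  is_decomposition a f -> is_decomposition a g -> f = g.
Proof.
move=> [Rf [n [an fn]]] [Rg [m [am gm]]]; apply/funext => i.
apply/eqP; rewrite -subr_eq0; apply/eqP.
pose N := (n + m + i.+1)%N.
have nN : (n <= N)%N by rewrite /N -addnA leq_addr.
have mN : (m <= N)%N by rewrite /N addnAC leq_addl.
apply: (@gr_direct _ R N (fun i => f i - g i)).
- by move=> j; apply: gr_D => //; exact: gr_N.
- rewrite big_split /= sumrN -(decomposition_widen an fn nN).
  by rewrite -(decomposition_widen am gm mN) subrr.
- by rewrite /N addnS ltnS leq_addl.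
Qed.

Definition hcomp i a : R := sval (cid (decomposition_ex a)) i.

Lemma hcompP a : is_decomposition a (hcomp ^~ a).
Proof. by rewrite /hcomp; case: cid. Qed.

Lemma hcomp_uniq a f : is_decomposition a f -> forall i, hcomp i a = f i.
Proof. by move=> af i; rewrite -(decomposition_uniq (hcompP a) af). Qed.

Lemma hcomp_in i a : gr R i (hcomp i a). Proof. by have [] := hcompP a. Qed.

Lemma hcompD i a b : hcomp i (a + b) = hcomp i a + hcomp i b.
Proof.
have [Ra [n [an fn]]] := hcompP a; have [Rb [m [bm gm]]] := hcompP b.
apply: (hcomp_uniq (f := fun i => hcomp i a + hcomp i b)); split=> [j|]; first exact: gr_D.
exists (n + m)%N; split=> [|j nmj].
  rewrite big_split /= -(decomposition_widen an fn) ?leq_addr //.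
  by rewrite -(decomposition_widen bm gm) ?leq_addl.
rewrite fn ?gm ?addr0 //; first exact: leq_trans (leq_addl _ _) nmj.
exact: leq_trans (leq_addr _ _) nmj.
Qed.

Lemma hcomp_hom i j a : gr R i a -> hcomp j a = if j == i then a else 0.
Proof.
move=> Ra; apply: (hcomp_uniq (f := fun j => if j == i then a else 0)); split=> [l|].
  by case: eqP => [->|_]//; exact: gr_0.
exists i.+1; split=> [|l]; last by rewrite ltnNge; case: eqP => // ->; rewrite leqnn.
by rewrite big_ord_recr /= eqxx big1 ?add0r // => l _; rewrite ltn_eqF.
Qed.

(** Integer degrees are needed because homomorphisms may lower degrees. *)
Definition hcompz (j : int) a : R := if j is Posz i then hcomp i a else 0.

Lemma hcomp_sumE a : exists n, forall m, (n <= m)%N -> a = \sum_(i < m) hcomp i a.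
Proof.
have [_ [n [an n0]]] := hcompP a; exists n => m nm.
exact: decomposition_widen an n0 nm.
Qed.

Definition ring_grading : grading (@grz k R).
Proof.
apply: (@Grading _ _ hcompz) => [[j|j] a b|[j|j] a|[j|j] a|[i|i] [j|j] a|a] //=.
- exact: hcompD.
- by rewrite addr0.
- exact: hcomp_in.
- by move=> /hcomp_hom ->; rewrite eqxx.
- by move=> Ra ij; rewrite (hcomp_hom _ Ra); case: eqP => // ji; rewrite ji in ij.
- by move=> -> _; rewrite (hcomp_hom (i := j)) ?eqxx //; exact: gr_0.
- have [n an] := hcomp_sumE a; exists [seq Posz i | i <- iota 0 n].
  split; first by rewrite map_inj_uniq ?iota_uniq // => i j [].
  rewrite big_map /= {1}(an n (leqnn n)) -(big_mkord xpredT (hcomp ^~ a)).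
  by rewrite /index_iota subn0.
Defined.

Section GradedModule.
Variables (M : lmodType R) (G : int -> set M) (D : grading G).
Hypothesis G_M : forall (i : nat) j r u, gr R i r -> G j u -> G (i%:Z + j) (r *: u).

Lemma pr_scale i r j u : gr R i r -> pr D (i%:Z + j) (r *: u) = r *: pr D j u.
Proof.
move=> Rr; apply: (pr_shift D (T := fun u => r *: u)) => [v w|l v].
  exact: scalerDr.
exact: G_M.
Qed.

Lemma pr_scaleA (c : k) j u : pr D j (c%:A *: u) = c%:A *: pr D j u.
Proof. by rewrite -[j in LHS]add0r (pr_scale (i := 0)) //; exact: gr_C. Qed.

End GradedModule.

Lemma hcompz_M i a j b : gr R i a -> hcompz (i%:Z + j) (a * b) = a * hcompz j b.
Proof.
move=> Ra; apply: (pr_shift ring_grading (T := fun u => a * u)) => [v w|l v].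
  exact: mulrDr.
exact: grz_M.
Qed.

Lemma hcomp_M i a j b : gr R i a -> hcomp (i + j) (a * b) = a * hcomp j b.
Proof. exact: (hcompz_M (Posz j) b). Qed.

End RingGrading.

(** * Suprema of sets of natural numbers *)

Section Suprema.
Variables (T : Type) (f : T -> nat) (X : set T).

Let s : \bar int := supremum -oo%E [set ((f t)%:Z)%:E%E | t in X].

(** A bounded set of natural numbers has a maximum, and an unbounded one has
    supremum +oo. Hence the default value in the definition of suprema is only
    reached for the empty set. *)
Lemma sup_natP : supremums [set ((f t)%:Z)%:E%E | t in X] !=set0 \/ X = set0.
Proof.
have [->|/set0P[t0 Xt0]] := eqVneq X set0; first by right.
left; have [[N HN]|noN] := pselect (exists N, forall t, X t -> (f t <= N)%N).
  have exf : exists i, `[< exists2 t, X t & f t = i >].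
    by exists (f t0); apply/asboolP; exists t0.
  have bdf i : `[< exists2 t, X t & f t = i >] -> (i <= N)%N.
    by move=> /asboolP[t Xt <-]; exact: HN.
  case: (ex_maxnP exf bdf) => i /asboolP[t Xt <-] tmax.
  exists ((f t)%:Z)%:E%E; split=> [y [u Xu <-]|y ub]; last by apply: ub; exists t.
  by rewrite lee_fin lez_nat; apply: tmax; apply/asboolP; exists u.
exists +oo%E; split=> [y _|[y||] ub]; rewrite ?leey //.
  exfalso; apply: noN; exists `|y|%N => t Xt.
  have /= : (((f t)%:Z)%:E <= y%:E)%E by apply: ub; exists t.
  by rewrite lee_fin => /le_trans/(_ (lez_abs y)); rewrite lez_nat.
by have := ub _ (imageP _ Xt0).
Qed.

Lemma sup_nat_ge t : X t -> (((f t)%:Z)%:E <= s)%E.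
Proof.
move=> Xt; have [sup0|X0] := sup_natP; last by rewrite X0 in Xt.
by apply: ge_supremum_Nmem => //; exists t.
Qed.

Lemma sup_nat_le (m : nat) : ((m%:Z)%:E <= s)%E -> exists2 t, X t & (m <= f t)%N.
Proof.
have [[t Xt mt]|noX] := pselect (exists2 t, X t & (m <= f t)%N); first by exists t.
have [sup0|X0] := sup_natP; last by rewrite /s X0 image_set0 supremum0.
rewrite /s /supremum; case: eqP => // _; case: xgetP => // y yE [_ lby].
have : (y <= (m%:Z - 1)%:E)%E.
  apply: lby => z [t Xt <-]; rewrite lee_fin lerBrDr -PoszD lez_nat addn1.
  by rewrite ltnNge; apply/negP => mt; apply: noX; exists t.
move=> /[swap] /le_trans/[apply]; rewrite lee_fin lerBrDr gerDl.
by [].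
Qed.

End Suprema.

(** * Prime ideals in finite extensions *)

Section IdealTheory.
Variable A : comNzRingType.
Implicit Types (I P Q : set A) (a b : A).

Lemma ideal_0 I : is_ideal I -> I 0. Proof. by case. Qed.

Lemma ideal_D I a b : is_ideal I -> I a -> I b -> I (a + b).
Proof. by case=> _ + _; apply. Qed.

Lemma ideal_Ml I a b : is_ideal I -> I b -> I (a * b).
Proof. by case=> _ _; apply. Qed.

Lemma ideal_Mr I a b : is_ideal I -> I a -> I (a * b).
Proof. by rewrite mulrC => idI; exact: ideal_Ml. Qed.

Lemma ideal_N I a : is_ideal I -> I a -> I (- a).
Proof. by rewrite -mulN1r => idI; exact: ideal_Ml. Qed.

Lemma ideal_B I a b : is_ideal I -> I a -> I b -> I (a - b).
Proof. by move=> idI Ia Ib; apply: ideal_D => //; exact: ideal_N. Qed.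

Lemma ideal_sum I (T : Type) (r : seq T) (p : pred T) (F : T -> A) :
  is_ideal I -> (forall i, p i -> I (F i)) -> I (\sum_(i <- r | p i) F i).
Proof.
move=> idI IF; elim/big_ind: _ => //; first exact: ideal_0.
by move=> a b; exact: ideal_D.
Qed.

Lemma ideal_subr I a b : is_ideal I -> I b -> I (a - b) -> I a.
Proof. by move=> idI Ib Iab; rewrite -(subrK b a); exact: ideal_D. Qed.

Lemma prime_ideal P : is_prime P -> is_ideal P. Proof. by case. Qed.

Lemma prime_M P a b : is_prime P -> P (a * b) -> P a \/ P b.
Proof. by case=> _ _; apply. Qed.

Lemma prime_X P a n : is_prime P -> P (a ^+ n) -> P a.
Proof.
move=> primeP; elim: n => [|n IHn]; first by case: primeP => _ P1 _ /P1.
by rewrite exprS => /(prime_M primeP)[|/IHn].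
Qed.

Lemma zero_ideal : is_ideal [set (0 : A)].
Proof. by split=> // [a b -> ->|a b ->]; rewrite ?addr0 ?mulr0. Qed.

(** An ideal that is maximal among those containing I and avoiding S is prime:
    adjoining a to it, or b, reaches S, and the product of the two elements of
    S so obtained would lie in the ideal if a * b did. The ideals compared are
    written I `|` J so that the empty chain has an upper bound. *)
Lemma prime_avoiding I (S : set A) : is_ideal I -> S 1 ->
  (forall a b, S a -> S b -> S (a * b)) -> (forall a, I a -> ~ S a) ->
  exists P, [/\ is_prime P, I `<=` P & forall a, P a -> ~ S a].
Proof.
move=> idI S1 SM IS.
pose good J := is_ideal (I `|` J) /\ forall a, (I `|` J) a -> ~ S a.
have [F FP Ftot|P [[idP PS] Pmax]] := @Zorn_bigcup A good.
  have [->|/set0P[J0 FJ0]] := eqVneq F set0.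
    by rewrite bigcup_set0 /good setU0; split.
  split; last by move=> a [/IS//|[J FJ Ja]]; apply: (FP J FJ).2; right.
  split=> [|a b Ia Ib|a b].
  - by left; exact: ideal_0.
  - have lift c : (I `|` \bigcup_(X in F) X) c -> exists2 J, F J & (I `|` J) c.
      by move=> [Ic|[J FJ Jc]]; [exists J0 => //; left | exists J => //; right].
    have [J FJ Ja] := lift _ Ia; have [K FK Kb] := lift _ Ib.
    have up L L' c : L `<=` L' -> (I `|` L) c -> (I `|` L') c.
      by move=> sub [|/sub]; [left | right].
    have back L c : F L -> (I `|` L) c -> (I `|` \bigcup_(X in F) X) c.
      by move=> FL [Ic|Lc]; [left | right; exists L].
    have [JK|KJ] := Ftot J K FJ FK.
      by apply: (back K) => //; apply: ideal_D (FP K FK).1 _ Kb; exact: up Ja.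
    by apply: (back J) => //; apply: ideal_D (FP J FJ).1 Ja _; exact: up Kb.
  - move=> [Ib|[J FJ Jb]]; first by left; exact: ideal_Ml.
    have [|Iab|Jab] := ideal_Ml (b := b) a (FP J FJ).1.
    + by right.
    + by left.
    + by right; exists J.
pose M := I `|` P; have IM : I `<=` M by move=> a Ia; left.
have maxM J : is_ideal J -> M `<=` J -> ~ J `<=` M -> exists2 a, J a & S a.
  move=> idJ MJ JM; apply: contrapT => noS; apply: (Pmax J).
    split; last by move=> JP; apply: JM => a /JP; right.
    by move=> a Pa; apply: MJ; right.
  rewrite /good (_ : I `|` J = J); last by apply/seteqP; split=> [a [/IM/MJ|]|a]//; right.
  by split=> // a Ja Sa; apply: noS; exists a.
exists M; split=> //; split=> //; first by move=> /PS.
move=> a b Mab; apply: contrapT => /not_orP[Ma Mb].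
have gen c : ~ M c -> exists m r, M m /\ S (m + r * c).
  move=> Mc; have [||//|_ [m [r [Mm ->]]]] :=
      maxM [set e | exists m r, M m /\ e = m + r * c].
  - split=> [|_ _ [m [r [Mm ->]]] [m' [r' [Mm' ->]]]|u _ [m [r [Mm ->]]]].
    + by exists 0, 0; rewrite mul0r addr0; split=> //; exact: ideal_0.
    + exists (m + m'), (r + r'); split; first exact: ideal_D.
      by ring.
    + exists (u * m), (u * r); split; first exact: ideal_Ml.
      by ring.
  - by move=> m Mm; exists m, 0; rewrite mul0r addr0.
  - move=> sub; apply: Mc; apply: sub; exists 0, 1; rewrite add0r mul1r.
    by split=> //; exact: ideal_0.
  by exists m, r.
have [m [r [Mm Sm]]] := gen a Ma; have [m' [r' [Mm' Sm']]] := gen b Mb.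
apply: (PS _ _ (SM _ _ Sm Sm')); rewrite -/(M _).
rewrite (_ : (m + r * a) * (m' + r' * b) =
  (m' + r' * b) * m + (r * a * m' + (r * r') * (a * b))); last by ring.
apply: ideal_D => //; first exact: ideal_Ml.
by apply: ideal_D => //; exact: ideal_Ml.
Qed.

Lemma det_congr I n (M N : 'M[A]_n) : is_ideal I ->
  (forall i j, I (M i j - N i j)) -> I (\det M - \det N).
Proof.
move=> idI MN; rewrite /determinant -sumrB; apply: ideal_sum => // s _.
rewrite -mulrBr; apply: ideal_Ml => //.
elim/big_ind2: _ => [|a b c e ab ce|i _]; [by rewrite subrr; exact: ideal_0| |exact: MN].
rewrite (_ : _ - _ = e * (b - a) + a * (e - c)); last by ring.
by apply: ideal_D => //; exact: ideal_Ml.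
Qed.

(** Cramer's rule: combine the relations with the coefficients of the adjugate
    matrix. *)
Lemma det_annihilates I n (N : 'M[A]_n) (e : 'I_n -> A) : is_ideal I ->
  (forall i, I (\sum_j N i j * e j)) -> forall l, I (\det N * e l).
Proof.
move=> idI Ne l.
have -> : \det N * e l = \sum_i (\adj N) l i * \sum_j N i j * e j.
  under eq_bigr do rewrite mulr_sumr.
  rewrite exchange_big /=; transitivity (\sum_j (\adj N *m N) l j * e j).
    rewrite mul_adj_mx (bigD1 l) //= mxE eqxx mulr1n big1 ?addr0 // => j jl.
    by rewrite mxE eq_sym (negbTE jl) mulr0n mul0r.
  apply: eq_bigr => j _; rewrite mxE mulr_suml.
  by apply: eq_bigr => i _; rewrite mulrA.
by apply: ideal_sum => // i _; exact: ideal_Ml.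
Qed.

End IdealTheory.

Section FiniteExtension.
Variables (C B : comNzRingType) (ev : {rmorphism C -> B}) (n : nat) (e : 'I_n -> B).

(** The ideal I is a parameter because finiteness over k[f] will only hold in
    a quotient of the graded algebra. *)
Definition generates_mod (I : set B) :=
  forall b, exists c : 'I_n -> C, I (b - \sum_i ev (c i) * e i).

Lemma generates_modS (I J : set B) :
  I `<=` J -> generates_mod I -> generates_mod J.
Proof. by move=> IJ gI b; have [c /IJ] := gI b; exists c. Qed.

Lemma generates_one (I : set B) w : is_ideal I -> generates_mod I ->
  (forall l, I (w * e l)) -> I w.
Proof.
move=> idI gI we; have [c Ic] := gI 1; rewrite -[w]mulr1.
apply: (ideal_subr idI (b := w * \sum_i ev (c i) * e i)).
  by rewrite mulr_sumr; apply: ideal_sum => // i _; rewrite mulrCA; exact: ideal_Ml.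
by rewrite -mulrBr; exact: ideal_Ml.
Qed.

(** Cayley-Hamilton, for the matrix of the multiplication by s. *)
Lemma integral_mod (I : set B) s : is_ideal I -> generates_mod I ->
  exists2 q : {poly C}, q \is monic & I (map_poly ev q).[s].
Proof.
move=> idI gI; have [c Hc] := choice (fun l => gI (s * e l)).
pose M : 'M[C]_n := \matrix_(l, j) c l j.
exists (char_poly M); first exact: char_poly_monic.
rewrite map_char_poly /= -[_.[s]]/(horner_eval s _) /char_poly -det_map_mx.
apply: generates_one (gI) _ => //; apply: det_annihilates => // l.
rewrite (_ : \sum_j _ = s * e l - \sum_j ev (c l j) * e j) //.
rewrite (_ : s * e l = \sum_j (s *+ (l == j)) * e j); last first.
  rewrite (bigD1 l) //= eqxx mulr1n big1 ?addr0 // => j jl.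
  by rewrite eq_sym (negbTE jl) mulr0n mul0r.
rewrite -sumrB; apply: eq_bigr => j _; rewrite -mulrBl; congr (_ * _).
rewrite mxE /char_poly_mx !mxE -[LHS]/((_ - _).[s]) hornerD hornerN hornerC; congr (_ - _).
by rewrite hornerMn hornerX.
Qed.

(** Take a monic relation satisfied by y modulo P. While its constant
    coefficient lies in P the relation can be divided by y, which is not in
    the prime P. Once it does not, this coefficient is the required element:
    it lies in P', because y does. *)
Lemma incomparable (P P' : set B) y : is_prime P -> is_ideal P' -> P `<=` P' ->
  generates_mod P -> P' y -> ~ P y -> exists2 c, P' (ev c) & ~ P (ev c).
Proof.
move=> primeP idP' PP' gP P'y Py; have idP := prime_ideal primeP.
have [q] := integral_mod y idP gP.
elim/poly_ind: q => [|q c IHq].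
  by rewrite monicE lead_coef0 eq_sym oner_eq0.
have [->|q0] := eqVneq q 0.
  rewrite mul0r add0r monicE lead_coefC => /eqP ->.
  by rewrite map_polyC /= rmorph1 hornerC; case: primeP.
rewrite monicE lead_coefDl; last first.
  by rewrite size_polyC size_mulX //; case: eqP => //; rewrite ltnS size_poly_gt0.
rewrite lead_coefMX -monicE => /IHq{}IHq.
rewrite rmorphD rmorphM /= map_polyX map_polyC /= hornerD hornerMX hornerC => Pq.
have [Pc|Pc] := pselect (P (ev c)).
  have : P ((map_poly ev q).[y] * y) by rewrite -[X in P X](addrK (ev c)); exact: ideal_B.
  by move=> /(prime_M primeP)[/IHq|/Py].
exists c => //; rewrite -[ev c](addKr ((map_poly ev q).[y] * y)).
by apply: ideal_D (PP' _ Pq) => //; apply: ideal_N => //; exact: ideal_Ml.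
Qed.

(** The elements of B that act on the generators, modulo I, through a matrix
    with entries in Q form an ideal J, which contains I and the image of Q. By
    Cayley-Hamilton an element of C that falls into J has a power in Q. So J
    avoids the complement of Q, and a prime over J that avoids it too is the
    required one. *)
Lemma going_up (I : set B) (Q : set C) : is_ideal I -> is_prime Q ->
  (forall c, I (ev c) -> Q c) -> generates_mod I ->
  exists P, [/\ is_prime P, I `<=` P & forall c, P (ev c) <-> Q c].
Proof.
move=> idI primeQ IQ gI; have idQ := prime_ideal primeQ.
pose J : set B := [set w | exists2 M : 'M[C]_n, (forall l j, Q (M l j)) &
  forall l, I (w * e l - \sum_j ev (M l j) * e j)].
have idJ : is_ideal J.
  split=> [|u v [M QM Iu] [N QN Iv]|r u [M QM Iu]].
  - exists 0 => [l j|l]; first by rewrite mxE; exact: ideal_0.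
    rewrite mul0r big1 ?subrr; first exact: ideal_0.
    by move=> j _; rewrite mxE rmorph0 mul0r.
  - exists (M + N) => [l j|l]; first by rewrite mxE; exact: ideal_D.
    rewrite (_ : _ - _ = (u * e l - \sum_j ev (M l j) * e j) +
      (v * e l - \sum_j ev (N l j) * e j)); first exact: ideal_D.
    rewrite addrACA -opprD -big_split mulrDl; congr (_ - _).
    by apply: eq_bigr => j _; rewrite mxE rmorphD mulrDl.
  - have [c Hc] := choice (fun l => gI (r * e l)).
    exists (M *m \matrix_(l, j) c l j) => [l j|l].
      by rewrite mxE; apply: ideal_sum => // i _; exact: ideal_Mr.
    have E : \sum_i ev (M l i) * (r * e i - \sum_j ev (c i j) * e j) =
        r * (\sum_j ev (M l j) * e j) -
        \sum_j ev ((M *m \matrix_(l, j) c l j) l j) * e j.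
      transitivity (\sum_i (r * (ev (M l i) * e i) -
                            \sum_j ev (M l i) * (ev (c i j) * e j))).
        by apply: eq_bigr => i _; rewrite mulrBr mulrCA mulr_sumr.
      rewrite sumrB -mulr_sumr exchange_big; congr (_ - _); apply: eq_bigr => j _.
      rewrite mxE rmorph_sum mulr_suml; apply: eq_bigr => i _.
      by rewrite mxE rmorphM mulrA.
    rewrite (_ : _ - _ = r * (u * e l - \sum_j ev (M l j) * e j) +
      \sum_i ev (M l i) * (r * e i - \sum_j ev (c i j) * e j)).
      apply: ideal_D => //; first exact: ideal_Ml.
      by apply: ideal_sum => // i _; exact: ideal_Ml.
    by rewrite E; ring.
have IJ : I `<=` J.
  move=> w Iw; exists 0 => [l j|l]; first by rewrite mxE; exact: ideal_0.
  rewrite big1 ?subr0; first exact: ideal_Mr.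
  by move=> j _; rewrite mxE rmorph0 mul0r.
have QJ c : Q c -> J (ev c).
  move=> Qc; exists c%:M => [l j|l].
    by rewrite mxE; case: eqP => _; rewrite ?mulr1n ?mulr0n //; exact: ideal_0.
  rewrite (bigD1 l) //= mxE eqxx mulr1n big1 ?addr0 ?subrr; first exact: ideal_0.
  by move=> j jl; rewrite mxE eq_sym (negbTE jl) mulr0n rmorph0 mul0r.
have JQ c : J (ev c) -> Q c.
  move=> [M QM Ic]; apply: (prime_X (n := n) primeQ).
  have : Q (\det (c%:M - M)).
    apply: IQ; apply: (generates_one idI gI); rewrite -det_map_mx.
    apply: det_annihilates => // l.
    rewrite (_ : \sum_j _ = ev c * e l - \sum_j ev (M l j) * e j) //.
    rewrite (_ : ev c * e l = \sum_j (ev c *+ (l == j)) * e j); last first.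
      rewrite (bigD1 l) //= eqxx mulr1n big1 ?addr0 // => j jl.
      by rewrite eq_sym (negbTE jl) mulr0n mul0r.
    rewrite -sumrB; apply: eq_bigr => j _; rewrite -mulrBl; congr (_ * _).
    by rewrite !mxE rmorphB rmorphMn.
  rewrite -det_scalar => Qdet.
  apply: (ideal_subr idQ Qdet).
  apply: det_congr => // i j; rewrite !mxE opprB addrC subrK.
  exact: QM.
have IP c : J c -> ~ [set ev c | c in ~` Q] c.
  by move=> Jc [c' Qc' ec]; apply: Qc'; apply: JQ; rewrite ec.
have [||P [primeP JP PS]] := prime_avoiding idJ _ _ IP.
- by exists 1; rewrite ?rmorph1 //; case: primeQ.
- move=> u v [c Qc <-] [c' Qc' <-]; exists (c * c'); rewrite ?rmorphM //.
  by move=> /(prime_M primeQ)[].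
exists P; split=> // [w /IJ/JP//|c]; split=> [Pc|/QJ/JP//].
by apply: contrapT => Qc; apply: (PS _ Pc); exists c.
Qed.

End FiniteExtension.

Lemma prime_preimage (C B : comNzRingType) (ev : {rmorphism C -> B}) (P : set B) :
  is_prime P -> is_prime (ev @^-1` P).
Proof.
move=> primeP; have idP := prime_ideal primeP; split=> [||a b /=].
- split=> [|a b|a b] /=; rewrite ?rmorph0 ?rmorphD ?rmorphM.
  + exact: ideal_0.
  + exact: ideal_D.
  + exact: ideal_Ml.
- by rewrite /= rmorph1; case: primeP.
- by rewrite rmorphM; exact: prime_M.
Qed.

(** Chains of C lift by going up, starting from the zero ideal of B; chains of
    B contract to strict chains by incomparability. *)
Lemma krull_dim_finite_extension (C B : comNzRingType) (ev : {rmorphism C -> B})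
    (n : nat) (e : 'I_n -> B) :
  injective ev -> generates_mod ev e [set 0] -> krull_dim C = krull_dim B.
Proof.
move=> ev_inj gen0; congr (supremum _ _); congr image.
apply/funext => m; apply/propext; split=> [[Q [primeQ ltQ]]|[P [primeP ltP]]].
- suff [P [HP ltP]] : exists P : nat -> set B, (forall i, (i <= m)%N -> is_prime (P i) /\
      forall c, P i (ev c) <-> Q i c) /\ forall i, (i < m)%N -> P i `<` P i.+1.
    by exists P; split=> // i /HP[].
  elim: m primeQ ltQ => [|m IHm] primeQ ltQ.
    have [|P [primeP _ PQ]] := going_up (@zero_ideal B) (primeQ 0%N (leqnn _)) _ gen0.
      move=> c /= /eqP; rewrite -(rmorph0 ev) (inj_eq ev_inj) => /eqP ->.
      exact: ideal_0 (prime_ideal (primeQ 0%N (leqnn _))).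
    by exists (fun=> P); split=> // i; rewrite leqn0 => /eqP ->.
  have [||P [HP ltP]] := IHm.
  - by move=> i im; apply: primeQ; exact: leqW.
  - by move=> i im; apply: ltQ; exact: ltnW.
  have [primeP PQ] := HP m (leqnn m).
  have gP : generates_mod ev e (P m).
    by apply: generates_modS gen0 => _ ->; apply: ideal_0; exact: prime_ideal.
  have [|P' [primeP' PP' PQ']] :=
      going_up (prime_ideal primeP) (primeQ m.+1 (leqnn _)) _ gP.
    by move=> c /PQ; apply: (ltQ m (ltnSn m)).1.
  exists (fun i => if (i <= m)%N then P i else P'); split=> i im /=.
    have [im'|mi] := leqP i m; first exact: HP.
    by have -> : i = m.+1 by apply/eqP; rewrite eqn_leq im mi.
  have [im'|mi] := ltnP i m; first by rewrite ltnW //; exact: ltP.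
  have -> : i = m by apply/eqP; rewrite eqn_leq mi -ltnS im.
  rewrite leqnn; split=> // P'P; have [_ QQ] := ltQ m (ltnSn m).
  by apply: QQ => c /PQ'/P'P/PQ.
- exists (fun i => ev @^-1` P i); split=> [i im|i im].
    by apply: prime_preimage; exact: primeP.
  have [PP' P'P] := ltP i im; split; first by move=> c; exact: PP'.
  move=> sub; apply: P'P => y P'y; apply: contrapT => Py.
  have idP : is_prime (P i) by apply: primeP; exact: ltnW.
  have gP : generates_mod ev e (P i).
    by apply: generates_modS gen0 => _ ->; apply: ideal_0; exact: prime_ideal.
  have [c P'c Pc] := incomparable idP (prime_ideal (primeP i.+1 im)) PP' gP P'y Py.
  by apply: Pc; exact: sub.
Qed.

(** * Graded algebras generated in degree one *)

Section IdealOf.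
Variable A : comNzRingType.
Implicit Types (I X Y : set A) (s t : seq A).

Lemma ideal_mul_0 X Y : X 0 -> Y 0 -> ideal_mul X Y 0.
Proof. by move=> X0 Y0; exists 0%N, (fun=> 0), (fun=> 0); rewrite big_ord0. Qed.

Lemma ideal_mul1 X Y a b : X a -> Y b -> ideal_mul X Y (a * b).
Proof.
move=> Xa Yb; exists 1%N, (fun=> a), (fun=> b).
by rewrite big_ord_recl big_ord0 addr0.
Qed.

Lemma ideal_mulD X Y a b :
  ideal_mul X Y a -> ideal_mul X Y b -> ideal_mul X Y (a + b).
Proof.
move=> [n [u [v [Xu Yv ->]]]] [m [u' [v' [Xu' Yv' ->]]]].
exists (n + m)%N, (fun i => if (i < n)%N then u i else u' (i - n)%N),
  (fun i => if (i < n)%N then v i else v' (i - n)%N).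
split=> [i|i|]; try by case: ifP.
rewrite big_split_ord /=; congr (_ + _); apply: eq_bigr => i _.
  by rewrite ltn_ord.
by rewrite ltnNge leq_addr addKn.
Qed.

(** Stated for arbitrary sets X and Y, which below are often graded pieces
    rather than ideals. *)
Lemma ideal_mul_sub X Y (P : A -> Prop) : P 0 ->
  (forall a b, P a -> P b -> P (a + b)) ->
  (forall a b, X a -> Y b -> P (a * b)) -> forall a, ideal_mul X Y a -> P a.
Proof.
move=> P0 PD PXY _ [n [u [v [Xu Yv ->]]]].
by elim/big_ind: _ => // i _; exact: PXY.
Qed.

Lemma is_ideal_of s : is_ideal (ideal_of s).
Proof.
split=> [|a b [u ->] [v ->]|a b [u ->]].
- by exists (fun=> 0); rewrite big1 // => i _; rewrite mul0r.
- exists (fun i => u i + v i); rewrite -big_split.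
  by apply: eq_bigr => i _; rewrite mulrDl.
- exists (fun i => a * u i); rewrite mulr_sumr.
  by apply: eq_bigr => i _; rewrite mulrA.
Qed.

Lemma mem_ideal_of s a : a \in s -> ideal_of s a.
Proof.
move=> sa; have ai : (index a s < size s)%N by rewrite index_mem.
exists (fun i => (i == index a s)%:R).
rewrite (bigD1 (Ordinal ai)) //= eqxx mul1r nth_index // big1 ?addr0 // => i.
by rewrite -(inj_eq val_inj) /= => /negbTE ->; rewrite mul0r.
Qed.

Lemma ideal_of_sub s I : is_ideal I -> (forall a, a \in s -> I a) -> ideal_of s `<=` I.
Proof.
move=> idI sI _ [c ->]; apply: ideal_sum => // i _; apply: ideal_Ml => //.
by apply: sI; exact: mem_nth.
Qed.

Lemma ideal_ofS s t : {subset s <= t} -> ideal_of s `<=` ideal_of t.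
Proof.
move=> st; apply: ideal_of_sub; first exact: is_ideal_of.
by move=> a /st; exact: mem_ideal_of.
Qed.

Lemma is_ideal_exp I n : is_ideal I -> is_ideal (ideal_exp I n).
Proof.
move=> idI; elim: n => [|n IHn] //; split.
- by apply: ideal_mul_0; exact: ideal_0.
- by move=> a b; exact: ideal_mulD.
- move=> a; apply: ideal_mul_sub => [|u v|u v Iu Iv].
  + by rewrite mulr0; apply: ideal_mul_0; exact: ideal_0.
  + by rewrite mulrDr; exact: ideal_mulD.
  + by rewrite mulrA; apply: ideal_mul1 => //; exact: ideal_Ml.
Qed.

End IdealOf.

Section Graded.
Variables (k : fieldType) (R : gradedAlg k).
Implicit Types (a b : R).

Lemma gr_ind (P : R -> Prop) : P 0 -> (forall a b, P a -> P b -> P (a + b)) ->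
  (forall i a, gr R i a -> P a) -> forall a, P a.
Proof.
move=> P0 PD PG; apply: (grading_ind (ring_grading R)) => // -[i|i] a /=.
  exact: PG.
by move=> ->.
Qed.

Lemma hcomp0 i : hcomp i (0 : R) = 0.
Proof. by apply: (addrI (hcomp i 0)); rewrite -hcompD !addr0. Qed.

Lemma hcomp_sum i (T : Type) (r : seq T) (p : pred T) (F : T -> R) :
  hcomp i (\sum_(j <- r | p j) F j) = \sum_(j <- r | p j) hcomp i (F j).
Proof. exact: (big_morph (hcomp i) (hcompD i) (hcomp0 i)). Qed.

Lemma hcompN i a : hcomp i (- a) = - hcomp i a.
Proof. by apply: (addrI (hcomp i a)); rewrite -hcompD !subrr hcomp0. Qed.

Lemma hcomp_ne i j a : gr R i a -> j != i -> hcomp j a = 0.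
Proof. by move=> Ra /negbTE ji; rewrite (hcomp_hom _ Ra) ji. Qed.

Lemma hcomp_id i a : gr R i a -> hcomp i a = a.
Proof. by move=> Ra; rewrite (hcomp_hom _ Ra) eqxx. Qed.

Lemma hcomp_Mlt i a j b : gr R i a -> (j < i)%N -> hcomp j (a * b) = 0.
Proof.
move=> Ra ji; elim/gr_ind: b => [|b c IHb IHc|l b Rb].
- by rewrite mulr0 hcomp0.
- by rewrite mulrDr hcompD IHb IHc addr0.
- apply: (hcomp_ne (gr_M Ra Rb)); rewrite ltn_eqF //.
  exact: leq_trans ji (leq_addr _ _).
Qed.

Lemma hcomp_eq0 a : (forall i, hcomp i a = 0) -> a = 0.
Proof.
move=> a0; have [n an] := hcomp_sumE a; rewrite (an n (leqnn n)) big1 //.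
Qed.

Lemma irrelevantP a : irrelevant R a <-> hcomp 0 a = 0.
Proof.
split=> [[n [f [Rf ->]]]|a0].
  by rewrite hcomp_sum big1 // => i _; rewrite (hcomp_ne (Rf i)).
have [n an] := hcomp_sumE a; exists n, (fun i => hcomp i.+1 a); split=> [i|].
  exact: hcomp_in.
by rewrite {1}(an n.+1 (leqnSn n)) big_ord_recl /= a0 add0r.
Qed.

Lemma hcomp0_M a b : hcomp 0 (a * b) = hcomp 0 a * hcomp 0 b.
Proof.
elim/gr_ind: a => [|a c IHa IHc|[|i] a Ra].
- by rewrite mul0r !hcomp0 mul0r.
- by rewrite mulrDl !hcompD IHa IHc mulrDl.
- by rewrite (hcomp_id Ra) -(hcomp_M 0 b Ra).
- by rewrite (hcomp_Mlt _ Ra) // (hcomp_ne Ra) // mul0r.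
Qed.

Lemma hcomp0_1 : hcomp 0 (1 : R) = 1. Proof. exact/hcomp_id/gr_1. Qed.

Lemma is_ideal_irrelevant : is_ideal (irrelevant R).
Proof.
split=> [|a b|a b]; rewrite !irrelevantP; first exact: hcomp0.
  by rewrite hcompD => -> ->; rewrite addr0.
by rewrite hcomp0_M => ->; rewrite mulr0.
Qed.

Lemma irrelevant_hom i a : gr R i.+1 a -> irrelevant R a.
Proof. by move=> Ra; apply/irrelevantP; rewrite (hcomp_ne Ra). Qed.

Definition order_ge n a : Prop := forall i, (i < n)%N -> hcomp i a = 0.

Lemma order_geM n i a b : gr R i a -> order_ge n b -> order_ge (i + n) (a * b).
Proof.
move=> Ra ob j jin; have [ji|ij] := ltnP j i; first exact: hcomp_Mlt Ra ji.
by rewrite -(subnKC ij) (hcomp_M _ _ Ra) ob ?mulr0 // ltn_subLR.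
Qed.

Lemma order_ge_D n a b : order_ge n a -> order_ge n b -> order_ge n (a + b).
Proof. by move=> oa ob i ni; rewrite hcompD oa // ob // addr0. Qed.

Lemma ideal_exp_order n a : ideal_exp (irrelevant R) n a -> order_ge n a.
Proof.
elim: n a => [|n IHn] a //=; apply: ideal_mul_sub => [i _|u v|u v Iu /IHn ov].
- exact: hcomp0.
- exact: order_ge_D.
have [m [f [Rf ->]]] := Iu; rewrite mulr_suml.
elim/big_ind: _ => [i _||i _]; [exact: hcomp0 | by move=> ? ?; exact: order_ge_D |].
have := order_geM (Rf i) ov => o j jn; apply: o.
by apply: leq_trans jn _; rewrite addSn ltnS leq_addl.
Qed.

(** The lowest nonzero component of a would be killed by the constant term of
    t, a nonzero scalar. *)
Lemma hcomp0_regular t a : hcomp 0 t != 0 -> (exists2 c : k, hcomp 0 t = c%:A & c != 0) ->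
  t * a = 0 -> a = 0.
Proof.
move=> t0 [c tc c0] ta; apply: hcomp_eq0.
have E i : order_ge i a -> hcomp 0 t * hcomp i a = 0.
  move=> oa; have [n tn] := hcomp_sumE t.
  have := congr1 (hcomp i) ta; rewrite {1}(tn n.+1 (leqnSn n)) mulr_suml hcomp_sum.
  rewrite big_ord_recl /= -[i in hcomp i (hcomp 0 t * _)]add0n (hcomp_M _ _ (hcomp_in 0 t)).
  rewrite hcomp0 big1 ?addr0 // => j _.
  by apply: (order_geM (hcomp_in _ _) oa); rewrite addSn ltnS leq_addl.
move=> i; elim/ltn_ind: i => i IH.
have := E i (fun j ji => IH j ji); rewrite tc -scalerAl mul1r.
move=> /(congr1 (fun v => c^-1 *: v)).
by rewrite scalerA mulVf // scale1r scaler0.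
Qed.

End Graded.

Section OneGenerated.
Variables (k : fieldType) (R : gradedAlg k).

(** Generation in degree one is expressed by products of graded pieces, a form
    that passes at once to Veronese subalgebras. *)
Record one_generated : Prop := OneGenerated {
  og_gr0 : forall a, gr R 0 a -> exists c : k, a = c%:A;
  og_mul : forall n a, gr R n.+1 a -> ideal_mul (gr R 1) (gr R n) a }.

Hypothesis oneR : one_generated.
Implicit Types (a b : R).

Lemma gr_mul_span m n a : gr R (m + n) a -> ideal_mul (gr R m) (gr R n) a.
Proof.
elim: m a => [|m IHm] a.
  by rewrite -[a]mul1r => Ra; apply: ideal_mul1 => //; [exact: gr_1 | rewrite mul1r in Ra].
rewrite addSn => /(og_mul oneR); apply: ideal_mul_sub => [|u v|b c Rb].
- by apply: ideal_mul_0; exact: gr_0.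
- exact: ideal_mulD.
move=> /IHm; apply: (ideal_mul_sub (P := fun c => _ (b * c))) => [|u v|u v Ru Rv].
- by rewrite mulr0; apply: ideal_mul_0; exact: gr_0.
- by rewrite mulrDr; exact: ideal_mulD.
- by rewrite mulrA; apply: ideal_mul1 => //; exact: (gr_M Rb Ru).
Qed.

Lemma gr_ideal_exp n t a : (n <= t)%N -> gr R t a -> ideal_exp (irrelevant R) n a.
Proof.
elim: n t a => [|n IHn] // [|t] // a nt /(og_mul oneR).
apply: ideal_mul_sub => [|u v|u v Ru Rv].
- by apply: ideal_mul_0; apply: ideal_0; [exact: is_ideal_irrelevant|
    apply: is_ideal_exp; exact: is_ideal_irrelevant].
- exact: ideal_mulD.
- by apply: ideal_mul1; [exact: irrelevant_hom Ru | exact: IHn Rv].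
Qed.

Lemma scalar_eq0 (c : k) : c%:A = 0 :> R -> c = 0.
Proof.
move=> c0; apply/eqP; apply: contraT => cn0.
have /eqP := oner_neq0 R; case; apply: (can_inj (scalerK cn0)).
by rewrite c0 scaler0.
Qed.

Lemma hcomp0_scalar a : exists c : k, hcomp 0 a = c%:A.
Proof. exact: og_gr0 (hcomp_in 0 a). Qed.

Lemma irrelevant_prime : is_prime (irrelevant R).
Proof.
split; first exact: is_ideal_irrelevant.
  by rewrite irrelevantP hcomp0_1; apply/eqP; exact: oner_neq0.
move=> a b; rewrite !irrelevantP hcomp0_M.
have [c ->] := hcomp0_scalar a; have [e ->] := hcomp0_scalar b.
rewrite -scalerAl mul1r scalerA => /scalar_eq0/eqP.
by rewrite mulf_eq0 => /orP[] /eqP ->; rewrite scale0r; [left|right].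
Qed.

Lemma mul_irrelevant_compl t a : ~ irrelevant R t -> t * a = 0 -> a = 0.
Proof.
rewrite irrelevantP => t0; apply: hcomp0_regular; first exact/eqP.
have [c tc] := hcomp0_scalar t; exists c => //; apply/eqP => c0; apply: t0.
by rewrite tc c0 scale0r.
Qed.

(** If the constant term of a were nonzero, it would be an invertible scalar
    lying in P. *)
Lemma prime_hcomp0 (P : set R) a : is_prime P -> P (hcomp 0 a) -> irrelevant R a.
Proof.
move=> primeP; have [c ac] := hcomp0_scalar a; rewrite irrelevantP ac => Pc.
have [->|c0] := eqVneq c 0; first by rewrite scale0r.
have [idP P1 _] := primeP; case: P1.
rewrite -[1](scalerK c0) -[c *: 1]mul1r scalerAl; exact: ideal_Ml.
Qed.

(** Each member of a finite family of generators of the irrelevant ideal is a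
    combination of finitely many forms of degree one; collecting these forms
    gives the new family. *)
Lemma one_generated_generators : noetherian R -> exists s : seq R,
  (forall a, a \in s -> gr R 1 a) /\ irrelevant R = ideal_of s.
Proof.
move=> /(_ _ (@is_ideal_irrelevant _ R))[t tE].
have [s [s1 st]] : exists s, (forall a, a \in s -> gr R 1 a) /\
    forall a, a \in t -> ideal_of s a.
  have : forall a, a \in t -> irrelevant R a.
    by rewrite tE => a; exact: mem_ideal_of.
  elim: t {tE} => [|a t IHt] It; first by exists [::].
  have [|s [s1 ts]] := IHt; first by move=> b tb; apply: It; rewrite inE tb orbT.
  have [s' [s'1 s'a]] : exists s', (forall b, b \in s' -> gr R 1 b) /\ ideal_of s' a.
    have [n [f [Rf ->]]] := It a (mem_head _ _).
    elim: n => [|n [s' [s'1 s'n]]].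
      by exists [::]; split=> //; rewrite big_ord0; exact: ideal_0 (is_ideal_of _).
    have [m [u [v [Ru Rv fE]]]] := og_mul oneR (Rf n).
    exists (s' ++ [seq u i | i <- iota 0 m]); split=> [b|].
      by rewrite mem_cat => /orP[/s'1//|/mapP[i _ ->]].
    rewrite big_ord_recr /=; apply: ideal_D; first exact: is_ideal_of.
      by apply: ideal_ofS s'n => b s'b; rewrite mem_cat s'b.
    rewrite fE; apply: ideal_sum; first exact: is_ideal_of.
    move=> i _; apply: ideal_Mr; first exact: is_ideal_of.
    apply: mem_ideal_of; rewrite mem_cat; apply/orP; right.
    by apply: map_f; rewrite mem_iota /=.
  exists (s' ++ s); split=> b.
    by rewrite mem_cat => /orP[/s'1//|/s1].
  rewrite inE => /orP[/eqP ->|tb].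
    by apply: ideal_ofS s'a => c s'c; rewrite mem_cat s'c.
  by apply: ideal_ofS (ts _ tb) => c sc; rewrite mem_cat sc orbT.
exists s; split=> //; apply/seteqP; split.
  by rewrite tE; apply: ideal_of_sub => //; exact: is_ideal_of.
apply: ideal_of_sub; first exact: is_ideal_irrelevant.
by move=> a /s1; exact: irrelevant_hom.
Qed.

Lemma generatorsP : noetherian R -> (forall a, a \in generators R -> gr R 1 a) /\
  irrelevant R = ideal_of (generators R).
Proof.
move=> /one_generated_generators[s Hs].
by rewrite /generators; case: xgetP => [t _ //|/(_ s)]; case.
Qed.

End OneGenerated.

(** The elements that preserve the claimed decomposition of components when
    multiplied to the left form a subalgebra. It contains the forms of degree
    one, hence everything, and it remains to apply it to 1. *)
Lemma standard_one_generated (k : fieldType) (R : gradedAlg k) :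
  standard_graded R -> one_generated R.
Proof.
move=> [_ gr0 gen]; split=> // n a Ra.
pose X (a : R) := forall m, ideal_mul (gr R 1) (gr R m) (hcomp m.+1 a).
have X0 : X 0 by move=> m; rewrite hcomp0; apply: ideal_mul_0; exact: gr_0.
have XD u v : X u -> X v -> X (u + v).
  by move=> Xu Xv m; rewrite hcompD; exact: ideal_mulD.
pose B : {pred R} := [pred b | `[< forall u, X u -> X (b * u) >]].
have BP b : reflect (forall u, X u -> X (b * u)) (b \in B) by exact: asboolP.
have closedB : subalg_closed B.
  split=> [|c u v /BP Bu /BP Bv|u v /BP Bu /BP Bv]; apply/BP => w Xw.
  - by rewrite mul1r.
  - rewrite mulrDl; apply: XD; last exact: Bv.
    move=> m; have -> : c *: u * w = c%:A * (u * w) by rewrite mulr_algl scalerAl.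
    rewrite -[m.+1]add0n (hcomp_M m.+1 (u * w) (gr_C R c)).
    apply: (ideal_mul_sub (P := fun e => _ (c%:A * e))) (Bu w Xw m) => [|x y|x y Rx Ry].
    + by rewrite mulr0; apply: ideal_mul_0; exact: gr_0.
    + by rewrite mulrDr; exact: ideal_mulD.
    + by rewrite mulrA; apply: ideal_mul1 => //; exact: (gr_M (gr_C R c) Rx).
  - by rewrite -mulrA; apply: Bu; exact: Bv.
have X1 : X 1.
  move=> m; rewrite (hcomp_ne (gr_1 R)) //; apply: ideal_mul_0; exact: gr_0.
have /BP/(_ 1 X1) : a \in B.
  apply: gen closedB _ _ => b Rb; apply/BP => u _ m.
  rewrite -add1n (hcomp_M _ _ Rb); apply: ideal_mul1 => //; exact: hcomp_in.
by rewrite mulr1 => /(_ n); rewrite (hcomp_id Ra).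
Qed.

(** * Cech complexes of families generating the same ideal up to radical *)

Section Fractions.
Variables (A : comNzRingType) (S : mulrClosed A).

Lemma fracP (u : loc S) : exists a s, u = frac_of a s.
Proof. by elim/locW: u => -[a s]; exists a, s. Qed.

Lemma fracZ (a b : A) (s : denominator S) : a *: frac_of b s = frac_of (a * b) s.
Proof. exact: loc_scaleE. Qed.

Lemma fracD (a b : A) (s t : denominator S) :
  frac_of a s + frac_of b t = frac_of (a * sval t + b * sval s) (denM s t).
Proof. exact: loc_addrE. Qed.

Lemma frac_eqP (a b : A) (s t : denominator S) : frac_of a s = frac_of b t <->
  exists2 r, r \in S & r * (a * sval t - b * sval s) = 0.
Proof. exact: loc_eqP. Qed.

Lemma frac_eq (a b : A) (s t : denominator S) :
  a * sval t = b * sval s -> frac_of a s = frac_of b t.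
Proof. exact: (@loc_eq _ _ (a, s) (b, t)). Qed.

Lemma frac_eq0P (a : A) (s : denominator S) :
  frac_of a s = 0 <-> exists2 r, r \in S & r * a = 0.
Proof.
rewrite -[0]/(frac_of 0 (den1 S)); split=> [/frac_eqP[r Sr]|[r Sr ra]].
  by rewrite mul0r subr0 /= mulr1; exists r.
by apply/frac_eqP; exists r => //; rewrite mul0r subr0 /= mulr1.
Qed.

End Fractions.

Lemma loc_map_comp (A : comNzRingType) (S T U : mulrClosed A)
  (ST : {subset S <= T}) (TU : {subset T <= U}) (SU : {subset S <= U}) u :
  loc_map TU (loc_map ST u) = loc_map SU u.
Proof.
by have [a [s ->]] := fracP u; rewrite !loc_mapE; apply: frac_eq.
Qed.

Lemma loc_map_id (A : comNzRingType) (S : mulrClosed A)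
  (SS : {subset S <= S}) u : loc_map SS u = u.
Proof. by have [a [s ->]] := fracP u; rewrite loc_mapE; apply: frac_eq. Qed.

Lemma uniform_bound (I : finType) (P : I -> nat -> Prop) :
  (forall i m m', (m <= m')%N -> P i m -> P i m') ->
  (forall i, exists m, P i m) -> exists m, forall i, P i m.
Proof.
move=> Pmono /choice[f Pf]; exists (\max_i f i)%N => i.
exact: Pmono (leq_bigmax i) (Pf i).
Qed.

Section CechTheory.
Variables (A : comNzRingType) (n : nat) (x : 'I_n -> A).
Implicit Types (I J K : {set 'I_n}) (c b : cech x).
Local Notation L J := (loc (monomials x J)).
Local Notation rho h := (loc_map (monomialsS (x:=x) h)).

Lemma monomials_expr J i m : i \in J -> x i ^+ m \in monomials x J.
Proof.
move=> iJ; rewrite inE; exists (fun j => if j == i then m else 0%N).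
rewrite (bigD1 i) //= eqxx big1 ?mulr1// => j /andP[_ /negbTE ->].
by rewrite expr0.
Qed.

Lemma monomials_split i J J' (r : A) : J' \subset i |: J ->
  r \in monomials x J' ->
  exists2 m, exists2 s, s \in monomials x J & r = x i ^+ m * s & True.
Proof.
move=> sJ; rewrite inE => -[e ->].
have [iJ'|iJ'] := boolP (i \in J'); last first.
  exists 0%N => //; exists (\prod_(j in J') x j ^+ e j); last by rewrite mul1r.
  have /monomialsS -> // : J' \subset J; last by rewrite inE; exists e.
  apply/fintype.subsetP => j jJ'; have := fintype.subsetP sJ _ jJ'.
  by rewrite !inE => /orP[/eqP ji|//]; rewrite -ji jJ' in iJ'.
exists (e i) => //; exists (\prod_(j in J' :\ i) x j ^+ e j).
  have /monomialsS -> // : J' :\ i \subset J; last by rewrite inE; exists e.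
  apply/fintype.subsetP => j; rewrite !inE => /andP[ji jJ'].
  by have := fintype.subsetP sJ _ jJ'; rewrite !inE (negbTE ji).
by rewrite (big_setD1 i).
Qed.

Lemma rho_congr I I' J c (h : I \subset J) (h' : I' \subset J) :
  I = I' -> rho h (c I) = rho h' (c I').
Proof. by move=> e; subst I'; rewrite (eq_irrelevance h h'). Qed.

Lemma rho_ker i J J' (h : J \subset J') (u : L J) : J' \subset i |: J ->
  rho h u = 0 -> exists m, x i ^+ m *: u = 0.
Proof.
move=> sJ; have [a [s ->]] := fracP u; rewrite loc_mapE => /frac_eq0P[r Jr ra].
have [m [t Jt rE] _] := monomials_split sJ Jr; exists m.
rewrite fracZ; apply/frac_eq0P; exists t => //.
by rewrite mulrA [t * _]mulrC -rE.
Qed.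

Lemma rho_lift i J J' (h : J \subset J') (v : L J') : J' \subset i |: J ->
  exists m u, rho h u = x i ^+ m *: v.
Proof.
move=> sJ; have [a [s ->]] := fracP v.
have [m [t Jt sE] _] := monomials_split sJ (valP s).
exists m, (frac_of a (Sub t Jt)); rewrite loc_mapE fracZ; apply: frac_eq.
by rewrite /= -[sval s]/(\val s) sE; ring.
Qed.

Lemma div_expr i J m (u : L J) : i \in J -> exists v, x i ^+ m *: v = u.
Proof.
move=> iJ; have [a [s ->]] := fracP u.
pose t : denominator (monomials x J) := Sub (x i ^+ m) (monomials_expr m iJ).
exists (frac_of a (denM t s)).
by rewrite fracZ; apply: frac_eq => /=; ring.
Qed.

Lemma expr_inj i J m (u v : L J) : i \in J ->
  x i ^+ m *: u = x i ^+ m *: v -> u = v.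
Proof.
move=> iJ uv; apply/eqP; rewrite -subr_eq0; apply/eqP.
have : x i ^+ m *: (u - v) = 0 by rewrite scalerBr uv subrr.
have [a [s ->]] := fracP (u - v); rewrite fracZ => /frac_eq0P[r Jr ra].
apply/frac_eq0P; exists (r * x i ^+ m); last by rewrite -mulrA.
by rewrite rpredM // monomials_expr.
Qed.

Definition sgn (j : 'I_n) J : A := (-1) ^+ #|[pred i in J | (i < j)%N]|.

Lemma sgn_sqr j J : sgn j J * sgn j J = 1.
Proof. by rewrite /sgn -exprD addnn -mul2n exprM sqrrN !expr1n. Qed.

Lemma sgnZK j J (V : lmodType A) (u : V) : sgn j J *: (sgn j J *: u) = u.
Proof. by rewrite scalerA sgn_sqr scale1r. Qed.

Lemma sgnD1 i j J : i \in J ->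
  sgn j J = (-1) ^+ (i < j)%N * sgn j (J :\ i).
Proof.
move=> iJ; rewrite /sgn -exprD; congr (_ ^+ _).
rewrite (cardD1 i) !inE iJ /=; congr (_ + _)%N.
by apply: eq_card => l; rewrite !inE andbA.
Qed.

(** Exactly one of the two signs is changed by the removal of the other index.
    *)
Lemma sgn_anti i j J : i \in J -> j \in J -> i != j ->
  sgn i J * sgn j (J :\ i) = - (sgn j J * sgn i (J :\ j)).
Proof.
move=> iJ jJ ij; rewrite (sgnD1 i jJ) (sgnD1 j iJ).
move: (neq_ltn i j); rewrite (inj_eq val_inj) ij => /esym/orP[] lt.
  by rewrite lt ltnNge (ltnW lt) /= expr0 expr1; ring.
by rewrite lt ltnNge (ltnW lt) /= expr0 expr1; ring.
Qed.

Lemma cech_diffE c J : cech_diff c J =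
  \sum_(j in J) sgn j J *: rho (subD1set J j) (c (J :\ j)).
Proof. by []. Qed.

Lemma cech_diff_eq c c' J :
  (forall j, j \in J -> c (J :\ j) = c' (J :\ j)) -> cech_diff c J = cech_diff c' J.
Proof. by move=> e; apply: eq_bigr => j jJ; rewrite e. Qed.

Lemma cechD c b J : (c + b) J = c J + b J. Proof. by []. Qed.
Lemma cechN c J : (- c) J = - c J. Proof. by []. Qed.
Lemma cechZ a c J : (a *: c) J = a *: c J. Proof. by []. Qed.
Lemma cech0 J : (0 : cech x) J = 0. Proof. by []. Qed.

(** Written over ordered pairs of distinct indices, the terms depend on the
    pair of removed indices only up to a sign, which is antisymmetric. *)
Lemma cech_diff2 c : cech_diff (cech_diff c) = 0.
Proof.
apply/functional_extensionality_dep => J; rewrite cech_diffE cech0.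
pose T j l : L J := rho (subsetDl J [set j; l]) (c (J :\: [set j; l])).
have TC j l : T j l = T l j by rewrite /T; apply: rho_congr; rewrite finset.setUC.
have E : \sum_(j in J) sgn j J *: rho (subD1set J j) (cech_diff c (J :\ j)) =
    \sum_(j in J) \sum_(l in J :\ j) (sgn j J * sgn l (J :\ j)) *: T j l.
  apply: eq_bigr => j jJ; rewrite cech_diffE linear_sum scaler_sumr.
  apply: eq_bigr => l lJ; rewrite linearZ /= scalerA; congr (_ *: _).
  rewrite (loc_map_comp _ _ (monomialsS (x:=x)
    (fintype.subset_trans (subD1set _ l) (subD1set J j)))).
  by apply: rho_congr; rewrite finset.setDDl finset.setUC.
rewrite E; pose F j l : L J := if [&& j \in J & l \in J :\ j] then
   (sgn j J * sgn l (J :\ j)) *: T j l else 0.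
have -> : \sum_(j in J) \sum_(l in J :\ j) (sgn j J * sgn l (J :\ j)) *: T j l =
   \sum_j \sum_l F j l.
  rewrite big_mkcond; apply: eq_bigr => j _; case: ifP => jJ.
    by rewrite big_mkcond; apply: eq_bigr => l _; rewrite /F jJ.
  by rewrite big1 // => l _; rewrite /F jJ.
have FA j l : F j l = - F l j.
  rewrite /F !inE (eq_sym l j) TC.
  have [<-|jl] := eqVneq j l; first by rewrite !andbF oppr0.
  rewrite !andTb [in RHS]andbC; case: ifP => [/andP[jJ lJ]|]; last by rewrite oppr0.
  by rewrite sgn_anti // scaleNr.
have FS (P : rel 'I_n) : \sum_j \sum_(l | P j l) F j l = - \sum_j \sum_(l | P l j) F j l.
  rewrite (exchange_big_dep xpredT) //= -sumrN; apply: eq_bigr => l _.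
  by rewrite -sumrN; apply: eq_bigr => j _.
have -> : \sum_j \sum_l F j l =
    \sum_(j : 'I_n) \sum_(l : 'I_n | (j < l)%N) F j l +
    \sum_(j : 'I_n) \sum_(l : 'I_n | (l < j)%N) F j l.
  rewrite -big_split; apply: eq_bigr => j _.
  rewrite (bigID (fun l : 'I_n => (j < l)%N)) /=; congr (_ + _).
  rewrite (bigD1 j) ?ltnn //= {1}/F !inE eqxx andbF add0r.
  by apply: eq_bigl => l; rewrite -leqNgt ltn_neqAle andbC.
by rewrite (FS (fun j l : 'I_n => (j < l)%N)) addNr.
Qed.

Lemma cech_diffB c b J : cech_diff (c - b) J = cech_diff c J - cech_diff b J.
Proof. by rewrite linearB. Qed.

Lemma cech_diffZ a c J : cech_diff (a *: c) J = a *: cech_diff c J.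
Proof. by rewrite linearZ. Qed.

Lemma rho_setU1 i J J' (u : forall I, L I) (v : forall I, L I) m (h : J \subset J') :
  (forall I, rho (finset.subsetUr [set i] I) (u I) = x i ^+ m *: v (i |: I)) ->
  i |: J = J' -> rho h (u J) = x i ^+ m *: v J'.
Proof.
by move=> uv e; subst J'; rewrite -uv (eq_irrelevance h (finset.subsetUr [set i] J)).
Qed.

(** The components over subsets of K form the Cech complex of the subfamily
    indexed by K, a quotient of the full complex. Its cochains are represented
    by cochains of the full family, and conditions are only imposed on subsets
    of K. *)
Definition closed_on K p c :=
  forall J, J \subset K -> #|J| = p.+1 -> cech_diff c J = 0.

Lemma cech_choice (P : forall J, L J -> Prop) :
  (forall J, exists u, P J u) -> exists c, forall J, P J (c J).
Proof.
by move=> H; exists (fun J => sval (cid (H J))) => J; case: cid.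
Qed.

(** A fraction whose denominators involve x_i becomes, after multiplication by
    a power of x_i, one whose denominators do not. So, up to this power, the
    part of the differential that adds the index i can be inverted. *)
Lemma lift_generator i c : exists m b, (forall J, i \in J -> b J = 0) /\
  forall J, i \in J -> cech_diff b J = x i ^+ m *: c J.
Proof.
have [M HM] : exists M, forall J, exists u : L J,
    rho (finset.subsetUr [set i] J) u = x i ^+ M *: c (i |: J).
  apply: uniform_bound => [J m m' mm' [u Hu]|J].
    by exists (x i ^+ (m' - m) *: u); rewrite linearZ /= Hu scalerA -exprD subnK.
  by apply: (@rho_lift i).
have [u Hu] := cech_choice HM.
pose b : cech x := fun J => if i \in J then 0 else sgn i (i |: J) *: u J.
exists M, b; split=> J iJ; first by rewrite /b iJ.
rewrite cech_diffE (bigD1 i) //= big1 ?addr0.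
  rewrite {1}/b setD11 [X in sgn _ _ *: X]linearZ /= finset.setD1K // sgnZK.
  by rewrite (rho_setU1 _ Hu) // finset.setD1K.
by move=> j /andP[jJ ji]; rewrite /b ifT ?linear0 ?scaler0 // !inE eq_sym ji.
Qed.

(** Under the hypothesis, the differential at i |: J is, up to sign, the image
    of c J after inverting x_i, and only x_i-power torsion dies there. *)
Lemma off_generator i c J : (forall J', i \in J' -> c J' = 0) -> i \notin J ->
  cech_diff c (i |: J) = 0 -> exists m, x i ^+ m *: c J = 0.
Proof.
move=> c0 iJ; have iJE : (i |: J) :\ i = J by rewrite finset.setU1K.
rewrite cech_diffE (bigD1 i) ?setU11 //= big1 ?addr0 => [|j /andP[_ ji]]; last first.
  by rewrite c0 ?linear0 ?scaler0 // !inE eqxx eq_sym ji.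
move=> /(congr1 (fun v => sgn i (i |: J) *: v)); rewrite sgnZK scaler0 => e.
apply: (rho_ker (h := finset.subsetUr [set i] J)) (fintype.subxx _) _.
by rewrite -e; apply: rho_congr.
Qed.

(** Subtract from x_i^m c the differential of a cochain chosen to remove all
    components over sets containing i. What remains is a cocycle without such
    components, so it is killed by a power of x_i. *)
Lemma generator_torsion i K p c : i \in K -> closed_on K p c ->
  exists m b, forall J, J \subset K -> #|J| = p ->
    x i ^+ m *: c J = cech_diff b J.
Proof.
move=> iK dc; have [M [b [b0 db]]] := lift_generator i c.
pose c1 := x i ^+ M *: c - cech_diff b.
have c1_in J : i \in J -> c1 J = 0.
  by move=> iJ; rewrite /c1 cechD cechN cechZ db // subrr.
have c1_ker J : exists m, J \subset K -> #|J| = p -> x i ^+ m *: c1 J = 0.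
  have [[JK Jp iJ]|nJ] := pselect [/\ J \subset K, #|J| = p & i \notin J]; last first.
    exists 0%N => JK Jp; rewrite c1_in ?scaler0 //; apply/negPn/negP => iJ.
    by apply: nJ.
  have [|m Hm] := off_generator c1_in iJ; last by exists m.
  rewrite cech_diffB cech_diffZ cech_diff2 cech0 subr0 dc ?scaler0 //.
    by rewrite finset.subUset finset.sub1set iK.
  by rewrite cardsU1 iJ Jp.
have [m Hm] : exists m, forall J, J \subset K -> #|J| = p -> x i ^+ m *: c1 J = 0.
  apply: uniform_bound c1_ker => J m m' mm' H JK Jp.
  by rewrite -(subnK mm') exprD -scalerA H // scaler0.
exists (m + M)%N, (x i ^+ m *: b) => J JK Jp; apply/eqP.
rewrite cech_diffZ exprD -scalerA -subr_eq0 -scalerBr; apply/eqP.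
exact: (Hm J JK Jp).
Qed.

Definition in_radical K (w : A) :=
  exists m (a : 'I_n -> A), w ^+ m = \sum_(i in K) a i * x i.

Lemma in_radicalS K K' w : K \subset K' -> in_radical K w -> in_radical K' w.
Proof.
move=> KK' [m [a wE]]; exists m, (fun i => if i \in K then a i else 0).
rewrite wE [RHS](bigID (mem K)) /= [X in _ + X]big1 ?addr0; last first.
  by move=> i /andP[_ /negbTE ->]; rewrite mul0r.
apply: eq_big => [i|i ->//]; rewrite andbC.
by case: (boolP (i \in K)) => // /(fintype.subsetP KK') ->.
Qed.

(** The elements that multiply c into coboundaries form an ideal. Its radical
    contains the x_i for i in K, hence the ideal they generate, hence w. *)
Lemma radical_torsion K p c w : in_radical K w -> closed_on K p c ->
  exists m b, forall J, J \subset K -> #|J| = p ->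
    w ^+ m *: c J = cech_diff b J.
Proof.
move=> [r [a wE]] dc.
pose N : set A := [set v | exists b, forall J, J \subset K -> #|J| = p ->
  v *: c J = cech_diff b J].
have ND u v : N u -> N v -> N (u + v).
  move=> [b ub] [b' vb']; exists (b + b') => J JK Jp.
  by rewrite linearD cechD scalerDl ub // vb'.
have NM u v : N v -> N (u * v).
  by move=> [b vb]; exists (u *: b) => J JK Jp; rewrite cech_diffZ -scalerA vb.
have N0 : N 0 by exists 0 => J _ _; rewrite linear0 scale0r.
have radD u v : (exists m, N (u ^+ m)) -> (exists m, N (v ^+ m)) ->
    exists m, N ((u + v) ^+ m).
  move=> [m um] [l vl]; exists (m + l)%N; rewrite exprDn.
  elim/big_ind: _ => // i _; rewrite -mulr_natl; apply: (NM).
  have [il|li] := leqP i l.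
    rewrite -addnBA // exprD.
    by rewrite (_ : _ * _ = u ^+ (l - i) * v ^+ i * u ^+ m); [apply: NM | ring].
  by rewrite -(subnK (ltnW li)) exprD mulrA; apply: NM.
have [m Nm] : exists m, N ((w ^+ r) ^+ m).
  rewrite wE; elim/big_ind: _ => [|u v|i iK]; first by exists 1%N; rewrite expr1.
    exact: radD.
  have [m [b H]] := generator_torsion iK dc; exists m; rewrite exprMn; apply: NM.
  by exists b.
by exists (r * m)%N; rewrite exprM.
Qed.

(** Adjoining j adds the components over sets that contain j, on which x_j is
    invertible. Since x_j^m c is the differential of some b over K, the
    components of x_j^-m db over these sets extend c to a cocycle. *)
Lemma extend_generator j K p c : j \notin K -> in_radical K (x j) ->
  closed_on K p c -> exists c',
    closed_on (j |: K) p c' /\ forall J, J \subset K -> c' J = c J.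
Proof.
move=> jK rj dc; have [m [b Hb]] := radical_torsion rj dc.
have notin J : J \subset K -> j \notin J.
  by move=> JK; apply: contra jK; apply: (fintype.subsetP JK).
have subK J : j \notin J -> J \subset j |: K -> J \subset K.
  move=> jJ JjK; apply/fintype.subsetP => i iJ.
  have := fintype.subsetP JjK _ iJ; rewrite !inE => /orP[/eqP ij|//].
  by rewrite -ij iJ in jJ.
pose b' : cech x := fun J => if j \in J then 0 else b J.
have [c' Hc'] : exists c' : cech x, forall J, (j \in J ->
    x j ^+ m *: c' J = cech_diff b' J) /\ (j \notin J -> c' J = c J).
  apply: (cech_choice (P := fun J v => (j \in J -> x j ^+ m *: v = cech_diff b' J)
     /\ (j \notin J -> v = c J))) => J.
  case: (boolP (j \in J)) => jJ; last by exists (c J).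
  by have [v] := div_expr m (cech_diff b' J) jJ; exists v.
have c'E J : J \subset j |: K -> #|J| = p -> x j ^+ m *: c' J = cech_diff b' J.
  move=> JK Jp; have [jJ|jJ] := boolP (j \in J); first exact: (Hc' J).1.
  rewrite (Hc' J).2 // Hb ?(subK J) //; apply: cech_diff_eq => i iJ.
  by rewrite /b' !inE (negbTE jJ) andbF.
exists c'; split=> [J JK Jp|J JK]; last by rewrite (Hc' J).2 ?notin.
have [jJ|jJ] := boolP (j \in J); last first.
  rewrite -[RHS](dc J) ?(subK J) //; apply: cech_diff_eq => i iJ.
  by rewrite (Hc' _).2 // !inE (negbTE jJ) andbF.
apply: (@expr_inj _ _ m) jJ _; rewrite scaler0 -cech_diffZ.
have -> : cech_diff (x j ^+ m *: c') J = cech_diff (cech_diff b') J.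
  apply: cech_diff_eq => i iJ; rewrite cechZ c'E //.
    exact: fintype.subset_trans (subD1set J i) JK.
  by move: Jp; rewrite (cardsD1 i) iJ => -[].
by rewrite cech_diff2.
Qed.

(** Subtracting a coboundary leaves a cocycle supported on the sets containing
    j. Up to a power of x_j it is the differential of some u supported on the
    sets without j, and a further power of x_j makes u a cocycle over K, hence
    by torsion a coboundary up to yet another power. Correcting u by this
    coboundary moves its support to the sets containing j, where the powers of
    x_j can be divided out. *)
Lemma bound_generator j K p c b : j \notin K -> in_radical K (x j) ->
  closed_on (j |: K) p c ->
  (forall J, J \subset K -> #|J| = p -> c J = cech_diff b J) ->
  exists b', forall J, J \subset j |: K -> #|J| = p -> c J = cech_diff b' J.
Proof.
move=> jK rj dc cb.
have notin J : J \subset K -> j \notin J.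
  by move=> JK; apply: contra jK; apply: (fintype.subsetP JK).
have subK J : j \notin J -> J \subset j |: K -> J \subset K.
  move=> jJ JjK; apply/fintype.subsetP => i iJ.
  have := fintype.subsetP JjK _ iJ; rewrite !inE => /orP[/eqP ij|//].
  by rewrite -ij iJ in jJ.
case: p dc cb => [|p] dc cb.
  exists b => J _ /eqP; rewrite cards_eq0 => /eqP ->.
  by rewrite cb ?finset.sub0set ?cards0.
pose b1 : cech x := fun J => if j \in J then 0 else b J.
pose c1 := c - cech_diff b1.
have dc1 : closed_on (j |: K) p.+1 c1.
  by move=> J JK Jp; rewrite cech_diffB cech_diff2 cech0 subr0 dc.
have c1K J : J \subset K -> #|J| = p.+1 -> c1 J = 0.
  move=> JK Jp; rewrite /c1 cechD cechN cb // (cech_diff_eq (c' := b1)) ?subrr //.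
  by move=> i iJ; rewrite /b1 !inE (negbTE (notin J JK)) andbF.
have [l [u [u0 du]]] := lift_generator j c1.
pose e := x j ^+ l *: c1 - cech_diff u.
have e0 J : j \in J -> e J = 0.
  by move=> jJ; rewrite /e cechD cechN cechZ du // subrr.
(* After multiplication by a power of x_j, u is a cocycle over K. *)
have [m Hm] : exists m, forall J, J \subset K -> #|J| = p.+1 ->
    x j ^+ m *: cech_diff u J = 0.
  apply: uniform_bound => [J m m' mm' H JK Jp|J].
    by rewrite -(subnK mm') exprD -scalerA H // scaler0.
  have [[JK Jp]|nJ] := pselect (J \subset K /\ #|J| = p.+1); last first.
    by exists 0%N => JK Jp; case: nJ.
  have [|m Hm] := off_generator e0 (notin J JK).
    rewrite cech_diffB cech_diffZ cech_diff2 cech0 subr0 dc1 ?scaler0 //.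
      exact: finset.setUS.
    by rewrite cardsU1 notin // Jp.
  exists m => _ _; rewrite /e cechD cechN cechZ c1K // scaler0 add0r scalerN in Hm.
  by apply/eqP; rewrite -oppr_eq0 Hm.
have [r [v Hv]] : exists r v, forall J, J \subset K -> #|J| = p ->
    x j ^+ r *: (x j ^+ m *: u) J = cech_diff v J.
  by apply: radical_torsion rj _ => J JK Jp; rewrite cech_diffZ Hm.
pose v1 : cech x := fun J => if j \in J then 0 else v J.
pose t := (r + (m + l))%N.
(* The corrected u, which vanishes on the subsets of K with p elements. *)
pose g := x j ^+ (r + m) *: u - cech_diff v1.
have [b2 Hb2] : exists b2 : cech x, forall J, (j \in J -> x j ^+ t *: b2 J = g J)
    /\ (j \notin J -> b2 J = 0).
  apply: (cech_choice (P := fun J w => (j \in J -> x j ^+ t *: w = g J)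
     /\ (j \notin J -> w = 0))) => J.
  case: (boolP (j \in J)) => jJ; last by exists 0.
  by have [w] := div_expr t (g J) jJ; exists w.
have b2E J : J \subset j |: K -> #|J| = p -> x j ^+ t *: b2 J = g J.
  move=> JK Jp; have [jJ|jJ] := boolP (j \in J); first exact: (Hb2 J).1.
  have JK' : J \subset K by rewrite subK.
  rewrite (Hb2 J).2 // scaler0 /g cechD cechN cechZ exprD -scalerA -[X in _ *: X]cechZ Hv //.
  rewrite (cech_diff_eq (c' := v1)) ?subrr // => i iJ.
  by rewrite /v1 !inE (negbTE jJ) andbF.
exists (b1 + b2) => J JK Jp; rewrite linearD cechD; apply/eqP.
rewrite addrC -subr_eq; apply/eqP; rewrite -[LHS]/(c1 J) -[RHS]/(cech_diff b2 J).
have [jJ|jJ] := boolP (j \in J); last first.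
  rewrite c1K ?subK //; apply/esym/big1 => i iJ.
  by rewrite (Hb2 _).2 ?linear0 ?scaler0 // !inE (negbTE jJ) andbF.
apply: (@expr_inj _ _ t) (jJ) _.
rewrite -cech_diffZ (cech_diff_eq (c' := g)); last first.
  move=> i iJ; rewrite cechZ b2E //.
    exact: fintype.subset_trans (subD1set J i) JK.
  by move: Jp; rewrite (cardsD1 i) iJ => -[].
rewrite cech_diffB cech_diff2 cech0 subr0 cech_diffZ du //.
by rewrite scalerA -exprD -addnA.
Qed.

(** With the next lemma: the restriction of the Cech complex to K induces
    isomorphisms in cohomology when the x_i with i in K generate, up to
    radical, the ideal of the whole family. The indices outside K are adjoined
    one at a time. *)
Lemma closed_on_extend K p c : (forall j, in_radical K (x j)) ->
  closed_on K p c -> exists c',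
    closed_on [set: 'I_n]%SET p c' /\ forall J, J \subset K -> c' J = c J.
Proof.
have [m Km] := ubnP #|~: K|; elim: m => // m IHm in K c Km * => rK dc.
have [KT|[j]] := set_0Vmem (~: K).
  have -> : [set: 'I_n]%SET = K by rewrite -(finset.setCK K) KT finset.setC0.
  by exists c.
rewrite inE => jK; have [c' [dc' cc']] := extend_generator jK (rK j) dc.
have sK := finset.subsetUr [set j] K.
have [||c'' [dc'' cc'']] := IHm (j |: K) c' _ _ dc'.
- apply: leq_trans (Km : (_ <= m)%N); apply: proper_card.
  by rewrite finset.properC; apply/properP; split=> //; exists j; rewrite ?setU11.
- by move=> i; exact: in_radicalS sK (rK i).
exists c''; split=> // J JK; rewrite cc'' ?cc' //.
exact: fintype.subset_trans JK sK.
Qed.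

Lemma bound_on_extend K p c b : (forall j, in_radical K (x j)) ->
  closed_on [set: 'I_n]%SET p c ->
  (forall J, J \subset K -> #|J| = p -> c J = cech_diff b J) ->
  exists b', forall J, #|J| = p -> c J = cech_diff b' J.
Proof.
have [m Km] := ubnP #|~: K|; elim: m => // m IHm in K b Km * => rK dc cb.
have [KT|[j]] := set_0Vmem (~: K).
  exists b => J Jp; apply: cb => //.
  by rewrite -(finset.setCK K) KT finset.setC0 finset.subsetT.
rewrite inE => jK.
have sK := finset.subsetUr [set j] K.
have [|b' cb'] := bound_generator jK (rK j) _ cb.
  by move=> J _ Jp; apply: dc; rewrite ?finset.subsetT.
apply: (IHm (j |: K) b') => // [|i].
  apply: leq_trans (Km : (_ <= m)%N); apply: proper_card.
  by rewrite finset.properC; apply/properP; split=> //; exists j; rewrite ?setU11.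
exact: in_radicalS sK (rK i).
Qed.

End CechTheory.

(** * Gradings of localizations and of Cech cohomology *)

Lemma fracD_num (A : comNzRingType) (S : mulrClosed A) (a b : A)
  (s : denominator S) : frac_of a s + frac_of b s = frac_of (a + b) s.
Proof. by rewrite fracD; apply: frac_eq => /=; ring. Qed.

Lemma frac_sum (A : comNzRingType) (S : mulrClosed A) (I : Type) (r : seq I)
  (F : I -> A) (s : denominator S) :
  \sum_(i <- r) frac_of (F i) s = frac_of (\sum_(i <- r) F i) s.
Proof.
elim/big_ind2: _ => [|u a v b -> ->|//]; last exact: fracD_num.
by apply/esym/frac_eq0P; exists 1; rewrite ?rpred1 ?mulr0.
Qed.

Section LocGrading.
Variables (k : fieldType) (R : gradedAlg k) (S : mulrClosed R).
Hypothesis homS : forall s, s \in S -> exists e, gr R e s.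

Lemma den_hom (s : denominator S) : exists e, gr R e (sval s).
Proof. exact: homS (valP s). Qed.

Definition den_deg (s : denominator S) : nat := sval (cid (den_hom s)).

Lemma den_degP (s : denominator S) : gr R (den_deg s) (sval s).
Proof. by rewrite /den_deg; case: cid. Qed.

Definition loc_pr (j : int) (u : loc S) : loc S :=
  frac_of (hcompz (j + (den_deg (repr u).2)%:Z) (repr u).1) (repr u).2.

(** Two expressions of the same fraction differ by homogeneous factors, which
    shift all degrees by the same amount. *)
Lemma loc_prE j e a (s : denominator S) : gr R e (sval s) ->
  loc_pr j (frac_of a s) = frac_of (hcompz (j + e%:Z) a) s.
Proof.
move=> Re; rewrite /loc_pr; case E : (repr (frac_of a s)) => [b t] /=.
have : frac_of b t = frac_of a s by rewrite /frac_of -E reprK.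
move=> /frac_eqP[r Sr rE]; apply/frac_eqP; exists r => //.
have [f Rf] := homS Sr; have Rt := den_degP t.
move: rE; rewrite !mulrBr => /subr0_eq rE; apply/eqP; rewrite subr_eq0; apply/eqP.
have -> : r * (hcompz (j + (den_deg t)%:Z) b * sval s) =
    hcompz ((e + f)%N%:Z + (j + (den_deg t)%:Z)) (r * (b * sval s)).
  by rewrite (_ : r * (b * sval s) = (sval s * r) * b) ?(hcompz_M _ _ (gr_M Re Rf)); ring.
have -> : r * (hcompz (j + e%:Z) a * sval t) =
    hcompz ((den_deg t + f)%N%:Z + (j + e%:Z)) (r * (a * sval t)).
  by rewrite (_ : r * (a * sval t) = (sval t * r) * a) ?(hcompz_M _ _ (gr_M Rt Rf)); ring.
by rewrite rE; congr hcompz; rewrite !PoszD; ring.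
Qed.

Definition loc_grading : grading (@loc_gr k R S).
Proof.
have hom (u : loc S) : exists e a s, gr R e (sval s) /\ u = frac_of a s.
  by have [a [s ->]] := fracP u; have [e Re] := den_hom s; exists e, a, s.
apply: (@Grading _ _ loc_pr) => [j u v|j u|j u|i j u|u].
- have [e [a [s [Rs ->]]]] := hom u; have [f [b [t [Rt ->]]]] := hom v.
  rewrite fracD (@loc_prE _ (e + f)); last exact: gr_M.
  rewrite (loc_prE _ _ Rs) (loc_prE _ _ Rt) fracD; congr frac_of.
  rewrite [LHS](prD (ring_grading R)) /=; congr (_ + _).
    by rewrite [RHS]mulrC -(hcompz_M _ _ Rt); congr hcompz; rewrite ?PoszD; ring.
  by rewrite [RHS]mulrC -(hcompz_M _ _ Rs); congr hcompz; rewrite ?PoszD; ring.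
- have [e [a [s [Rs ->]]]] := hom u; exists e, (hcompz (j + e%:Z) a), s; split=> //.
    exact: (pr_in (ring_grading R)).
  exact: loc_prE.
- move=> [e [a [s [Rs Ra ->]]]]; rewrite (loc_prE _ _ Rs); congr frac_of.
  exact: (pr_id (ring_grading R)).
- move=> [e [a [s [Rs Ra ->]]]] ij; rewrite (loc_prE _ _ Rs).
  rewrite [hcompz _ _](pr_ne (ring_grading R) Ra); last by move/addIr.
  by apply/frac_eq0P; exists 1; rewrite ?rpred1 ?mulr0.
- have [e [a [s [Rs ->]]]] := hom u.
  exists [seq i - e%:Z | i <- supp (ring_grading R) a]; split.
    by rewrite map_inj_uniq ?supp_uniq //; exact: addIr.
  rewrite big_map [in LHS](suppE (ring_grading R) a) -frac_sum.
  by apply: eq_bigr => i _; rewrite (loc_prE _ _ Rs) subrK.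
Defined.

End LocGrading.

Section MapGraded.
Variables (k : fieldType) (R : gradedAlg k) (S T : mulrClosed R).
Variable ST : {subset S <= T}.

Lemma loc_map_gr j u : loc_gr j u -> loc_gr j (loc_map ST u).
Proof.
by move=> [e [a [s [Rs Ra ->]]]]; exists e, a, (den_map ST s); rewrite loc_mapE.
Qed.

End MapGraded.

Lemma loc_gr_M (k : fieldType) (R : gradedAlg k) (S : mulrClosed R) (i : nat) j r
  (u : loc S) : gr R i r -> loc_gr j u -> loc_gr (i%:Z + j) (r *: u).
Proof.
move=> Rr [e [a [s [Rs Ra ->]]]]; exists e, (r * a), s; rewrite fracZ -addrA.
by split=> //; exact: grz_M.
Qed.

Section CechCohomology.
Variables (A : comNzRingType) (n : nat) (x : 'I_n -> A) (p : nat).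
Implicit Types (c : cech x) (I : {set 'I_n}).

Lemma cocycleP c : reflect (cech_deg p c /\ cech_diff c = 0) (c \in @cocycle _ _ x p).
Proof. exact: asboolP. Qed.

Lemma coboundaryP (z : cocycles x p) : reflect (exists2 b : cech x,
  forall I, #|I|.+1 != p -> b I = 0 & val z = cech_diff b) (z \in @coboundary _ _ x p).
Proof. exact: asboolP. Qed.

Lemma coho_class0 : coho_class 0 = 0 :> cohomology x p.
Proof. exact: raddf0. Qed.

Lemma coho_class_sum (T : Type) (r : seq T) (F : T -> cocycles x p) :
  coho_class (\sum_(i <- r) F i) = \sum_(i <- r) coho_class (F i).
Proof. exact: raddf_sum. Qed.

End CechCohomology.

Section CechGraded.
Variables (k : fieldType) (R : gradedAlg k) (n : nat) (x : 'I_n -> R).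
Hypothesis homx : forall i, exists e, gr R e (x i).
Implicit Types (I J : {set 'I_n}) (c b : cech x).

Lemma monomials_hom J s : s \in monomials x J -> exists e, gr R e s.
Proof.
rewrite inE => -[e ->]; elim/big_ind: _ => [|a b [i Ra] [j Rb]|i _].
- by exists 0%N; exact: gr_1.
- by exists (i + j)%N; exact: gr_M.
- by have [f Rx] := homx i; exists (e i * f)%N; exact: gr_X.
Qed.

Let DL J := loc_grading (@monomials_hom J).

Definition cech_gr (j : int) : set (cech x) := [set c | forall I, loc_gr j (c I)].

Lemma cech_sum (T : Type) (r : seq T) (F : T -> cech x) J :
  (\sum_(i <- r) F i) J = \sum_(i <- r) F i J.
Proof. by elim: r => [|i r IH]; rewrite ?big_nil ?big_cons // cechD IH. Qed.

Definition cech_grading : grading cech_gr.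
Proof.
apply: (@Grading _ _ (fun j c J => pr (DL J) j (c J))) => [j c b|j c|j c|i j c|c].
- by apply/functional_extensionality_dep => J; exact: (prD (DL J)).
- by move=> J; exact: (pr_in (DL J)).
- by move=> cj; apply/functional_extensionality_dep => J; exact: (pr_id (DL J) (cj J)).
- move=> ci ij; apply/functional_extensionality_dep => J.
  exact: (pr_ne (DL J) (ci J)).
- pose s := undup (flatten [seq supp (DL J) (c J) | J <- enum {set 'I_n}]).
  exists s; split; first exact: undup_uniq.
  apply/functional_extensionality_dep => J; rewrite cech_sum.
  apply: pr_sumE => [|j]; first exact: undup_uniq.
  rewrite mem_undup => js; apply: notin_supp; apply: contra js => jJ.
  by apply/flatten_mapP; exists J; rewrite ?mem_enum.
Defined.

Lemma cech_diff_gr j c : cech_gr j c -> cech_gr j (cech_diff c).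
Proof.
move=> cj J; rewrite cech_diffE; apply: (gr_sum_mem (DL J)) => i iJ.
rewrite -[j]add0r; apply: (loc_gr_M (i := 0)) (loc_map_gr _ (cj (J :\ i))).
have := gr_X #|[pred l in J | (l < i)%N]| (gr_N (gr_1 R)).
by rewrite muln0.
Qed.

Lemma pr_cech_diff j c :
  pr cech_grading j (cech_diff c) = cech_diff (pr cech_grading j c).
Proof.
apply: (pr_graded_map cech_grading cech_grading (f := id)) => // [u v|].
  exact: linearD.
exact: cech_diff_gr.
Qed.

Variable p : nat.

Lemma cocycle_pr j (z : cocycles x p) : pr cech_grading j (val z) \in @cocycle _ _ x p.
Proof.
have /cocycleP[z0 dz] := valP z; apply/cocycleP; split.
  by move=> I /z0 zI; rewrite -[LHS]/(pr (DL I) j (val z I)) zI pr0.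
by rewrite -pr_cech_diff dz pr0.
Qed.

Definition cocycle_prz j (z : cocycles x p) : cocycles x p :=
  Sub (pr cech_grading j (val z)) (cocycle_pr j z).

Definition coho_pr j (h : cohomology x p) : cohomology x p :=
  coho_class (cocycle_prz j (coho_rep h)).

Lemma coho_prE j z : coho_pr j (coho_class z) = coho_class (cocycle_prz j z).
Proof.
apply/coho_eqP; have /coho_eqP/coboundaryP[b b0 db] := coho_repK (coho_class z).
apply/coboundaryP; exists (pr cech_grading j b) => [I /b0 bI|].
  by rewrite -[LHS]/(pr (DL I) j (b I)) bI pr0.
by rewrite -pr_cech_diff -db [val _]raddfB [val _]raddfB prB.
Qed.

Definition coho_grading : grading (@coho_gr k R n x p).
Proof.
apply: (@Grading _ _ coho_pr) => [j|j|j h|i j h|].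
- elim/cohoW=> u; elim/cohoW=> v; rewrite -coho_classD !coho_prE -coho_classD.
  congr coho_class; apply: val_inj.
  exact: (prD cech_grading j (val u) (val v)).
- elim/cohoW=> z; rewrite coho_prE; exists (cocycle_prz j z) => //.
  exact: (pr_in cech_grading j (val z)).
- move=> [z zj ->]; rewrite coho_prE; congr coho_class; apply: val_inj.
  exact: (pr_id cech_grading zj).
- move=> [z zj ->] ij; rewrite coho_prE -coho_class0; apply/coho_eqP.
  apply/coboundaryP; exists 0 => //; rewrite [RHS]linear0.
  by rewrite (subr0 (cocycle_prz j z)); exact: (pr_ne cech_grading zj ij).
- elim/cohoW=> z; exists (supp cech_grading (val z)); split; first exact: supp_uniq.
  under eq_bigr do rewrite coho_prE; rewrite -coho_class_sum; congr coho_class.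
  by apply: val_inj; rewrite [RHS]raddf_sum; exact: suppE.
Defined.

End CechGraded.

(** * Restriction of Cech cohomology to a subfamily *)

Lemma loc_map_congr (A : comNzRingType) (n : nat) (x : 'I_n -> A) (c : cech x)
    (T : mulrClosed A) (I I' : {set 'I_n})
    (h : {subset monomials x I <= T}) (h' : {subset monomials x I' <= T}) :
  I = I' -> loc_map h (c I) = loc_map h' (c I').
Proof.
move=> e; subst I'; have [a [s ->]] := fracP (c I).
by rewrite !loc_mapE; apply: frac_eq.
Qed.

Section Truncation.
Variables (A : comNzRingType) (n : nat) (x : 'I_n -> A).
Implicit Types (c : cech x) (J : {set 'I_n}).

Definition trunc p c : cech x := fun J => if #|J| == p then c J else 0.

Lemma trunc_deg p c : cech_deg p (trunc p c).
Proof. by move=> J /negbTE Jp; rewrite /trunc Jp. Qed.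

Lemma cech_diff_trunc p c J :
  cech_diff (trunc p c) J = if #|J| == p.+1 then cech_diff c J else 0.
Proof.
case: eqP => Jp.
  apply: cech_diff_eq => j jJ; rewrite /trunc ifT //.
  by move: Jp; rewrite (cardsD1 j) jJ add1n => -[->].
rewrite cech_diffE big1 // => j jJ; rewrite /trunc ifF ?linear0 ?scaler0 //.
by apply/eqP => jp; apply: Jp; rewrite (cardsD1 j) jJ jp.
Qed.

(** The differential raises the degree by one, so b can be cut down to its
    part of degree p - 1. *)
Lemma bounds_trunc p c b : cech_deg p c ->
  (forall J, #|J| = p -> c J = cech_diff b J) ->
  exists2 b' : cech x, forall J, #|J|.+1 != p -> b' J = 0 & c = cech_diff b'.
Proof.
move=> c0 cb; exists (fun J => if #|J|.+1 == p then b J else 0) => [J /negbTE ->//|].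
apply/functional_extensionality_dep => J.
have [Jp|Jp] := eqVneq #|J| p.
  rewrite cb //; apply: cech_diff_eq => j jJ.
  by rewrite ifT // -Jp (cardsD1 j J) jJ.
rewrite c0 // cech_diffE big1 // => j jJ; rewrite ifF ?linear0 ?scaler0 //.
by apply: contraNF Jp => /eqP <-; rewrite (cardsD1 j J) jJ.
Qed.

End Truncation.

Section Restriction.
Variables (A : comNzRingType) (n N : nat) (x : 'I_n -> A) (z : 'I_N -> A).
Variable f : 'I_n -> 'I_N.
Hypothesis f_mono : forall i j, (f i < f j)%N = (i < j)%N.
Hypothesis xz : forall i, x i = z (f i).
Implicit Types (I : {set 'I_n}) (J : {set 'I_N}).

Lemma increasing_inj : injective f.
Proof.
move=> i j fij; apply: ord_inj; case: (ltngtP i j) => // ij.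
  by have := f_mono i j; rewrite ij fij ltnn.
by have := f_mono j i; rewrite ij fij ltnn.
Qed.

Lemma monomials_res I : {subset monomials z (f @: I) <= monomials x I}.
Proof.
move=> a; rewrite inE => -[e ->]; apply: rpred_prod => j /imsetP[i iI ->].
by rewrite -xz; exact: monomials_expr.
Qed.

Lemma monomials_ext J : {subset monomials x (f @^-1: J) <= monomials z J}.
Proof.
move=> a; rewrite inE => -[e ->]; apply: rpred_prod => i; rewrite inE => iJ.
by rewrite xz; exact: monomials_expr.
Qed.

(** The restriction to the subfamily x of z. The map f is increasing, so that
    the signs of the two differentials agree. *)
Definition cech_res (c : cech z) : cech x :=
  fun I => loc_map (@monomials_res I) (c (f @: I)).

(** A section of the restriction, compatible with the differentials over the
    subsets of the image of f. *)
Definition cech_ext (c : cech x) : cech z :=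
  fun J => loc_map (@monomials_ext J) (c (f @^-1: J)).

Lemma cech_res_is_linear : linear cech_res.
Proof.
by move=> a c d; apply/functional_extensionality_dep => I; exact: linearP.
Qed.
HB.instance Definition _ :=
  GRing.isLinear.Build A (cech z) (cech x) *:%R cech_res cech_res_is_linear.

Lemma sgn_imset i I : sgn A (f i) (f @: I) = sgn A i I.
Proof.
congr (_ ^+ _).
have -> : #|[pred l in I | (l < i)%N]| = #|f @: [pred l in I | (l < i)%N]|.
  by rewrite card_imset //; exact: increasing_inj.
apply: eq_card => j.
rewrite !inE; apply/andP/imsetP => [[/imsetP[l lI ->]]|[l]].
  by rewrite f_mono => li; exists l; rewrite ?inE ?lI.
by rewrite !inE => /andP[lI li] ->; rewrite f_mono imset_f.
Qed.

Lemma cech_res_diff c : cech_diff (cech_res c) = cech_res (cech_diff c).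
Proof.
apply/functional_extensionality_dep => I.
rewrite /cech_res !cech_diffE linear_sum big_imset /=; last by move=> i j _ _ /increasing_inj.
apply: eq_bigr => i iI; rewrite linearZ /= sgn_imset; congr (_ *: _).
have sub1 : {subset monomials z (f @: (I :\ i)) <= monomials x I}.
  by move=> a /monomials_res; apply: monomialsS (subD1set I i) _.
have sub2 : {subset monomials z ((f @: I) :\ f i) <= monomials x I}.
  by move=> a /(monomialsS (subD1set _ _)); exact: monomials_res.
rewrite (loc_map_comp _ _ sub1) (loc_map_comp _ _ sub2).
apply: loc_map_congr; apply/setP => j; rewrite !inE.
apply/imsetP/andP => [[l]|[ji /imsetP[l lI jl]]].
  by rewrite !inE => /andP[li lI] ->; rewrite (inj_eq increasing_inj) li imset_f.
by exists l; rewrite // !inE lI andbT; apply: contra ji => /eqP <-; rewrite jl.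
Qed.

Lemma cech_extK : cancel cech_ext cech_res.
Proof.
move=> c; apply/functional_extensionality_dep => I.
have fI : f @^-1: (f @: I) = I.
  by apply/setP => i; rewrite inE mem_imset //; exact: increasing_inj.
have sub : {subset monomials x (f @^-1: (f @: I)) <= monomials x I}.
  by rewrite fI.
rewrite /cech_res /cech_ext (loc_map_comp _ _ sub).
by rewrite (loc_map_congr c sub (fun a => id)) ?loc_map_id.
Qed.

Local Notation K := (f @: [set: 'I_n]%SET).

Lemma subset_imset J : J \subset K -> exists2 I : {set _}, J = f @: I & #|I| = #|J|.
Proof.
move=> JK; exists (f @^-1: J); last first.
  have -> : #|f @^-1: J| = #|f @: (f @^-1: J)| by rewrite card_imset //; exact: increasing_inj.
  apply: eq_card => j.
  apply/imsetP/idP => [[i]|jJ]; first by rewrite inE => iJ ->.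
  have /imsetP[i _ ji] := fintype.subsetP JK _ jJ.
  by exists i => //; rewrite inE -ji.
apply/setP => j; apply/idP/imsetP => [jJ|[i]]; last by rewrite inE => iJ ->.
have /imsetP[i _ ji] := fintype.subsetP JK _ jJ.
by exists i => //; rewrite inE -ji.
Qed.

Lemma cech_res_inj (c d : cech z) I :
  cech_res c I = cech_res d I -> c (f @: I) = d (f @: I).
Proof.
have sub : {subset monomials x I <= monomials z (f @: I)}.
  move=> a; rewrite inE => -[e ->]; apply: rpred_prod => i iI.
  by rewrite xz monomials_expr // imset_f.
move=> /(congr1 (loc_map sub)); rewrite !(loc_map_comp _ _ (fun a => id)).
by rewrite !loc_map_id.
Qed.

Variable p : nat.

Lemma cocycle_res (c : cocycles z p) : cech_res (val c) \in @cocycle _ _ x p.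
Proof.
have /cocycleP[c0 dc] := valP c; apply/cocycleP; split=> [I Ip|].
  by rewrite /cech_res c0 ?linear0 // card_imset //; exact: increasing_inj.
by rewrite cech_res_diff dc linear0.
Qed.

Definition cocycle_resz (c : cocycles z p) : cocycles x p :=
  Sub (cech_res (val c)) (cocycle_res c).

Definition coho_res (h : cohomology z p) : cohomology x p :=
  coho_class (cocycle_resz (coho_rep h)).

Lemma coho_resE c : coho_res (coho_class c) = coho_class (cocycle_resz c).
Proof.
apply/coho_eqP; have /coho_eqP/coboundaryP[b b0 db] := coho_repK (coho_class c).
apply/coboundaryP; exists (cech_res b) => [I Ip|].
  by rewrite /cech_res b0 ?linear0 // card_imset //; exact: increasing_inj.
rewrite cech_res_diff -db; exact/esym/(linearB cech_res).
Qed.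

Lemma coho_res_is_linear : linear coho_res.
Proof.
move=> a; elim/cohoW=> u; elim/cohoW=> v.
rewrite -coho_classZ -coho_classD !coho_resE -coho_classZ -coho_classD.
by congr coho_class; apply: val_inj; exact: (linearP cech_res).
Qed.
HB.instance Definition _ := GRing.isLinear.Build A (cohomology z p)
  (cohomology x p) *:%R coho_res coho_res_is_linear.

Hypothesis radical_K : forall j, in_radical z K (z j).

Lemma coho_res_surj (h : cohomology x p) : exists g, coho_res g = h.
Proof.
elim/cohoW: h => c; have /cocycleP[c0 dc] := valP c.
have dext : closed_on K p (cech_ext (val c)).
  move=> J /subset_imset[I -> <-] Ip; apply: (cech_res_inj (d := 0)).
  by rewrite -cech_res_diff cech_extK dc linear0.
have [c' [dc' cc']] := closed_on_extend radical_K dext.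
have Hc : trunc p c' \in @cocycle _ _ z p.
  apply/cocycleP; split; first exact: trunc_deg.
  apply/functional_extensionality_dep => J; rewrite cech_diff_trunc.
  by case: eqP => // Jp; apply: dc'; rewrite ?finset.subsetT.
exists (coho_class (Sub (trunc p c') Hc)); rewrite coho_resE; congr coho_class.
apply/val_inj/functional_extensionality_dep => I /=.
rewrite /cech_res /trunc card_imset; last exact: increasing_inj.
case: eqP => [_|/eqP/c0 ->]; last exact: linear0.
rewrite cc' ?imsetS ?finset.subsetT //.
by rewrite -[LHS]/(cech_res (cech_ext (val c)) I) cech_extK.
Qed.

Lemma coho_res_inj : injective coho_res.
Proof.
suff ker h : coho_res h = 0 -> h = 0.
  move=> u v uv; apply/eqP; rewrite -subr_eq0; apply/eqP/ker.
  by rewrite linearB /= uv subrr.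
elim/cohoW: h => c; rewrite coho_resE -!coho_class0 => /coho_eqP/coboundaryP[b _].
rewrite subr0 /= => cb; apply/coho_eqP; rewrite subr0.
have /cocycleP[c0 dc] := valP c.
have [b' cb'] : exists b', forall J, #|J| = p -> val c J = cech_diff b' J.
  apply: (bound_on_extend (b := cech_ext b) radical_K).
    by move=> J _ _; rewrite dc.
  move=> J /subset_imset[I -> _] _; apply: cech_res_inj.
  by rewrite -cech_res_diff cech_extK cb.
by apply/coboundaryP; exact: bounds_trunc c0 cb'.
Qed.

End Restriction.

(** * Cech cohomology of Veronese subalgebras *)

Section LocPush.
Variables (A B : comNzRingType) (g : {rmorphism A -> B}).
Variables (S : mulrClosed A) (T : mulrClosed B).
Hypothesis gST : forall s, s \in S -> g s \in T.

Definition den_push (s : denominator S) : denominator T :=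
  Sub (g (sval s)) (gST (valP s)).

Definition loc_push (u : loc S) : loc T :=
  frac_of (g (repr u).1) (den_push (repr u).2).

Lemma loc_pushE a s : loc_push (frac_of a s) = frac_of (g a) (den_push s).
Proof.
rewrite /loc_push; case E : (repr (frac_of a s)) => [b t] /=.
have : frac_of b t = frac_of a s by rewrite /frac_of -E reprK.
move=> /frac_eqP[r Sr rE]; apply/frac_eqP; exists (g r); first exact: gST.
by rewrite /= -!rmorphM -rmorphB -rmorphM rE rmorph0.
Qed.

Lemma loc_pushD u v : loc_push (u + v) = loc_push u + loc_push v.
Proof.
have [a [s ->]] := fracP u; have [b [t ->]] := fracP v.
rewrite fracD !loc_pushE fracD; apply: frac_eq.
by rewrite /= rmorphD !rmorphM.
Qed.

Lemma loc_push0 : loc_push 0 = 0.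
Proof. by apply: (addrI (loc_push 0)); rewrite -loc_pushD !addr0. Qed.

Lemma loc_push_sum (I : Type) (r : seq I) (P : pred I) (F : I -> loc S) :
  loc_push (\sum_(i <- r | P i) F i) = \sum_(i <- r | P i) loc_push (F i).
Proof. exact: (big_morph loc_push loc_pushD loc_push0). Qed.

Lemma loc_pushZ a u : loc_push (a *: u) = g a *: loc_push u.
Proof.
have [b [t ->]] := fracP u; rewrite fracZ !loc_pushE fracZ.
by rewrite rmorphM.
Qed.

End LocPush.

Lemma loc_push_map (A B : comNzRingType) (g : {rmorphism A -> B})
    (S S' : mulrClosed A) (T T' : mulrClosed B)
    (gST : forall s, s \in S -> g s \in T) (gST' : forall s, s \in S' -> g s \in T')
    (SS' : {subset S <= S'}) (TT' : {subset T <= T'}) u :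
  loc_map TT' (loc_push gST u) = loc_push gST' (loc_map SS' u).
Proof.
have [a [s ->]] := fracP u; rewrite loc_mapE !loc_pushE loc_mapE.
exact: frac_eq.
Qed.

(** The inclusion of a Veronese subalgebra enters the proof through these
    properties only. *)
Record veronese_embedding (k : fieldType) (A R : gradedAlg k) (d : nat)
    (g : {rmorphism A -> R}) : Prop := VeroneseEmbedding {
  ve_inj : injective g;
  ve_gr : forall i a, gr A i a <-> gr R (i * d) (g a);
  ve_surj : forall i b, gr R (i * d) b -> exists a, g a = b;
  ve_C : forall c : k, g c%:A = c%:A
}.

Section VeroneseEmbedding.
Variables (k : fieldType) (A R : gradedAlg k) (d : nat) (g : {rmorphism A -> R}).
Hypothesis d_gt0 : (0 < d)%N.
Hypothesis gV : veronese_embedding d g.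

Lemma ve_grz j a : grz j a -> grz (j * d%:Z) (g a).
Proof.
case: j => j /=; first by move=> /(ve_gr gV).
by move=> ->; rewrite rmorph0; exact: (gr0_mem (ring_grading R)).
Qed.

Lemma ve_grz_surj j b : grz (j * d%:Z) b -> exists2 a, grz j a & g a = b.
Proof.
case: j => j.
  by move=> Rb; have [a gab] := ve_surj gV Rb; exists a => //; rewrite /= (ve_gr gV) gab.
rewrite -[d]prednK // => ->; exists 0; rewrite ?rmorph0 //.
Qed.

Lemma mul_d_inj : injective (fun j : int => j * d%:Z).
Proof. by apply: mulIf; rewrite eqz_nat -lt0n. Qed.

Section Complex.
Variables (n : nat) (y : 'I_n -> A).
Hypothesis homy : forall i, exists e, gr A e (y i).
Let x i := g (y i).
Implicit Types (I J : {set 'I_n}).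

Lemma monomials_push I s : s \in monomials y I -> g s \in monomials x I.
Proof.
rewrite !inE => -[e ->]; exists e; rewrite rmorph_prod.
by apply: eq_bigr => i _; rewrite rmorphXn.
Qed.

Lemma monomials_pull I r : r \in monomials x I ->
  exists2 s, s \in monomials y I & g s = r.
Proof.
rewrite inE => -[e ->]; exists (\prod_(i in I) y i ^+ e i).
  by rewrite inE; exists e.
by rewrite rmorph_prod; apply: eq_bigr => i _; rewrite rmorphXn.
Qed.

Lemma push_homogeneous i : exists e, gr R e (x i).
Proof. by have [e /(ve_gr gV) Rx] := homy i; exists (e * d)%N. Qed.

Local Notation push I := (loc_push (@monomials_push I)).

Lemma push_inj I : injective (push I).
Proof.
suff ker u : push I u = 0 -> u = 0.
  move=> u v uv; apply/eqP; rewrite -subr_eq0; apply/eqP/ker.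
  by rewrite loc_pushD uv -loc_pushD subrr loc_push0.
have [a [s ->]] := fracP u; rewrite loc_pushE => /frac_eq0P[r].
move=> /monomials_pull[t Yt <-]; rewrite -rmorphM -(rmorph0 g) => /(ve_inj gV) ta.
by apply/frac_eq0P; exists t.
Qed.

Lemma push_gr I j u : loc_gr j u -> loc_gr (j * d%:Z) (push I u).
Proof.
move=> [e [a [s [/(ve_gr gV) Rs Ra ->]]]].
exists (e * d)%N, (g a), (den_push (@monomials_push I) s).
by rewrite loc_pushE; split=> //; rewrite PoszM -mulrDl; exact: ve_grz.
Qed.

(** A product of the g (y i) is homogeneous of degree divisible by d, whatever
    other degree it may have been assigned, unless it is zero. Hence the
    numerator of a fraction of degree j * d has degree divisible by d as well.
    *)
Lemma push_surj I j v : loc_gr (j * d%:Z) v -> exists u, push I u = v.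
Proof.
move=> [e [b [t [Rt Rb ->]]]].
(* The degree e in the grading of the fraction may differ from the degree of
   the product t only if t = 0. *)
have [s Ys st] := monomials_pull (valP t).
have [f Rs] := monomials_hom homy Ys.
have [fe|fe] := eqVneq (f * d)%N e.
  move: Rb; rewrite -fe PoszM -mulrDl => /ve_grz_surj[a _ <-].
  exists (frac_of a (Sub s Ys)); rewrite loc_pushE; apply: frac_eq.
  by rewrite /= st.
exists 0; rewrite loc_push0; apply/esym/frac_eq0P.
exists (sval t); first exact: valP.
have -> : sval t = 0; last by rewrite mul0r.
move: Rs; rewrite (ve_gr gV) => /(hcomp_hom e).
rewrite eq_sym (negbTE fe) st => <-; by rewrite (hcomp_hom e Rt) eqxx.
Qed.

Definition cech_push (c : cech y) : cech x := fun I => push I (c I).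

Lemma cech_pushD c b : cech_push (c + b) = cech_push c + cech_push b.
Proof. by apply/functional_extensionality_dep => I; exact: loc_pushD. Qed.

Lemma cech_push0 : cech_push 0 = 0.
Proof. by apply/functional_extensionality_dep => I; exact: loc_push0. Qed.

Lemma cech_pushZ a c : cech_push (a *: c) = g a *: cech_push c.
Proof. by apply/functional_extensionality_dep => I; exact: loc_pushZ. Qed.

Lemma cech_pushB c b : cech_push (c - b) = cech_push c - cech_push b.
Proof.
by apply: (addIr (cech_push b)); rewrite -cech_pushD !subrK.
Qed.

Lemma cech_push_inj : injective cech_push.
Proof.
move=> c b cb; apply/functional_extensionality_dep => I; apply: push_inj.
exact: (congr1 (fun c : cech x => c I) cb).
Qed.

Lemma cech_push_diff c : cech_diff (cech_push c) = cech_push (cech_diff c).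
Proof.
apply/functional_extensionality_dep => J.
rewrite /cech_push !cech_diffE loc_push_sum; apply: eq_bigr => j jJ.
rewrite loc_pushZ /sgn rmorphXn rmorphN1; congr (_ *: _).
exact: loc_push_map.
Qed.

Lemma cech_push_surj j (c : cech x) : cech_gr (j * d%:Z) c ->
  exists b, cech_push b = c.
Proof.
move=> cj; have [b Hb] := cech_choice (fun I => push_surj (cj I)).
by exists b; apply/functional_extensionality_dep.
Qed.

Variable p : nat.

Lemma cocycle_push (c : cocycles y p) : cech_push (val c) \in @cocycle _ _ x p.
Proof.
have /cocycleP[c0 dc] := valP c; apply/cocycleP; split=> [I Ip|].
  by rewrite /cech_push c0 // loc_push0.
by rewrite cech_push_diff dc cech_push0.
Qed.

Definition cocycle_pushz (c : cocycles y p) : cocycles x p :=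
  Sub (cech_push (val c)) (cocycle_push c).

Definition coho_push (h : cohomology y p) : cohomology x p :=
  coho_class (cocycle_pushz (coho_rep h)).

Lemma coho_pushE c : coho_push (coho_class c) = coho_class (cocycle_pushz c).
Proof.
apply/coho_eqP; have /coho_eqP/coboundaryP[b b0 db] := coho_repK (coho_class c).
apply/coboundaryP; exists (cech_push b) => [I Ip|].
  by rewrite /cech_push b0 // loc_push0.
by rewrite cech_push_diff -db; exact/esym/cech_pushB.
Qed.

Lemma coho_pushD u v : coho_push (u + v) = coho_push u + coho_push v.
Proof.
elim/cohoW: u => u; elim/cohoW: v => v.
rewrite -coho_classD !coho_pushE -coho_classD.
by congr coho_class; apply: val_inj; exact: cech_pushD.
Qed.

Lemma coho_pushZ a u : coho_push (a *: u) = g a *: coho_push u.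
Proof.
elim/cohoW: u => u; rewrite -coho_classZ !coho_pushE -coho_classZ.
by congr coho_class; apply: val_inj; exact: cech_pushZ.
Qed.

Lemma coho_push_gr j h : coho_gr j h -> coho_gr (j * d%:Z) (coho_push h).
Proof.
move=> [z zj ->]; rewrite coho_pushE; exists (cocycle_pushz z) => // I.
exact: (push_gr (zj I)).
Qed.

Lemma coho_push_surj j h : coho_gr (j * d%:Z) h -> exists u, coho_push u = h.
Proof.
move=> [z zj ->]; have [c cz] := cech_push_surj zj.
have /cocycleP[z0 dz] := valP z.
have Hc : c \in @cocycle _ _ y p.
  apply/cocycleP; split=> [I Ip|].
    apply: push_inj; rewrite loc_push0 -(z0 I Ip).
    exact: (congr1 (fun c : cech x => c I) cz).
  by apply: cech_push_inj; rewrite -cech_push_diff cz dz cech_push0.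
exists (coho_class (Sub c Hc)); rewrite coho_pushE; congr coho_class.
by apply: val_inj; exact: cz.
Qed.

(** If the image of a cocycle is the differential of b, it is also the
    differential of the component of b of degree j * d, and this component
    comes from A. *)
Lemma coho_push_ker_hom j h : coho_gr j h -> coho_push h = 0 -> h = 0.
Proof.
move=> [z zj ->]; rewrite coho_pushE -!coho_class0.
move=> /coho_eqP/coboundaryP[b b0]; rewrite subr0 => bz.
apply/coho_eqP/coboundaryP; rewrite subr0.
have zE : val (cocycle_pushz z) = cech_push (val z) by [].
have [c cb] := cech_push_surj (pr_in (cech_grading push_homogeneous) (j * d%:Z) b).
exists c => [I Ip|].
  apply: push_inj; rewrite loc_push0 -[LHS]/(cech_push c I) cb.
  rewrite -[LHS]/(pr (loc_grading (@monomials_hom _ _ _ _ push_homogeneous I)) _ (b I)).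
  by rewrite b0 // pr0.
apply: cech_push_inj; rewrite -cech_push_diff cb -pr_cech_diff -bz zE.
by rewrite pr_id // => I; exact: (push_gr (zj I)).
Qed.

Lemma coho_push_inj : injective coho_push.
Proof.
have push0 : coho_push 0 = 0.
  by apply: (addrI (coho_push 0)); rewrite -coho_pushD !addr0.
suff ker h : coho_push h = 0 -> h = 0.
  move=> u v uv; apply/eqP; rewrite -subr_eq0; apply/eqP/ker.
  by rewrite coho_pushD uv -coho_pushD subrr push0.
move=> h0; apply: (pr_inj (D := coho_grading homy p)) => j; rewrite pr0.
apply: (coho_push_ker_hom (pr_in _ j h)).
rewrite -(pr_graded_map (coho_grading homy p) (coho_grading push_homogeneous p)
  mul_d_inj coho_pushD).
  by rewrite h0 pr0.
exact: coho_push_gr.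
Qed.

End Complex.

End VeroneseEmbedding.

(** * Comparison of local cohomology *)

Section RestrictionGraded.
Variables (k : fieldType) (R : gradedAlg k) (n N : nat).
Variables (x : 'I_n -> R) (z : 'I_N -> R) (f : 'I_n -> 'I_N).
Hypothesis f_mono : forall i j, (f i < f j)%N = (i < j)%N.
Hypothesis xz : forall i, x i = z (f i).
Hypothesis homz : forall i, exists e, gr R e (z i).
Hypothesis radical_K : forall j, in_radical z (f @: [set: 'I_n]%SET) (z j).
Variable p : nat.

Let homx i : exists e, gr R e (x i).
Proof. by rewrite xz. Qed.

Local Notation res := (@coho_res R n N x z f f_mono xz p).

Lemma coho_res_gr j h : coho_gr j h -> coho_gr j (res h).
Proof.
move=> [c cj ->]; rewrite coho_resE; exists (cocycle_resz f_mono xz c) => // I.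
exact: (loc_map_gr _ (cj (f @: I))).
Qed.

Lemma coho_res_gr_inv j h : coho_gr j (res h) -> coho_gr j h.
Proof.
move=> hj; suff -> : h = pr (coho_grading homz p) j h by exact: pr_in.
apply: (@coho_res_inj _ _ _ _ _ _ f_mono xz p radical_K).
rewrite -(pr_graded_map (coho_grading homz p) (coho_grading homx p) (f := id)) //.
- by rewrite pr_id.
- exact: linearD.
- exact: coho_res_gr.
Qed.

End RestrictionGraded.

Section Compare.
Variables (k : fieldType) (A R : gradedAlg k) (d : nat) (g : {rmorphism A -> R}).
Hypothesis d_gt0 : (0 < d)%N.
Hypothesis gV : veronese_embedding d g.
Variables (m n : nat) (y : 'I_m -> A) (x : 'I_n -> R).
Hypothesis homy : forall i, exists e, gr A e (y i).
Hypothesis homx : forall i, exists e, gr R e (x i).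
Hypothesis rad_y : forall i, in_radical x [set: 'I_n]%SET (g (y i)).
Hypothesis rad_x : forall i, in_radical (fun j => g (y j)) [set: 'I_m]%SET (x i).
Variable p : nat.

Let gy i := g (y i).
Let z (i : 'I_(m + n)) : R := match fintype.split i with inl j => gy j | inr j => x j end.

Let zl i : gy i = z (lshift n i).
Proof. by rewrite /z (unsplitK (inl i)). Qed.

Let zr i : x i = z (rshift m i).
Proof. by rewrite /z (unsplitK (inr i)). Qed.

Let homz i : exists e, gr R e (z i).
Proof.
rewrite /z; case: fintype.split => j //.
by have [e /(ve_gr gV)] := homy j; exists (e * d)%N.
Qed.

Lemma in_radical_imset (q : nat) (v : 'I_q -> R) (f : 'I_q -> 'I_(m + n)) w :
  injective f -> (forall i, v i = z (f i)) ->
  in_radical v [set: 'I_q]%SET w -> in_radical z (f @: [set: 'I_q]%SET) w.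
Proof.
move=> increasing_inj vz [e [a wE]]; exists e.
exists (fun j => if [pick i | f i == j] is Some i then a i else 0).
rewrite wE big_imset /=; last by move=> i j _ _ /increasing_inj.
apply: eq_bigr => i _; rewrite vz; case: pickP => [l /eqP/increasing_inj ->//|/(_ i)].
by rewrite eqxx.
Qed.

Lemma in_radical_gen (q : nat) (v : 'I_q -> R) i : in_radical v [set: 'I_q]%SET (v i).
Proof.
exists 1%N, (fun j => (j == i)%:R); rewrite expr1 (bigD1 i) ?inE //= eqxx mul1r.
by rewrite big1 ?addr0 // => j /andP[_ /negbTE ->]; rewrite mul0r.
Qed.

Let rad_l j : in_radical z (@lshift m n @: [set: 'I_m]%SET) (z j).
Proof.
apply: in_radical_imset zl _; first exact: lshift_inj.
rewrite /z; case: fintype.split => i; last exact: rad_x.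
exact: (in_radical_gen gy).
Qed.

Let rad_r j : in_radical z (@rshift m n @: [set: 'I_n]%SET) (z j).
Proof.
apply: in_radical_imset zr _; first exact: rshift_inj.
rewrite /z; case: fintype.split => i; first exact: rad_y.
exact: (in_radical_gen x).
Qed.

Let mono_l (i j : 'I_m) : (lshift n i < lshift n j)%N = (i < j)%N.
Proof. by []. Qed.

Let mono_r (i j : 'I_n) : (rshift m i < rshift m j)%N = (i < j)%N.
Proof. by rewrite ltn_add2l. Qed.

(** Let z be the union of x and of the image of y. Each of the two subfamilies
    generates the ideal of z up to radical, so the restrictions from z to both
    are isomorphisms in cohomology. They identify the cohomology of x with
    that of the image of y, whose part in degrees divisible by d is the
    cohomology of y over A. *)
Lemma coho_compare : exists iota : cohomology y p -> cohomology x p,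
  [/\ forall u v, iota (u + v) = iota u + iota v,
      forall a u, iota (a *: u) = g a *: iota u,
      injective iota,
      forall j u, coho_gr j u -> coho_gr (j * d%:Z) (iota u) &
      forall j v, coho_gr (j * d%:Z) v -> exists u, iota u = v].
Proof.
pose resl := @coho_res R m (m + n) gy z (@lshift m n) mono_l zl p.
pose resr := @coho_res R n (m + n) x z (@rshift m n) mono_r zr p.
have [inv invK] := choice (@coho_res_surj _ _ _ _ _ _ mono_l zl p rad_l).
rewrite -/resl in invK.
have inj_l : injective resl := @coho_res_inj _ _ _ _ _ _ mono_l zl p rad_l.
have inj_r : injective resr := @coho_res_inj _ _ _ _ _ _ mono_r zr p rad_r.
have rlD u v : resl (u + v) = resl u + resl v by exact: linearD.
have rrD u v : resr (u + v) = resr u + resr v by exact: linearD.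
have rlZ a u : resl (a *: u) = a *: resl u by exact: linearZ.
have rrZ a u : resr (a *: u) = a *: resr u by exact: linearZ.
exists (fun u => resr (inv (coho_push g (y := y) u))); split.
- move=> u v; rewrite -rrD; congr resr; apply: inj_l.
  by rewrite rlD !invK coho_pushD.
- move=> a u; rewrite -rrZ; congr resr; apply: inj_l.
  by rewrite rlZ !invK coho_pushZ.
- move=> u v /inj_r/(congr1 resl); rewrite !invK.
  exact: (coho_push_inj d_gt0 gV homy).
- move=> j u uj; apply: coho_res_gr.
  apply: (@coho_res_gr_inv _ _ _ _ _ _ _ mono_l zl homz rad_l p); rewrite -/resl invK.
  exact: coho_push_gr.
- move=> j v vj; have [u uv] := @coho_res_surj _ _ _ _ _ _ mono_r zr p rad_r v.
  have /(coho_res_gr mono_l zl) : coho_gr (j * d%:Z) u.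
    by apply: (@coho_res_gr_inv _ _ _ _ _ _ _ mono_r zr homz rad_r p); rewrite uv.
  move=> /(coho_push_surj d_gt0 gV homy)[w wu]; exists w; rewrite -uv; congr resr.
  by apply: inj_l; rewrite invK wu.
Qed.

End Compare.

(** * Graded duals *)

Section DualGrading.
Variables (k : fieldType) (R : gradedAlg k) (H : lmodType R) (G : int -> set H).
Variable G_M : forall (i : nat) j r h, gr R i r -> G j h -> G (i%:Z + j) (r *: h).
Variable D : grading G.
Local Notation W := (gdual G_M).

Lemma gdual_additive (f : W) u v : val f (u + v) = val f u + val f v.
Proof. by have /gdual_predP[-> _ _] := valP f. Qed.

Lemma gdual_0 (f : W) : val f 0 = 0.
Proof. by apply: (addrI (val f 0)); rewrite -gdual_additive !addr0. Qed.

Lemma gdual_scaleC (f : W) (c : k) u : val f (c%:A *: u) = c * val f u.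
Proof. by have /gdual_predP[_ -> _] := valP f. Qed.

Lemma gdual_pr_subproof (j : int) (f : W) : (fun h => val f (pr D (- j) h)) \in gdual_pred G.
Proof.
apply/gdual_predP; split=> [u v|c u|].
- by rewrite prD gdual_additive.
- by rewrite (pr_scaleA D G_M) gdual_scaleC.
- exists [:: - j] => i h; rewrite inE => /eqP ij Gh.
  by rewrite (pr_ne D Gh) // gdual_0.
Qed.

Definition gdual_pr (j : int) (f : W) : W :=
  Sub (fun h => val f (pr D (- j) h)) (gdual_pr_subproof j f).

Lemma gdual_prE j (f : W) h : val (gdual_pr j f) h = val f (pr D (- j) h).
Proof. by []. Qed.

Definition gdual_grading : grading (@gdual_gr k R H G G_M).
Proof.
apply: (@Grading _ _ gdual_pr) => [j u v|j u|j u Gu|i j u Gu ij|u].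
- by apply: val_inj; apply/funext.
- by move=> i h /eqP ij Gh; rewrite gdual_prE (pr_ne D Gh) // gdual_0.
- apply: val_inj; apply/funext => h; rewrite gdual_prE.
  elim/(grading_ind D): h => [|v w IHv IHw|i h Gh].
  + by rewrite pr0.
  + by rewrite prD !gdual_additive IHv IHw.
  + have [ij|/eqP ij] := eqVneq i (- j); first by rewrite -ij pr_id.
    by rewrite (pr_ne D Gh ij) gdual_0 (Gu i h) //; exact/eqP.
- apply: val_inj; apply/funext => h; rewrite gdual_prE.
  apply: (Gu (- j)); last exact: pr_in.
  by apply/eqP => /oppr_inj ji; apply: ij.
- have /gdual_predP[_ _ [s su]] := valP u.
  exists [seq - j | j <- undup s]; split.
    by rewrite map_inj_uniq ?undup_uniq //; exact: oppr_inj.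
  have sumE (r : seq int) (h : H) :
      val (\sum_(j <- r) gdual_pr j u) h = \sum_(j <- r) val u (pr D (- j) h).
    by elim: r => [|j r IH]; rewrite ?big_nil ?big_cons // -IH.
  apply: val_inj; apply/funext => h; rewrite sumE big_map.
  rewrite {1}(suppE D h) (big_morph (val u) (gdual_additive u) (gdual_0 u)).
  under [RHS]eq_bigr do rewrite opprK.
  apply: big_supp_eq; rewrite ?supp_uniq ?undup_uniq // => j.
    by move=> /(notin_supp) ->; rewrite gdual_0.
  by rewrite mem_undup => js; apply: (su j) => //; exact: pr_in.
Defined.

Lemma gdual_gr_M (i : nat) j r (f : W) : gr R i r -> gdual_gr j f ->
  gdual_gr (i%:Z + j) (r *: f).
Proof.
move=> Rr fj l h lij Gh; rewrite -[LHS]/(val f (r *: h)).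
apply: (fj (i%:Z + l)); last exact: G_M.
apply: contra lij => /eqP e; apply/eqP; apply: (addrI i%:Z); rewrite e; ring.
Qed.

End DualGrading.

Section DualVeronese.
Variables (k : fieldType) (A R : gradedAlg k) (d : nat) (g : {rmorphism A -> R}).
Hypothesis d_gt0 : (0 < d)%N.
Hypothesis gV : veronese_embedding d g.
Variables (H : lmodType R) (G : int -> set H).
Variable G_M : forall (i : nat) j r h, gr R i r -> G j h -> G (i%:Z + j) (r *: h).
Variables (H' : lmodType A) (G' : int -> set H').
Variable G'_M : forall (i : nat) j r h, gr A i r -> G' j h -> G' (i%:Z + j) (r *: h).
Variables (D : grading G) (D' : grading G').
Variable iota : H' -> H.
Hypothesis iotaD : forall u v, iota (u + v) = iota u + iota v.
Hypothesis iotaZ : forall a u, iota (a *: u) = g a *: iota u.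
Hypothesis iota_inj : injective iota.
Hypothesis iota_gr : forall (j : int) u, G' j u -> G (j * d%:Z) (iota u).
Hypothesis iota_surj : forall (j : int) v, G (j * d%:Z) v -> exists u, iota u = v.
Local Notation W := (gdual G_M).
Local Notation W' := (gdual G'_M).

Let iota0 : iota 0 = 0.
Proof. by apply: (addrI (iota 0)); rewrite -iotaD !addr0. Qed.

Definition veronese_part (h : H) : H :=
  glue D (fun j u => if (d%:Z %| j)%Z then u else 0) h.

Lemma veronese_partD u v :
  veronese_part (u + v) = veronese_part u + veronese_part v.
Proof. by apply: glueD => j a b; case: ifP; rewrite ?addr0. Qed.

Lemma veronese_part_hom j u : G j u ->
  veronese_part u = if (d%:Z %| j)%Z then u else 0.
Proof.
by move=> Gu; apply: (glue_hom D _ Gu) => i a b; case: ifP; rewrite ?addr0.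
Qed.

Lemma veronese_part0 : veronese_part 0 = 0.
Proof. by rewrite (veronese_part_hom (gr0_mem D 0)); case: ifP. Qed.

Lemma veronese_part_iota u : veronese_part (iota u) = iota u.
Proof.
elim/(grading_ind D'): u => [|u v IHu IHv|j u Gu].
- by rewrite iota0 veronese_part0.
- by rewrite iotaD veronese_partD IHu IHv.
- by rewrite (veronese_part_hom (iota_gr Gu)) dvdz_mull.
Qed.

Lemma veronese_part_surj h : exists u, iota u = veronese_part h.
Proof.
elim/(grading_ind D): h => [|u v [a au] [b bv]|j u Gu].
- by exists 0; rewrite iota0 veronese_part0.
- by exists (a + b); rewrite iotaD veronese_partD au bv.
- rewrite (veronese_part_hom Gu); case: ifP => dj; last by exists 0.
  by apply: (iota_surj (j := (j %/ d%:Z)%Z)); rewrite divzK.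
Qed.

(** The left inverse of iota that vanishes in the degrees not divisible by d.
    *)
Definition corestrict h : H' := sval (cid (veronese_part_surj h)).

Lemma corestrictE h : iota (corestrict h) = veronese_part h.
Proof. by rewrite /corestrict; case: cid. Qed.

Lemma corestrictD u v : corestrict (u + v) = corestrict u + corestrict v.
Proof. by apply: iota_inj; rewrite iotaD !corestrictE veronese_partD. Qed.

Lemma corestrict0 : corestrict 0 = 0.
Proof. by apply: iota_inj; rewrite corestrictE iota0 veronese_part0. Qed.

Lemma corestrictZ a u : corestrict (g a *: u) = a *: corestrict u.
Proof.
apply: iota_inj; rewrite iotaZ !corestrictE.
elim/(grading_ind (ring_grading A)): a => [|a b IHa IHb|].
- by rewrite rmorph0 !scale0r veronese_part0.
- by rewrite rmorphD !scalerDl veronese_partD IHa IHb.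
case=> [i|i] a /= Aa; last by rewrite Aa rmorph0 !scale0r veronese_part0.
elim/(grading_ind D): u => [|u v IHu IHv|j u Gu].
- by rewrite veronese_part0 !scaler0 veronese_part0.
- by rewrite scalerDr !veronese_partD scalerDr IHu IHv.
rewrite (veronese_part_hom Gu); have /(ve_gr gV) Ra := Aa.
rewrite (veronese_part_hom (G_M Ra Gu)) PoszM rpredDl ?dvdz_mull //.
by case: ifP; rewrite ?scaler0.
Qed.

Lemma corestrictK u : corestrict (iota u) = u.
Proof. by apply: iota_inj; rewrite corestrictE veronese_part_iota. Qed.

Lemma corestrict_gr j u : G (j * d%:Z) u -> G' j (corestrict u).
Proof.
move=> Gu; rewrite (gr_prE D'); apply: iota_inj.
rewrite -(pr_graded_map D' D (mul_d_inj d_gt0) iotaD iota_gr).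
by rewrite corestrictE (veronese_part_hom Gu) dvdz_mull // pr_id.
Qed.

Lemma corestrict_ndvd j u : ~~ (d%:Z %| j)%Z -> G j u -> corestrict u = 0.
Proof.
move=> /negbTE dj Gu; apply: iota_inj.
by rewrite corestrictE (veronese_part_hom Gu) dj iota0.
Qed.

Lemma dual_restrict_subproof (w : W) : (fun h => val w (iota h)) \in gdual_pred G'.
Proof.
apply/gdual_predP; split=> [u v|c u|].
- by rewrite iotaD gdual_additive.
- by rewrite iotaZ (ve_C gV) gdual_scaleC.
have /gdual_predP[_ _ [s sw]] := valP w.
exists [seq (j %/ d%:Z)%Z | j <- s] => j h js /iota_gr Gh; apply: sw Gh.
apply: contra js => js; apply/mapP; exists (j * d%:Z) => //.
by rewrite mulzK // eqz_nat -lt0n.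
Qed.

Definition dual_restrict (w : W) : W' :=
  Sub (fun h => val w (iota h)) (dual_restrict_subproof w).

Lemma dual_extend_subproof (f : W') : (fun h => val f (corestrict h)) \in gdual_pred G.
Proof.
apply/gdual_predP; split=> [u v|c u|].
- by rewrite corestrictD gdual_additive.
- by rewrite -(ve_C gV) corestrictZ gdual_scaleC.
have /gdual_predP[_ _ [s sf]] := valP f.
exists [seq j * d%:Z | j <- s] => j h js Gh.
have [dj|dj] := boolP (d%:Z %| j)%Z; last by rewrite (corestrict_ndvd dj Gh) gdual_0.
move: js Gh; rewrite -(divzK dj) => js /corestrict_gr; apply: sf.
by apply: contra js => js; apply/mapP; exists (j %/ d%:Z)%Z.
Qed.

(** Forms on H' are extended to H by zero in the degrees not divisible by d.
    *)
Definition dual_extend (f : W') : W :=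
  Sub (fun h => val f (corestrict h)) (dual_extend_subproof f).

Lemma dual_restrictE w h : val (dual_restrict w) h = val w (iota h).
Proof. by []. Qed.

Lemma dual_extendE f h : val (dual_extend f) h = val f (corestrict h).
Proof. by []. Qed.

Lemma dual_restrictD u v : dual_restrict (u + v) = dual_restrict u + dual_restrict v.
Proof. by apply: val_inj; apply/funext. Qed.

Lemma dual_restrictZ a u : dual_restrict (g a *: u) = a *: dual_restrict u.
Proof.
apply: val_inj; apply/funext => h.
by rewrite -[LHS]/(val u (g a *: iota h)) -iotaZ.
Qed.

Lemma dual_extendD u v : dual_extend (u + v) = dual_extend u + dual_extend v.
Proof. by apply: val_inj; apply/funext. Qed.

Lemma dual_extendZ a u : dual_extend (a *: u) = g a *: dual_extend u.
Proof.
apply: val_inj; apply/funext => h.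
rewrite -[RHS]/(val u (corestrict (g a *: h))) corestrictZ.
by [].
Qed.

Lemma dual_extendK f : dual_restrict (dual_extend f) = f.
Proof. by apply: val_inj; apply/funext => h; rewrite dual_restrictE dual_extendE corestrictK. Qed.

Lemma dual_restrictK j w : gdual_gr (j * d%:Z) w -> dual_extend (dual_restrict w) = w.
Proof.
move=> wj; apply: val_inj; apply/funext => h.
rewrite dual_extendE dual_restrictE.
elim/(grading_ind D): h => [|u v IHu IHv|i u Gu].
- by rewrite corestrict0 iota0.
- by rewrite corestrictD iotaD !gdual_additive IHu IHv.
rewrite corestrictE (veronese_part_hom Gu); case: ifP => // di.
rewrite gdual_0 (wj i u) //; apply: contraFN di => /eqP ->.
by rewrite rpredN dvdz_mull.
Qed.

Lemma dual_restrict_gr j w : gdual_gr (j * d%:Z) w -> gdual_gr j (dual_restrict w).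
Proof.
move=> wj i h ij /iota_gr Gh; apply: wj Gh.
apply: contra ij; rewrite -mulNr => /eqP/(mul_d_inj d_gt0) ->.
by [].
Qed.

Lemma dual_restrict_ndvd j w : ~~ (d%:Z %| j)%Z -> gdual_gr j w -> dual_restrict w = 0.
Proof.
move=> dj wj; apply: val_inj; apply/funext => h.
rewrite dual_restrictE; elim/(grading_ind D'): h => [|u v IHu IHv|i h Gh].
- by rewrite iota0 gdual_0.
- by rewrite iotaD gdual_additive IHu IHv; exact: addr0.
apply: wj (iota_gr Gh); apply: contra dj => /eqP e.
by rewrite -rpredN -e dvdz_mull.
Qed.

Lemma dual_extend_gr j f : gdual_gr j f -> gdual_gr (j * d%:Z) (dual_extend f).
Proof.
move=> fj i h ij Gh; rewrite dual_extendE.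
have [di|di] := boolP (d%:Z %| i)%Z; last by rewrite (corestrict_ndvd di Gh) gdual_0.
move: Gh; rewrite -(divzK di) => /corestrict_gr; apply: fj.
by apply: contra ij => /eqP e; rewrite -(divzK di) e mulNr.
Qed.

End DualVeronese.

(** * Veronese subalgebras as finite extensions *)

Section Monomials.
Variables (k : fieldType) (R : gradedAlg k).
Hypothesis oneR : one_generated R.
Variable s : seq R.
Hypothesis s1 : forall a, a \in s -> gr R 1 a.
Hypothesis sE : irrelevant R = ideal_of s.

Let n := size s.
Let x (i : 'I_n) : R := s`_i.

Definition monomial (b : 'I_n -> nat) : R := \prod_i x i ^+ b i.

Lemma gens_hom (i : 'I_n) : gr R 1 (x i).
Proof. by apply: s1; apply: mem_nth. Qed.

Lemma gr_prod (I : finType) (F : I -> R) (m : I -> nat) :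
  (forall i, gr R (m i) (F i)) -> gr R (\sum_i m i) (\prod_i F i).
Proof.
move=> RF; elim/big_rec2: _ => [|i u v _ Rv]; first exact: gr_1.
by apply: gr_M.
Qed.

Lemma monomial_hom b : gr R (\sum_i b i) (monomial b).
Proof.
apply: gr_prod => i; have := gr_X (b i) (gens_hom i).
by rewrite muln1.
Qed.

Lemma linear_span a : gr R 1 a -> exists c : 'I_n -> k, a = \sum_i c i *: x i.
Proof.
move=> Ra; have : irrelevant R a := irrelevant_hom Ra.
rewrite sE => -[u aE].
have [c cE] := choice (fun i => hcomp0_scalar oneR (u i)).
exists (fun i : 'I_n => c i); rewrite -{1}(hcomp_id Ra) aE hcomp_sum.
apply: eq_bigr => i _; rewrite mulrC -[1%N in LHS]addn0 (hcomp_M 0 _ (gens_hom i)).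
by rewrite cE mulrC mulr_algl.
Qed.

Lemma monomial_add b j :
  x j * monomial b = monomial (fun i => b i + (i == j))%N.
Proof.
rewrite /monomial (bigD1 j) //= [in RHS](bigD1 j) //= eqxx addn1 exprS mulrA.
by congr (_ * _); apply: eq_bigr => i /negbTE ->; rewrite addn0.
Qed.

(** An induction principle, which avoids enumerating the monomials of a given
    degree. *)
Lemma monomial_ind (P : R -> Prop) m : P 0 ->
  (forall a b, P a -> P b -> P (a + b)) ->
  (forall c b, (\sum_i b i)%N = m -> P (c *: monomial b)) ->
  forall a, gr R m a -> P a.
Proof.
elim: m P => [|m IHm] P P0 PD PM a.
  move=> /(og_gr0 oneR)[c ->].
  have -> : (1 : R) = monomial (fun=> 0%N) by rewrite /monomial big1.
  by apply: PM; rewrite big1.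
move=> /(og_mul oneR); apply: ideal_mul_sub => // b c /linear_span[u ->].
apply: (IHm (fun c => P ((\sum_i u i *: x i) * c))) => {c} [|c e|c e em]; first by rewrite mulr0.
  by rewrite mulrDr; exact: PD.
rewrite mulr_suml; elim/big_ind: _ => // i _.
rewrite -scalerAr -scalerAl scalerA monomial_add; apply: PM.
by rewrite big_split /= em (bigD1 i) //= eqxx big1 ?addn0 ?addn1 // => j /negbTE ->.
Qed.

End Monomials.

Section Embedding.
Variables (k : fieldType) (A R : gradedAlg k) (d : nat) (g : {rmorphism A -> R}).
Hypothesis d_gt0 : (0 < d)%N.
Hypothesis gV : veronese_embedding d g.
Hypothesis oneR : one_generated R.
Hypothesis noethR : noetherian R.

Lemma embedding_one_generated : one_generated A.
Proof.
split=> [a /(ve_gr gV)|n a /(ve_gr gV)].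
  move=> /(og_gr0 oneR)[c ac]; exists c; apply: (ve_inj gV).
  by rewrite (ve_C gV).
rewrite mulSn => /(gr_mul_span oneR)[m [u [v [Ru Rv aE]]]].
have pull (i : nat) (b : R) : gr R (i * d) b -> exists a, gr A i a /\ g a = b.
  by move=> Rb; have [c cb] := ve_surj gV Rb; exists c; rewrite (ve_gr gV) cb.
have Ru1 i : gr R (1 * d) (u i) by rewrite mul1n.
have [u' Hu] := choice (fun i => pull 1%N (u i) (Ru1 i)).
have [v' Hv] := choice (fun i => pull n (v i) (Rv i)).
exists m, u', v'; split=> [i|i|]; [exact: (Hu i).1 | exact: (Hv i).1 |].
apply: (ve_inj gV); rewrite aE rmorph_sum; apply: eq_bigr => i _.
by rewrite rmorphM (Hu i).2 (Hv i).2.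
Qed.

(** The projection onto the degrees divisible by d is the left inverse already
    constructed for modules, applied to the algebras themselves. *)
Lemma embedding_retract : exists rho : R -> A,
  [/\ forall u v, rho (u + v) = rho u + rho v,
      forall a u, rho (g a * u) = a * rho u & forall a, rho (g a) = a].
Proof.
have GM (i : nat) j (r : R) (h : R^o) : gr R i r -> grz j h -> grz (i%:Z + j) (r *: h).
  by move=> Rr Rh; exact: grz_M.
have gD (u v : A^o) : g (u + v) = g u + g v :> R^o by exact: rmorphD.
have gZ a (u : A^o) : g (a *: u) = g a *: (g u : R^o) by exact: rmorphM.
have gG (j : int) (u : A^o) : grz j u -> grz (j * d%:Z) (g u : R^o) by exact: ve_grz.
have gS (j : int) (v : R^o) : grz (j * d%:Z) v -> exists u : A^o, g u = v.
  by move=> /(ve_grz_surj d_gt0 gV)[u _ uv]; exists u.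
pose D : grading (@grz k R : int -> set R^o) := ring_grading R.
pose D' : grading (@grz k A : int -> set A^o) := ring_grading A.
exists (corestrict D gD gS); split=> [u v|a u|a].
- exact: (corestrictD D gD (ve_inj gV) gS).
- exact: (corestrictZ gV GM D gD gZ (ve_inj gV) gS).
- exact: (corestrictK D D' gD (ve_inj gV) gG gS).
Qed.

(** Extend an ideal of A to R and choose generators of the extension inside
    the ideal; applying the retraction to the coefficients shows that they
    already generate it over A. *)
Lemma embedding_noetherian : noetherian A.
Proof.
move=> I idI; have [rho [rhoD rhoZ rhoK]] := embedding_retract.
have rho0 : rho 0 = 0 by apply: (addrI (rho 0)); rewrite -rhoD !addr0.
pose J := ideal_mul setT [set g a | a in I].
have I0 : [set g a | a in I] 0 by exists 0; [exact: ideal_0 | rewrite rmorph0].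
have idJ : is_ideal J.
  split=> [|a b|a]; first exact: ideal_mul_0.
    exact: ideal_mulD.
  apply: ideal_mul_sub => [|u v|u v _ Iv].
  - by rewrite mulr0; exact: ideal_mul_0.
  - by rewrite mulrDr; exact: ideal_mulD.
  - by rewrite mulrA; exact: ideal_mul1.
have [s sE] := noethR idJ.
have [t [tI ts]] : exists t, (forall a, a \in t -> I a) /\
    forall b, b \in s -> ideal_of (map g t) b.
  have : forall b, b \in s -> J b by rewrite sE => b; exact: mem_ideal_of.
  elim: s {sE} => [|b s IHs] Js; first by exists [::].
  have [|t [tI st]] := IHs; first by move=> c sc; apply: Js; rewrite inE sc orbT.
  have [m [u [v [_ Iv bE]]]] := Js b (mem_head _ _).
  have Iv' i : exists a, I a /\ g a = v i by have [a Ia av] := Iv i; exists a.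
  have [w Hw] := choice Iv'.
  exists ([seq w i | i <- iota 0 m] ++ t); split=> a.
    by rewrite mem_cat => /orP[/mapP[i _ ->]|/tI//]; case: (Hw i).
  rewrite inE => /orP[/eqP ->|sa]; last first.
    by apply: ideal_ofS (st a sa) => c tc; rewrite map_cat mem_cat tc orbT.
  rewrite bE; apply: ideal_sum; first exact: is_ideal_of.
  move=> i _; apply: ideal_Ml; first exact: is_ideal_of.
  apply: mem_ideal_of; rewrite -(Hw i).2; apply: map_f.
  by rewrite mem_cat map_f // mem_iota /=.
exists t; apply/seteqP; split; last exact: ideal_of_sub.
move=> a Ia; have : J (g a).
  by rewrite -[g a]mul1r; apply: ideal_mul1 => //; exists a.
rewrite sE => /(ideal_of_sub (is_ideal_of _) ts)[c].
rewrite size_map => /(congr1 rho); rewrite rhoK => ->.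
exists (fun i => rho (c i)).
rewrite (big_morph rho rhoD rho0); apply: eq_bigr => i _.
by rewrite (nth_map 0) // mulrC rhoZ mulrC.
Qed.

(** The monomials with all exponents less than d generate R over A, because
    the d-th powers of the forms of degree one come from A. *)
Lemma embedding_krull_dim : krull_dim A = krull_dim R.
Proof.
have [s [s1 sE]] := one_generated_generators oneR noethR.
pose F := {ffun 'I_(size s) -> 'I_d}.
pose e (i : 'I_#|F|) : R := monomial (fun j => enum_val i j : nat).
apply: (krull_dim_finite_extension (e := e) (ve_inj gV)).
pose W (r : R) := exists c : F -> A, r = \sum_f g (c f) * monomial (s := s) (fun j => f j : nat).
have W0 : W 0.
  by exists (fun=> 0); rewrite big1 // => i _; rewrite rmorph0 mul0r.
have WD u v : W u -> W v -> W (u + v).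
  move=> [b ->] [c ->]; exists (fun i => b i + c i); rewrite -big_split.
  by apply: eq_bigr => i _; rewrite rmorphD mulrDl.
have WR r : W r.
  elim/gr_ind: r => // m r; apply: (monomial_ind oneR s1 sE) => // c b _.
  have Ry (j : 'I_(size s)) : gr R (b j %/ d * d) (s`_j ^+ (b j %/ d * d)).
    have := gr_X (b j %/ d * d) (gens_hom s1 j).
    by rewrite muln1.
  have [y Hy] := choice (fun j => ve_surj gV (Ry j)).
  pose f0 : F := [ffun j => Ordinal (ltn_pmod (b j) d_gt0)].
  exists (fun f => if f == f0 then c%:A * \prod_j y j else 0).
  rewrite (bigD1 f0) //= eqxx [X in _ + X]big1 ?addr0; last first.
    by move=> f /negbTE ->; rewrite rmorph0 mul0r.
  rewrite rmorphM (ve_C gV) -scalerAl mul1r -scalerAl; congr (_ *: _).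
  rewrite rmorph_prod -big_split; apply: eq_bigr => j _.
  rewrite -[RHS]/(g (y j) * s`_j ^+ f0 j) Hy -exprD ffunE /=.
  by rewrite -divn_eq.
move=> r; have [c ->] := WR r; exists (fun i => c (enum_val i)).
rewrite /= (reindex (@enum_val F predT)) /= ?subrr //.
by apply: onW_bij; exact: enum_val_bij.
Qed.

End Embedding.

(** * Dimension at the irrelevant ideal *)

Section Star.
Variables (k : fieldType) (R : gradedAlg k).
Implicit Types (a b : R) (P : set R).

(** For an ideal P, this is the largest homogeneous ideal contained in P. *)
Definition star P : set R := [set a | forall i, P (hcomp i a)].

Lemma star_sub P : is_ideal P -> star P `<=` P.
Proof.
move=> idP a Pa; have [n an] := hcomp_sumE a; rewrite (an n (leqnn n)).
by apply: ideal_sum => // i _; exact: Pa.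
Qed.

Lemma star_hom P i a : is_ideal P -> gr R i a -> star P a <-> P a.
Proof.
move=> idP Ra; split; first exact: star_sub.
by move=> Pa j; rewrite (hcomp_hom _ Ra); case: eqP => // _; exact: ideal_0.
Qed.

Lemma star_hcomp P i a : is_ideal P -> star P a -> star P (hcomp i a).
Proof.
by move=> idP Pa j; rewrite (hcomp_hom _ (hcomp_in i a)); case: eqP => // _; exact: ideal_0.
Qed.

Lemma is_ideal_star P : is_ideal P -> is_ideal (star P).
Proof.
move=> idP; split=> [i|a b Pa Pb i|a b Pb i]; first by rewrite hcomp0; exact: ideal_0.
  by rewrite hcompD; exact: ideal_D.
elim/gr_ind: a => [|a c IHa IHc|l a Ra].
- by rewrite mul0r hcomp0; exact: ideal_0.
- by rewrite mulrDl hcompD; exact: ideal_D.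
- have [il|li] := ltnP i l; first by rewrite (hcomp_Mlt _ Ra) //; exact: ideal_0.
  by rewrite -(subnKC li) (hcomp_M _ _ Ra); exact: ideal_Ml.
Qed.

Lemma order_geMM i j a b : order_ge i a -> order_ge j b -> order_ge (i + j) (a * b).
Proof.
move=> oa ob; have [n an] := hcomp_sumE a; rewrite (an n (leqnn n)).
rewrite mulr_suml => l lij; rewrite hcomp_sum big1 // => m _.
have [mi|im] := ltnP m i; first by rewrite oa // mul0r hcomp0.
by apply: (order_geM (hcomp_in _ _) ob); apply: leq_trans lij _; rewrite leq_add2r.
Qed.

Lemma hcomp_lowest i j a b : order_ge i a -> order_ge j b ->
  hcomp (i + j) (a * b) = hcomp i a * hcomp j b.
Proof.
move=> oa ob; have oa' : order_ge i.+1 (a - hcomp i a).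
  move=> l; rewrite ltnS leq_eqVlt hcompD hcompN => /orP[/eqP ->|li].
    by rewrite (hcomp_id (hcomp_in i a)) subrr.
  by rewrite oa // (hcomp_ne (hcomp_in i a)) ?subr0 // ltn_eqF.
rewrite -{1}[a](subrK (hcomp i a)) mulrDl hcompD (order_geMM oa' ob) ?addSn //.
by rewrite add0r (hcomp_M _ _ (hcomp_in i a)).
Qed.

(** Discard the components below the first one that is not in P. *)
Lemma star_trunc P a : is_ideal P -> ~ star P a -> exists i b,
  [/\ star P (a - b), order_ge i b & ~ P (hcomp i b)].
Proof.
move=> idP Pa; have exi : exists i, `[< ~ P (hcomp i a) >].
  by apply: contrapT => noi; apply: Pa => i; apply: contrapT => Pi;
    apply: noi; exists i; apply/asboolP.
case: (ex_minnP exi) => i /asboolP Pi imin.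
pose c := \sum_(l < i) hcomp l a.
have cpc l : hcomp l c = if (l < i)%N then hcomp l a else 0.
  rewrite /c hcomp_sum; case: ifP => li.
    rewrite (bigD1 (Ordinal li)) //= (hcomp_id (hcomp_in _ _)) big1 ?addr0 // => m ml.
    by apply: (hcomp_ne (hcomp_in _ _)); rewrite eq_sym; move: ml; rewrite -(inj_eq val_inj).
  rewrite big1 // => m _; apply: (hcomp_ne (hcomp_in _ _)).
  by apply: contraFN li => /eqP ->.
exists i, (a - c); split.
- rewrite opprB addrC subrK => l; rewrite cpc; case: ifP => li; last exact: ideal_0.
  by apply: contrapT => Pl; move: li; rewrite ltnNge imin //; exact/asboolP.
- by move=> l li; rewrite hcompD hcompN cpc li subrr.
- by rewrite hcompD hcompN cpc ltnn subr0.
Qed.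

(** If a and b are not in the ideal, truncate them at their first components
    outside P. The product of these components is the lowest component of a
    product that is congruent to a * b. *)
Lemma star_prime P : is_prime P -> is_prime (star P).
Proof.
move=> primeP; have idP := prime_ideal primeP; have idS := is_ideal_star idP.
split=> // [S1|a b Sab]; first by case: primeP => _ + _; apply; exact: star_sub S1.
apply: contrapT => /not_orP[/(star_trunc idP)[i [a' [aa' oa Pa]]]].
move=> /(star_trunc idP)[j [b' [bb' ob Pb]]].
have : star P (a' * b').
  rewrite (_ : a' * b' = a * b - (a * (b - b') + (a - a') * b')); last by ring.
  apply: (ideal_B idS Sab); apply: (ideal_D idS).
    exact: (ideal_Ml _ idS).
  exact: (ideal_Mr _ idS).
by move=> /(_ (i + j)%N); rewrite hcomp_lowest // => /(prime_M primeP)[].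
Qed.

End Star.

Section ChainInIrrelevant.
Variables (k : fieldType) (R : gradedAlg k).
Hypothesis oneR : one_generated R.
Hypothesis noethR : noetherian R.

Lemma star_irrelevant (P : set R) : is_prime P -> star P `<=` irrelevant R.
Proof. by move=> primeP a Pa; apply: (prime_hcomp0 oneR primeP); exact: Pa. Qed.

Lemma irrelevant_maximal (P P' : set R) : is_prime P' -> irrelevant R `<=` P ->
  P `<=` P' -> P' `<=` irrelevant R.
Proof.
move=> primeP' IP PP' y P'y; have idP' := prime_ideal primeP'.
apply: (prime_hcomp0 oneR primeP'); rewrite -[hcomp 0 y](subKr y).
apply: ideal_B => //; apply/PP'/IP; apply/irrelevantP.
by rewrite hcompD hcompN (hcomp_id (hcomp_in 0 y)) subrr.
Qed.

Variables (s : seq R) (f : R) (p : set R) (N : nat).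
Hypothesis s1 : forall a, a \in s -> gr R 1 a.
Hypothesis sE : irrelevant R = ideal_of s.
Hypothesis idp : is_ideal p.
Hypothesis nil_s : forall i : 'I_(size s), exists2 h,
  gr R N h & p (s`_i ^+ N.+1 - f * h).

Let F := {ffun 'I_(size s) -> 'I_N.+1}.
Let e (i : 'I_#|F|) : R := monomial (s := s) (fun j => enum_val i j : nat).

(** Modulo p, a monomial with an exponent larger than N is f times a form of
    smaller degree. By induction on the degree, the finitely many other
    monomials generate R over k[f] modulo p. *)
Lemma generates_mod_line : generates_mod (horner_alg f) e p.
Proof.
pose W (r : R) := exists c : F -> {poly k},
  p (r - \sum_f0 horner_alg f (c f0) * monomial (s := s) (fun j => f0 j : nat)).
have W0 r : p r -> W r.
  move=> pr; exists (fun=> 0); rewrite big1 ?subr0 // => i _.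
  by rewrite rmorph0 mul0r.
have WD u v : W u -> W v -> W (u + v).
  move=> [b pu] [c pv]; exists (fun i => b i + c i).
  under eq_bigr do rewrite rmorphD mulrDl.
  by rewrite big_split opprD addrACA; exact: ideal_D.
have WM q u : W u -> W (horner_alg f q * u).
  move=> [c pu]; exists (fun i => q * c i).
  under eq_bigr do rewrite rmorphM -mulrA.
  by rewrite -mulr_sumr -mulrBr; exact: ideal_Ml.
have WZ c u : W u -> W (c *: u).
  by move=> /(WM c%:P); rewrite horner_algC mulr_algl.
have Wm m : forall a, gr R m a -> W a.
  elim/ltn_ind: m => m IHm; apply: (monomial_ind oneR s1 sE) => //.
    by apply: W0; exact: ideal_0.
  move=> c b bm; apply: WZ.
  have [[j Nj]|small] := pselect (exists j, N < b j)%N.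
    have [h Rh ph] := nil_s j.
    pose b' (i : 'I_(size s)) := (b i - (i == j) * N.+1)%N.
    have bE : monomial b = s`_j ^+ N.+1 * monomial b'.
      rewrite /monomial (bigD1 j) //= [in RHS](bigD1 j) //= mulrA -exprD /b' eqxx.
      rewrite mul1n subnKC //; congr (_ * _); apply: eq_bigr => i /negbTE ->.
      by rewrite mul0n subn0.
    have b'm : (N.+1 + \sum_i b' i)%N = m.
      rewrite -bm (bigD1 j) //= [in RHS](bigD1 j) //= addnA /b' eqxx mul1n subnKC //.
      by congr (_ + _)%N; apply: eq_bigr => i /negbTE ->; rewrite mul0n subn0.
    have -> : monomial b = f * (h * monomial b') + (s`_j ^+ N.+1 - f * h) * monomial b'.
      by rewrite bE; ring.
    apply: WD; last by apply: W0; exact: ideal_Mr.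
    have -> : f = horner_alg f 'X by rewrite horner_algX.
    apply/WM/(IHm (N + \sum_i b' i)%N); first by rewrite -b'm addSn.
    exact: gr_M Rh (monomial_hom s1 _).
  pose f0 : F := [ffun j => inord (b j)].
  exists (fun i => if i == f0 then 1 else 0).
  rewrite [X in _ - X](_ : _ = monomial b) ?subrr; first exact: ideal_0.
  rewrite (bigD1 f0) //= eqxx [X in _ + X]big1 ?addr0; last first.
    by move=> i /negbTE ->; rewrite rmorph0 mul0r.
  rewrite rmorph1 mul1r; apply: eq_bigr => j _; rewrite ffunE inordK // ltnS leqNgt.
  by apply/negP => Nj; apply: small; exists j.
have WR r : W r.
  elim/gr_ind: r => [|u v|i a]; [by apply: W0; exact: ideal_0 | exact: WD | exact: Wm].
move=> r; have [c pc] := WR r; exists (fun i => c (enum_val i)).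
move: pc; rewrite (reindex (@enum_val F predT)) //=.
by apply: onW_bij; exact: enum_val_bij.
Qed.

End ChainInIrrelevant.

(** A nonzero element c0 of least degree in the prime I1 is coprime to c1, by
    unique factorization; a Bezout relation then puts 1 in I2. *)
Lemma poly_prime_maximal (k : fieldType) (I1 I2 : set {poly k}) c0 c1 :
  is_prime I1 -> is_ideal I2 -> I1 `<=` I2 -> I1 c0 -> c0 != 0 ->
  I2 c1 -> ~ I1 c1 -> I2 1.
Proof.
move=> primeI1 idI2 I12 I1c0 c00 I2c1 I1c1; have idI1 := prime_ideal primeI1.
have exm : exists m, `[< exists c, [/\ I1 c, c != 0 & size c = m] >].
  by exists (size c0); apply/asboolP; exists c0.
case: (ex_minnP exm) => m /asboolP[{c0 I1c0 c00}c0 [I1c0 c00 cm]] minm.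
have [[u v] /= uv] := Bezoutp c0 c1.
have I2g : I2 (gcdp c0 c1).
  move: uv => /eqpP[[a b] /= /andP[a0 b0] ab].
  rewrite -[gcdp _ _](scalerK b0) -ab scalerA -mul_polyC.
  apply: ideal_Ml => //; apply: ideal_D => //; apply: ideal_Ml => //.
  exact: I12.
have g0 : gcdp c0 c1 != 0 by rewrite gcdp_eq0 negb_and c00.
have /dvdpP[h hE] := dvdp_gcdl c0 c1; have /dvdpP[h' h'E] := dvdp_gcdr c0 c1.
have I1h : I1 h.
  move: (I1c0); rewrite hE => /(prime_M primeI1)[//|I1g].
  by case: I1c1; rewrite h'E; exact: ideal_Ml.
have h0 : h != 0 by apply: contraNneq c00 => h0; rewrite hE h0 mul0r.
have mh : (m <= size h)%N by apply: minm; apply/asboolP; exists h.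
have /size_poly1P[a a0 gE] : size (gcdp c0 c1) == 1%N.
  move: mh; rewrite -cm {1}hE size_mul // -[size (gcdp _ _)]prednK ?size_poly_gt0 //.
  by rewrite addnS /= -[leqRHS]addn0 leq_add2l leqn0 => /eqP ->.
have -> : (1 : {poly k}) = a^-1%:P * gcdp c0 c1 by rewrite gE -polyCM mulVf.
exact: ideal_Ml.
Qed.

(** The primes of the given chain P 0, P 1, P 2 need be neither homogeneous
    nor contained in the irrelevant ideal. Let p be the largest homogeneous
    ideal in P 0, which is prime, and let f be a form of degree one outside P
    0. If some form x of degree one is not nilpotent modulo p + (f), a prime
    over p + (f) that avoids the powers of x contains a homogeneous prime,
    which lies strictly between p and the irrelevant ideal. Otherwise R is
    finite over k[f] modulo p. Then P 1 and P 2 contract to distinct primes of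
    k[X], and the smaller one is nonzero as P 1 contains p strictly; this is
    impossible, because nonzero primes of k[X] are maximal. *)
Lemma chain_in_irrelevant (k : fieldType) (R : gradedAlg k) :
  one_generated R -> noetherian R -> prime_chain R 2 ->
  exists p Q : set R, [/\ is_prime p, is_prime Q, p `<` Q & Q `<` irrelevant R].
Proof.
move=> oneR noethR [P [primeP ltP]].
have [primeP0 primeP1 primeP2] := And3 (primeP 0 isT) (primeP 1 isT) (primeP 2 isT).
have [idP0 idP1 idP2] := And3 (prime_ideal primeP0) (prime_ideal primeP1) (prime_ideal primeP2).
have [[P01 P10] [P12 P21]] := (ltP 0 isT, ltP 1 isT).
have [s [s1 sE]] := one_generated_generators oneR noethR.
pose p := star (P 0); have idp : is_ideal p by exact: is_ideal_star.
have pP0 : p `<=` P 0 by exact: star_sub.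
have [f Rf P0f] : exists2 f, gr R 1 f & ~ P 0 f.
  apply: contrapT => nof; apply: P10.
  apply: subset_trans (irrelevant_maximal oneR primeP1 _ P01) _.
    rewrite sE; apply: ideal_of_sub => // a /s1 Ra.
    by apply: contrapT => P0a; apply: nof; exists a.
  rewrite sE; apply: ideal_of_sub => // a /s1 Ra.
  by apply: contrapT => P0a; apply: nof; exists a.
pose J : set R := [set a | exists2 u, p u & exists r, a = u + r * f].
have idJ : is_ideal J.
  split=> [|a b [u pu [r ->]] [v pv [t ->]]|a b [u pu [r ->]]].
  - by exists 0; [exact: (ideal_0 idp) | exists 0; rewrite mul0r addr0].
  - exists (u + v); [exact: (ideal_D idp) | exists (r + t)].
    by rewrite mulrDl addrACA.
  - exists (a * u); [exact: (ideal_Ml _ idp) | exists (a * r)].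
    by rewrite mulrDr mulrA.
have pJ : p `<=` J by move=> u pu; exists u => //; exists 0; rewrite mul0r addr0.
have Jf : J f by exists 0; [exact: (ideal_0 idp) | exists 1; rewrite mul1r add0r].
have [[x Rx Jx]|nil] := pselect (exists2 x, gr R 1 x & forall n, ~ J (x ^+ n)).
  have [||a Ja [n _ aE]|Q [primeQ JQ Qx]] := @prime_avoiding R J [set x ^+ n | n in setT] idJ.
  - by exists 0%N.
  - by move=> a b [n _ <-] [m _ <-]; exists (n + m)%N; rewrite ?exprD.
  - by apply: (Jx n); rewrite aE.
  have idQ := prime_ideal primeQ.
  exists p, (star Q); split; [exact: star_prime | exact: star_prime | |].
    split=> [u pu i|QP]; first by apply/JQ/pJ; exact: star_hcomp.
    by apply/P0f/pP0/QP/(star_hom idQ Rf)/JQ.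
  split=> [|IQ]; first exact: star_irrelevant.
  by apply: (Qx x); [apply/(star_hom idQ Rx)/IQ; exact: irrelevant_hom Rx | exists 1%N].
have [N HN] : exists N, forall i : 'I_(size s), J (s`_i ^+ N).
  apply: uniform_bound => [i m m' mm' Ji|i].
    by rewrite -(subnK mm') exprD; exact: ideal_Ml.
  apply: contrapT => noi; apply: nil; exists s`_i; first exact/s1/mem_nth.
  by move=> n Jn; apply: noi; exists n.
have nil_s (i : 'I_(size s)) : exists2 h, gr R N h & p (s`_i ^+ N.+1 - f * h).
  have [u pu [r uE]] : J (s`_i ^+ N.+1) by rewrite exprS; exact: ideal_Ml.
  have Rs : gr R N.+1 (s`_i ^+ N.+1).
    by have := gr_X N.+1 (s1 _ (mem_nth 0 (ltn_ord i))); rewrite muln1.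
  exists (hcomp N r); first exact: hcomp_in.
  rewrite -(hcomp_id Rs) uE hcompD mulrC -add1n (hcomp_M _ _ Rf) addrK.
  exact: star_hcomp.
have gp := generates_mod_line oneR s1 sE idp nil_s.
have gP1 := generates_modS (subset_trans pP0 P01) gp.
have primep : is_prime p by exact: star_prime.
have [y P1y P0y] : exists2 y, P 1 y & ~ P 0 y.
  by apply: contrapT => noy; apply: P10 => y P1y; apply: contrapT => P0y; apply: noy; exists y.
have [c0 P1c0 pc0] := incomparable primep idP1 (subset_trans pP0 P01) gp P1y
  (fun py => P0y (pP0 _ py)).
have [z P2z P1z] : exists2 z, P 2 z & ~ P 1 z.
  by apply: contrapT => noz; apply: P21 => z P2z; apply: contrapT => P1z; apply: noz; exists z.
have [c1 P2c1 P1c1] := incomparable primeP1 idP2 P12 gP1 P2z P1z.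
have [] : ~ P 2 1 by case: primeP2.
rewrite -(rmorph1 (horner_alg f)).
apply: (poly_prime_maximal (I2 := horner_alg f @^-1` P 2)
  (prime_preimage (horner_alg f) primeP1) _ _ P1c0 _ P2c1 P1c1).
- exact: prime_ideal (prime_preimage (horner_alg f) primeP2).
- by move=> c; exact: P12.
- by apply/eqP => c00; apply: pc0; rewrite c00 rmorph0; exact: (ideal_0 idp).
Qed.

(** * Depth at the irrelevant ideal *)

Section LocalPrimes.
Variables (A : comNzRingType) (M : set A) (primeM : is_prime M).
Local Notation S := (prime_compl primeM).
Local Notation L := (loc_at primeM).

Lemma prime_complP a : a \in S <-> ~ M a.
Proof. by rewrite inE; split=> [/negP Ma /mem_set|Ma]; last apply/negP => /set_mem. Qed.

Definition local_ideal (P : set A) : set L :=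
  [set u | exists2 a, P a & exists s, u = frac_of a s].

(** The numerator of a fraction in the extension of a prime inside M is
    determined up to factors outside M. *)
Lemma local_idealE P a (s : denominator S) : is_prime P -> P `<=` M ->
  local_ideal P (frac_of a s : L) <-> P a.
Proof.
move=> primeP PM; split=> [[b Pb [t /frac_eqP[r Sr]]]|Pa]; last by exists a => //; exists s.
rewrite mulrBr => /subr0_eq rE; have idP := prime_ideal primeP.
have notP c : c \in S -> ~ P c by move=> /prime_complP Mc /PM.
have : P (r * (a * sval t)) by rewrite rE; apply: ideal_Ml => //; exact: ideal_Mr.
move=> /(prime_M primeP)[/(notP _ Sr)//|/(prime_M primeP)[//|]].
by move=> /(notP _ (valP t)).
Qed.

Lemma loc_mul_frac a b (s t : denominator S) :
  (frac_of a s : L) * (frac_of b t : L) = frac_of (a * b) (denM s t).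
Proof. exact: loc_mulE. Qed.

Lemma loc_add_frac a b (s t : denominator S) :
  (frac_of a s : L) + (frac_of b t : L) =
  frac_of (a * sval t + b * sval s) (denM s t).
Proof. exact: loc_addrE. Qed.

Lemma local_ideal_prime P : is_prime P -> P `<=` M -> is_prime (local_ideal P).
Proof.
move=> primeP PM; have idP := prime_ideal primeP.
split=> [||u v].
- split=> [|u v|u v].
  + by exists 0; [exact: ideal_0 | exists (den1 S)].
  + move=> [a Pa [s ->]] [b Pb [t ->]]; rewrite loc_add_frac local_idealE //.
    by apply: ideal_D => //; exact: ideal_Mr.
  + have [a [s ->]] := fracP u; move=> [b Pb [t ->]].
    by rewrite loc_mul_frac local_idealE //; exact: ideal_Ml.
- rewrite -[1]/(frac_of 1 (den1 S)) local_idealE //.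
  by case: primeP.
- have [a [s ->]] := fracP u; have [b [t ->]] := fracP v.
  rewrite loc_mul_frac !local_idealE //; exact: prime_M.
Qed.

Lemma local_chain p Q : is_prime p -> is_prime Q -> p `<` Q -> Q `<` M ->
  prime_chain L 2.
Proof.
move=> primep primeQ [pQ Qp] [QM MQ].
exists (fun i => local_ideal (if i is j.+1 then if j is 0%N then Q else M else p)).
have pM := subset_trans pQ QM.
have lt P P' : is_prime P -> is_prime P' -> P' `<=` M -> P `<=` P' -> ~ P' `<=` P ->
    local_ideal P `<` local_ideal P'.
  move=> primeP primeP' P'M PP' P'P; split=> [_ [a /PP' Pa [s ->]]|sub].
    by exists a => //; exists s.
  apply: P'P => a P'a; have PM := subset_trans PP' P'M.
  apply/(local_idealE a (den1 S) primeP PM)/sub.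
  exact/(local_idealE a (den1 S) primeP' P'M).
split=> [[|[|[|]]]|[|[|]]] // _.
- exact: local_ideal_prime.
- exact: local_ideal_prime.
- exact: local_ideal_prime.
- exact: lt.
- exact: lt.
Qed.

Lemma local_regular_pair : (2%:Z%:E <= depth L)%E -> exists u v : L,
  [/\ forall w, u * w <> 1, forall w, v * w <> 1,
      forall w, u * w = 0 -> w = 0 &
      forall w z, v * w = z * u -> exists c, w = c * u].
Proof.
move=> /sup_nat_le[s [nonunit [_ reg]] s2].
exists s`_0, s`_1; split=> [w|w|w uw|w z vw].
- by apply: nonunit; apply: mem_nth; exact: ltnW.
- by apply: nonunit; exact: mem_nth.
- have := reg 0%N w (ltnW s2); rewrite take0 => -[|c ->]; last by rewrite big_ord0.
  by exists (fun=> 0); rewrite big_ord0 uw.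
- have E (t : seq L) : (1 < size t)%N -> take 1 t = [:: t`_0].
    by case: t => //= a t _; rewrite take0.
  have := reg 1%N w s2; rewrite E //= => -[|c ->].
    by exists (fun=> z); rewrite big_ord_recl big_ord0 addr0.
  by exists (c 0%N); rewrite big_ord_recl big_ord0 addr0.
Qed.

Lemma local_nonunit a (s : denominator S) :
  (forall w : L, (frac_of a s : L) * w <> 1) -> M a.
Proof.
move=> nu; apply: contrapT => /prime_complP Sa.
apply: (nu (frac_of (sval s) (Sub a Sa))); rewrite loc_mul_frac.
by rewrite -[1]/(frac_of 1 (den1 S)); apply: frac_eq => /=; ring.
Qed.

End LocalPrimes.

Section Grade.
Variables (k : fieldType) (R : gradedAlg k).
Hypothesis oneR : one_generated R.
Hypothesis noethR : noetherian R.
Hypothesis R_dim : ((2%:Z)%:E <= krull_dim R)%E.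
Hypothesis R_S2 : serre R 2.

Let primeM := irrelevant_prime oneR.
Local Notation S := (prime_compl primeM).
Local Notation L := (loc_at primeM).

Lemma dim_local_ge2 : ((2%:Z)%:E <= krull_dim L)%E.
Proof.
have [n [P [primeP ltP]] n2] := sup_nat_le (f := id) R_dim.
have [|p [Q [primep primeQ pQ QM]]] := chain_in_irrelevant oneR noethR.
  exists P; split=> i i2; [apply: primeP | apply: ltP]; exact: leq_trans i2 n2.
by apply: (@sup_nat_ge _ id) (local_chain primeM primep primeQ pQ QM).
Qed.

Lemma depth_local_ge2 : ((2%:Z)%:E <= depth L)%E.
Proof.
by have := R_S2 primeM; rewrite min_l // dim_local_ge2.
Qed.

Lemma frac_eq0 r (s : denominator S) : (frac_of r s : L) = 0 -> r = 0.
Proof.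
move=> /frac_eq0P[t /prime_complP It tr]; exact: (mul_irrelevant_compl oneR It).
Qed.

Lemma irrelevant_span a : irrelevant R a -> exists n (x c : nat -> R),
  (forall i, gr R 1 (x i)) /\ a = \sum_(i < n) c i * x i.
Proof.
have [s [s1 sE]] := one_generated_generators oneR noethR.
rewrite sE => -[c aE]; exists (size s), (fun i => s`_i), c; split=> // i.
have [si|si] := ltnP i (size s); first exact/s1/mem_nth.
by rewrite nth_default //; exact: gr_0.
Qed.

(** A regular element of the localization has its numerator in the irrelevant
    ideal, that is, in the ideal generated by the forms of degree one. It
    therefore kills r, so r vanishes in the localization, hence in R. *)
Lemma grade0 r : (forall x, gr R 1 x -> x * r = 0) -> r = 0.
Proof.
move=> xr; have [u [v [nu _ reg _]]] := local_regular_pair depth_local_ge2.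
have [a [s uE]] := fracP u; rewrite uE in nu reg.
have [n [x [c [Rx aE]]]] := irrelevant_span (local_nonunit nu).
apply: (@frac_eq0 _ (den1 S)); apply: reg; rewrite loc_mul_frac.
apply/frac_eq0P; exists 1; first exact: rpred1.
rewrite mul1r aE mulr_suml big1 // => i _.
by rewrite -mulrA xr ?mulr0.
Qed.

Lemma grade0_hom e r : (forall x, gr R e x -> x * r = 0) -> r = 0.
Proof.
elim: e r => [|e IHe] r xr; first by rewrite -[r]mul1r xr //; exact: gr_1.
apply: IHe => y Ry; apply: grade0 => x Rx.
by rewrite mulrA xr //; have := gr_M Rx Ry; rewrite add1n.
Qed.

(** Extended linearly to the irrelevant ideal, phi can be evaluated at the
    numerators a and b of a regular sequence of the localization. The symmetry
    b * phi a = a * phi b and regularity show that phi is the multiplication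
    by a fraction c / m. Since m has an invertible constant term, comparing
    the components of degree 1 + j in the relation m * phi x = x * c replaces
    c / m by a component of c, up to a scalar. *)
Lemma grade1 (phi : R -> R) (j : int) :
  (forall x, gr R 1 x -> grz (1 + j) (phi x)) ->
  (forall x y, gr R 1 x -> gr R 1 y -> x * phi y = y * phi x) ->
  exists2 r, grz j r & forall x, gr R 1 x -> phi x = x * r.
Proof.
move=> phi_gr phi_sym.
have [u [v [nu nv regu regv]]] := local_regular_pair depth_local_ge2.
have [a [s uE]] := fracP u; have [b [t vE]] := fracP v; subst u v.
have ext c : irrelevant R c -> exists al, forall x, gr R 1 x -> x * al = c * phi x.
  move=> /irrelevant_span[n [y [e [Ry ->]]]].
  exists (\sum_(i < n) e i * phi (y i)) => x Rx.
  rewrite mulr_sumr mulr_suml; apply: eq_bigr => i _.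
  by rewrite mulrCA (phi_sym x) // mulrA.
have Ia := local_nonunit nu; have Ib := local_nonunit nv.
have [al Hal] := ext a Ia; have [be Hbe] := ext b Ib.
(* al and be play the roles of phi a and phi b. *)
have E : b * al = a * be.
  apply/eqP; rewrite -subr_eq0; apply/eqP/grade0 => x Rx.
  by rewrite mulrBr !(mulrCA x) Hal // Hbe // mulrCA subrr.
have [] := regv (frac_of (al * sval t) (den1 S)) (frac_of (be * sval s) (den1 S)).
  rewrite !loc_mul_frac; apply: frac_eq => /=.
  transitivity (b * al * (sval t * sval s)); first by ring.
  by rewrite E; ring.
move=> w; have [c [q ->]] := fracP w; rewrite loc_mul_frac.
move=> /frac_eqP[z /prime_complP Sz]; rewrite /= => zE.
pose m := sval t * sval q * sval s.
have mE x : gr R 1 x -> m * phi x = x * c.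
  move=> Rx; apply/eqP; rewrite -subr_eq0; apply/eqP.
  apply: (@frac_eq0 _ (den1 S)); apply: regu; rewrite loc_mul_frac.
  apply/frac_eq0P; exists 1; rewrite ?rpred1 // mul1r.
  apply: (mul_irrelevant_compl oneR Sz).
  transitivity (z * (x * al * (sval t * (sval q * sval s)) - x * c * a)).
    by rewrite Hal // /m; ring.
  transitivity (x * (z * (al * sval t * (sval q * sval s) - c * a * 1))); first by ring.
  by rewrite zE mulr0.
have Im : ~ irrelevant R m.
  have In (r : denominator S) : ~ irrelevant R (sval r).
    by apply/prime_complP; exact: (valP r).
  by move=> /(prime_M primeM)[/(prime_M primeM)[]|]; exact: In.
have [l lE] := hcomp0_scalar oneR m.
have l0 : l != 0.
  by apply/eqP => l0; apply: Im; apply/irrelevantP; rewrite lE l0 scale0r.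
exists (hcompz j (l^-1 *: c)); first exact: (pr_in (ring_grading R)).
move=> x Rx; rewrite -(hcompz_M _ _ Rx) -scalerAr -mE //.
(* Only the constant term of m contributes in degree 1 + j. *)
have mphi i : hcompz (1 + j) (hcomp i m * phi x) = if i == 0%N then hcomp 0 m * phi x else 0.
  have := grz_M (hcomp_in i m) (phi_gr x Rx); case: eqP => [->|/eqP i0] Rphi.
    by rewrite add0r in Rphi; exact: (pr_id (ring_grading R) Rphi).
  apply: (pr_ne (ring_grading R) Rphi) => /eqP.
  by rewrite -subr_eq0 addrK eqz_nat (negbTE i0).
have [n mn] := hcomp_sumE m.
have -> : hcompz (1 + j) (l^-1 *: (m * phi x)) = l^-1 *: hcompz (1 + j) (m * phi x).
  have := hcompz_M (1 + j) (m * phi x) (gr_C R l^-1).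
  by rewrite add0r !mulr_algl.
rewrite (mn n.+1 (leqnSn n)) mulr_suml.
rewrite [hcompz _ _](pr_sum (ring_grading R)) big_ord_recl /= mphi eqxx big1 ?addr0.
  by rewrite lE mulr_algl scalerA mulVf // scale1r.
by move=> i _; rewrite mphi.
Qed.

(** Induction on the degree. For x of degree e + 1 the map sending y to phi (x
    * y) is the multiplication by some r x, and r inherits the symmetry of phi
    one degree lower, because forms of positive degree have no common
    annihilator. *)
Lemma grade_hom e (phi : R -> R) (j : int) :
  (forall x, gr R e.+1 x -> grz (e.+1%:Z + j) (phi x)) ->
  (forall x y, gr R e.+1 x -> gr R e.+1 y -> x * phi y = y * phi x) ->
  exists2 r, grz j r & forall x, gr R e.+1 x -> phi x = x * r.
Proof.
elim: e phi => [|e IHe] phi phi_gr phi_sym; first exact: grade1.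
have Hr x : exists r : R, gr R e.+1 x -> grz (e.+1%:Z + j) r /\
    forall y, gr R 1 y -> phi (x * y) = y * r.
  have [Rx|nRx] := pselect (gr R e.+1 x); last by exists 0.
  have Rxy y : gr R 1 y -> gr R e.+2 (x * y).
    by move=> Ry; rewrite -addn1; exact: gr_M.
  have [y Ry|y z Ry Rz|r Rr rE] := @grade1 (fun y => phi (x * y)) (e.+1%:Z + j).
  - by rewrite addrA -PoszD add1n; apply: phi_gr; exact: Rxy.
  - apply/eqP; rewrite -subr_eq0; apply/eqP; apply: (@grade0_hom e.+2) => w Rw.
    rewrite mulrBr !(mulrCA w) !(phi_sym w) //; try exact: Rxy.
    by ring.
  - by exists r.
have [r rP] := choice Hr.
have [x Rx|x y Rx Ry|t Rt tE] := IHe r.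
- exact: (rP x Rx).1.
- apply/eqP; rewrite -subr_eq0; apply/eqP; apply: grade0 => z Rz.
  have Rxz u : gr R e.+1 u -> gr R e.+2 (u * z).
    by move=> Ru; rewrite -addn1; exact: gr_M.
  rewrite mulrBr !(mulrCA z) -(rP x Rx).2 // -(rP y Ry).2 //.
  apply: (@grade0_hom e.+2) => w Rw.
  rewrite mulrBr !(mulrCA w) !(phi_sym w) //; try exact: Rxz.
  by ring.
exists t => // x Rx; apply/eqP; rewrite -subr_eq0; apply/eqP.
apply: (@grade0_hom e.+1) => y Ry; apply: grade0 => z Rz.
have Ryz : gr R e.+2 (y * z) by rewrite -addn1; exact: gr_M.
rewrite mulrA (mulrC z) mulrBr phi_sym // (rP y Ry).2 // tE //.
by ring.
Qed.

End Grade.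

(** * Canonical modules of Veronese subalgebras *)

Section VeroneseVal.
Variables (k : fieldType) (R : gradedAlg k) (d : nat) (d_gt0 : (0 < d)%N).
Local Notation A := (veronese R d_gt0).

Definition veronese_val (a : A) : R := val (a : veronese_type R d).

Lemma veronese_val_zmod_morphism : zmod_morphism veronese_val. Proof. by []. Qed.
Lemma veronese_val_monoid_morphism : monoid_morphism veronese_val. Proof. by []. Qed.
HB.instance Definition _ := GRing.isZmodMorphism.Build A R veronese_val veronese_val_zmod_morphism.
HB.instance Definition _ :=
  GRing.isMonoidMorphism.Build A R veronese_val veronese_val_monoid_morphism.

Lemma veronese_val_embedding : veronese_embedding d (veronese_val : {rmorphism A -> R}).
Proof.
split=> // [|i b Rb]; first exact: val_inj.
by exists (Sub b (veronese_hom Rb) : veronese_type R d).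
Qed.

End VeroneseVal.

(** * Homogeneous components of homomorphisms *)

Lemma linear_of (A : comNzRingType) (M : lmodType A) (f : M -> A^o) :
  (forall u v, f (u + v) = f u + f v) -> (forall a u, f (a *: u) = a * f u) ->
  exists psi : {linear M -> A^o}, forall u, psi u = f u.
Proof.
move=> fD fZ; have lin : linear f by move=> a u v; rewrite fD fZ.
pose h := GRing.isLinear.Build A M A^o *:%R f lin.
pose F : {linear M -> A^o} := HB.pack f h.
by exists F.
Qed.

Section HomComponents.
Variables (k : fieldType) (R : gradedAlg k) (M : lmodType R) (G : int -> set M).
Hypothesis G_M : forall (i : nat) j r u, gr R i r -> G j u -> G (i%:Z + j) (r *: u).
Variable D : grading G.
Implicit Types (phi psi : {linear M -> R^o}).

(** A homomorphism need not be a finite sum of homogeneous ones, but its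
    components are well defined, since each element has finitely many nonzero
    components. *)
Lemma hom_component phi (j : int) : exists psi, hom_gr G j psi /\
  forall i u, G i u -> psi u = hcompz (i + j) (phi u).
Proof.
pose F (i : int) (u : M) : R := hcompz (i + j) (phi u).
have FD i u v : F i (u + v) = F i u + F i v.
  by rewrite /F linearD; exact: (prD (ring_grading R)).
have hom i u : G i u -> glue D F u = F i u by exact: glue_hom.
have [||psi psiE] := @linear_of R M (glue D F).
- exact: glueD.
- have F0 : glue D F 0 = 0.
    by apply: (addrI (glue D F 0)); rewrite -glueD // !addr0.
  move=> r u; elim/gr_ind: r => [|a b IHa IHb|l a Ra].
  + by rewrite scale0r mul0r.
  + by rewrite scalerDl glueD // mulrDl IHa IHb.
  elim/(grading_ind D): u => [|u v IHu IHv|i u Gu].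
  + by rewrite scaler0 F0 mulr0.
  + by rewrite scalerDr !glueD // mulrDr IHu IHv.
  rewrite (hom _ _ Gu) (hom _ _ (G_M Ra Gu)) /F -addrA linearZ.
  exact: hcompz_M.
exists psi; split=> [i u Gu|i u Gu]; rewrite psiE (hom _ _ Gu) //.
exact: (pr_in (ring_grading R)).
Qed.

Lemma trace0 : trace M 0.
Proof. by exists 0%N, (fun=> \0%R : {linear M -> R^o}), (fun=> 0); rewrite big_ord0. Qed.

Lemma trace_app phi u : trace M (phi u).
Proof. by exists 1%N, (fun=> phi), (fun=> u); rewrite big_ord_recl big_ord0 addr0. Qed.

Lemma traceD a b : trace M a -> trace M b -> trace M (a + b).
Proof.
move=> [n [f [u ->]]] [m [g [v ->]]].
exists (n + m)%N, (fun i => match fintype.split i with inl j => f j | inr j => g j end),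
  (fun i => match fintype.split i with inl j => u j | inr j => v j end).
rewrite big_split_ord /=; congr (_ + _); apply: eq_bigr => i _.
  by rewrite (unsplitK (inl i)).
by rewrite (unsplitK (inr i)).
Qed.

(** Components of elements of the trace are sums of values of homogeneous
    homomorphisms at homogeneous elements. *)
Lemma trace_component (P : R -> Prop) t a : P 0 ->
  (forall u v, P u -> P v -> P (u + v)) ->
  (forall j psi u, hom_gr G j psi -> G (t%:Z - j) u -> P (psi u)) ->
  trace M a -> P (hcomp t a).
Proof.
move=> P0 PD Phom [n [phi [u ->]]]; rewrite hcomp_sum.
elim/big_ind: _ => // i _; rewrite {1}(suppE D (u i)) linear_sum hcomp_sum.
elim/big_ind: _ => // l _.
have [psi [psi_gr psiE]] := hom_component (phi i) (t%:Z - l).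
have Gl := pr_in D l (u i).
have -> : hcomp t (phi i (pr D l (u i))) = psi (pr D l (u i)).
  by rewrite (psiE _ _ Gl) addrC subrK.
by apply: (Phom _ _ _ psi_gr); rewrite subKr.
Qed.

End HomComponents.

(** A nonempty set of integers has a greatest lower bound in the extended
    integers, its minimum or -oo. So the infimum is a lower bound, not a
    default value. *)
Lemma indeg_le (X : set int) j : X j -> (indeg X <= j%:E)%E.
Proof.
move=> Xj; rewrite /indeg /infimum; case: eqP => [X0|_].
  have : [set i%:E%E | i in X] j%:E%E by exists j.
  by rewrite X0.
suff [y yinf] : infimums [set i%:E%E | i in X] !=set0.
  by case: xgetP => [z _ [lbz _]|/(_ y)//]; apply: lbz; exists j.
have [[b lb]|nolb] := pselect (exists b : int, forall i, X i -> b <= i).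
  have exn : exists n : nat, `[< X (b + n%:Z) >].
    exists `|j - b|%N; apply/asboolP; rewrite gez0_abs ?subr_ge0 ?lb //.
    by rewrite (_ : b + (j - b) = j) //; ring.
  case: (ex_minnP exn) => n /asboolP Xn nmin.
  exists (b + n%:Z)%:E%E; split=> [y [i Xi <-]|y ub]; last by apply: ub; exists (b + n%:Z).
  have ib : 0 <= i - b by rewrite subr_ge0 lb.
  rewrite lee_fin -lerBrDl -(gez0_abs ib) lez_nat; apply: nmin; apply/asboolP.
  by rewrite gez0_abs // (_ : b + (i - b) = i) //; ring.
exists -oo%E; split=> [y _|[y||] ub]; rewrite ?leNye //.
  exfalso; apply: nolb; exists y => i Xi.
  have /= : (y%:E <= i%:E)%E by apply: ub; exists i.
  by rewrite lee_fin.
by have := ub _ (imageP _ Xj).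
Qed.

Lemma ceil_div_le (d : nat) (z n : int) : (0 < d)%N -> (ceil_div d z <= n) = (z <= n * d%:Z).
Proof.
move=> d0; have dQ : 0 < (d%:R : rat) by rewrite ltr0n.
rewrite /ceil_div ceil_le_int ler_pdivrMr // -[d%:R]/((d%:Z)%:~R) -intrM.
by rewrite ler_int.
Qed.

(** This says that W' is the Veronese part of W: ext is the inclusion, and res
    is the projection that kills the degrees not divisible by d. *)
Record veronese_dual (k : fieldType) (A R : gradedAlg k) (d : nat) (g : A -> R)
    (W : lmodType R) (GW : int -> set W) (W' : lmodType A) (GW' : int -> set W')
    (res : W -> W') (ext : W' -> W) : Prop := VeroneseDual {
  vd_resD : forall u v, res (u + v) = res u + res v;
  vd_resZ : forall a u, res (g a *: u) = a *: res u;
  vd_extD : forall u v, ext (u + v) = ext u + ext v;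
  vd_extZ : forall a u, ext (a *: u) = g a *: ext u;
  vd_extK : forall u, res (ext u) = u;
  vd_resK : forall j u, GW (j * d%:Z) u -> ext (res u) = u;
  vd_res_gr : forall j u, GW (j * d%:Z) u -> GW' j (res u);
  vd_res_ndvd : forall j u, ~~ (d%:Z %| j)%Z -> GW j u -> res u = 0;
  vd_ext_gr : forall j u, GW' j u -> GW (j * d%:Z) (ext u) }.

Section CanonicalVeronese.
Variables (k : fieldType) (A R : gradedAlg k) (d : nat) (g : {rmorphism A -> R}).
Hypothesis d_gt0 : (0 < d)%N.
Hypothesis gV : veronese_embedding d g.
Hypothesis oneR : one_generated R.
Hypothesis noethR : noetherian R.

Let oneA : one_generated A := embedding_one_generated gV oneR.
Let noethA : noetherian A := embedding_noetherian d_gt0 gV noethR.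

Lemma generators_hom (B : gradedAlg k) : one_generated B -> noetherian B ->
  forall i : 'I_(size (generators B)), exists e, gr B e (generators B)`_i.
Proof.
move=> oneB noethB i; exists 1%N; apply: (generatorsP oneB noethB).1.
exact: mem_nth.
Qed.

Definition canonical_grading (B : gradedAlg k) (oneB : one_generated B)
    (noethB : noetherian B) : grading (@canonical_gr k B) :=
  gdual_grading _ (coho_grading (generators_hom oneB noethB) (dim_index B)).

(** The two algebras have the same dimension, so the canonical modules are the
    graded duals of local cohomology modules of the same index. These are
    compared through the generators of the irrelevant ideals: the generators
    of R have their d-th powers in the extension of the irrelevant ideal of A,
    and those of A lie in the irrelevant ideal of R. *)
Lemma canonical_veronese : exists res ext,
  veronese_dual d g (@canonical_gr k R) (@canonical_gr k A) res ext.
Proof.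
have dimE : dim_index A = dim_index R.
  by rewrite /dim_index (embedding_krull_dim d_gt0 gV oneR noethR).
have [sA sAE] := generatorsP oneA noethA.
have [sR sRE] := generatorsP oneR noethR.
have rad_y (i : 'I_(size (generators A))) : in_radical
    (fun j : 'I_(size (generators R)) => (generators R)`_j) [set: _]%SET (g (generators A)`_i).
  have : irrelevant R (g (generators A)`_i).
    have := sA _ (mem_nth 0 (ltn_ord i)); rewrite (ve_gr gV) mul1n -[d]prednK //.
    exact: irrelevant_hom.
  rewrite sRE => -[c cE]; exists 1%N, (fun j => c j); rewrite expr1 cE.
  by apply: eq_bigl => j; rewrite !inE.
have rad_x (i : 'I_(size (generators R))) : in_radical
    (fun j : 'I_(size (generators A)) => g (generators A)`_j) [set: _]%SET (generators R)`_i.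
  have := gr_X d (sR _ (mem_nth 0 (ltn_ord i))); rewrite muln1 -[d in gr R d]mul1n.
  move=> Rx; have [a ax] := ve_surj gV Rx.
  have : irrelevant A a by apply: (@irrelevant_hom _ _ 0); rewrite (ve_gr gV) ax.
  rewrite sAE => -[c cE]; exists d, (fun j => g (c j)).
  rewrite -ax cE rmorph_sum; apply: eq_big => [j|j _]; first by rewrite !inE.
  by rewrite rmorphM.
have homy := generators_hom oneA noethA; have homx := generators_hom oneR noethR.
rewrite /canonical_gr /canonical_module dimE.
have [iota [iD iZ iinj igr isurj]] :=
  coho_compare d_gt0 gV homy homx rad_y rad_x (dim_index R).
pose D := coho_grading homx (dim_index R).
pose D' := coho_grading homy (dim_index R).
exists (dual_restrict d_gt0 gV _ iD iZ igr),
  (dual_extend d_gt0 gV _ D D' iD iZ iinj igr isurj); split.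
- exact: dual_restrictD.
- exact: dual_restrictZ.
- exact: dual_extendD.
- exact: dual_extendZ.
- exact: dual_extendK.
- exact: dual_restrictK.
- exact: dual_restrict_gr.
- by move=> j u; apply: dual_restrict_ndvd.
- exact: dual_extend_gr.
Qed.

End CanonicalVeronese.

(** * Trace ideals of Veronese subalgebras *)

Section Bounds.
Variables (k : fieldType) (A R : gradedAlg k) (d : nat) (g : {rmorphism A -> R}).
Hypothesis d_gt0 : (0 < d)%N.
Hypothesis gV : veronese_embedding d g.
Hypothesis oneR : one_generated R.
Variables (W : lmodType R) (GW : int -> set W) (DW : grading GW).
Hypothesis GW_M : forall (i : nat) j r u, gr R i r -> GW j u -> GW (i%:Z + j) (r *: u).
Variables (W' : lmodType A) (GW' : int -> set W') (DW' : grading GW').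
Hypothesis GW'_M : forall (i : nat) j r u, gr A i r -> GW' j u -> GW' (i%:Z + j) (r *: u).
Variables (res : W -> W') (ext : W' -> W).
Hypothesis VD : veronese_dual d g GW GW' res ext.

Let oneA : one_generated A := embedding_one_generated gV oneR.

Let res0 : res 0 = 0.
Proof. by apply: (addrI (res 0)); rewrite -(vd_resD VD) !addr0. Qed.

Let ext0 : ext 0 = 0.
Proof. by apply: (addrI (ext 0)); rewrite -(vd_extD VD) !addr0. Qed.

(** A degree divisible by d is what makes psi map the Veronese part of W to
    that of R. *)
Lemma hom_restrict (psi : W -> R) (q : int) :
  (forall u v, psi (u + v) = psi u + psi v) ->
  (forall r u, psi (r *: u) = r * psi u) ->
  (forall i u, GW i u -> grz (i + q * d%:Z) (psi u)) ->
  exists theta : {linear W' -> A^o}, forall u, g (theta u) = psi (ext u).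
Proof.
move=> psiD psiZ psi_gr.
have psi0 : psi 0 = 0 by apply: (addrI (psi 0)); rewrite -psiD !addr0.
have ex u : exists a, g a = psi (ext u).
  elim/(grading_ind DW'): u => [|u v [a au] [b bv]|i u Gu].
  - by exists 0; rewrite rmorph0 ext0 psi0.
  - by exists (a + b); rewrite rmorphD au bv (vd_extD VD) psiD.
  - have := psi_gr _ _ (vd_ext_gr VD Gu); rewrite -mulrDl.
    by move=> /(ve_grz_surj d_gt0 gV)[a _ <-]; exists a.
have [th thE] := choice ex.
have [||theta thetaE] := @linear_of A W' th.
- by move=> u v; apply: (ve_inj gV); rewrite rmorphD !thE (vd_extD VD) psiD.
- by move=> a u; apply: (ve_inj gV); rewrite rmorphM !thE (vd_extZ VD) psiZ.
by exists theta => u; rewrite thetaE thE.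
Qed.

(** Write a as a sum of products b * c with b of degree l. Then b is a sum of
    values psi w, with psi of some degree j. Choose e < d with e + j divisible
    by d and split c into products x * y with x of degree e. The homomorphism
    x * psi restricts to the Veronese parts and y * w lies in the Veronese
    part of W, so psi w * (x * y) is in the trace. The bound on the degree of
    a ensures that c has degree at least e. *)
Lemma trace_contains_gr l t a : ideal_exp (irrelevant R) l `<=` trace W ->
  (d.-1 + l <= t * d)%N -> gr A t a -> trace W' a.
Proof.
move=> l_trace lt /(ve_gr gV) Ra; have ltd : (l <= t * d)%N by lia.
suff : exists2 u, trace W' u & g u = g a by move=> [u ? /(ve_inj gV) <-].
pose P (x : R) := exists2 u, trace W' u & g u = x.
have P0 : P 0 by exists 0; [exact: trace0 | rewrite rmorph0].
have PD x y : P x -> P y -> P (x + y).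
  by move=> [u ? <-] [v ? <-]; exists (u + v); [exact: traceD | rewrite rmorphD].
move: Ra; rewrite -{1}(subnKC ltd) => /(gr_mul_span oneR).
apply: (ideal_mul_sub P0 PD) => b c Rb Rc.
have : trace W b by apply: l_trace; exact: gr_ideal_exp oneR _ _ _ (leqnn l) Rb.
rewrite -[b in X in _ -> X](hcomp_id Rb).
apply: (trace_component GW_M DW (P := fun b => P (b * c))).
- by rewrite mul0r.
- by move=> u v; rewrite mulrDl; exact: PD.
move=> j psi w psi_gr Gw.
have [e [q [ed jq]]] : exists (e : nat) (q : int), (e < d)%N /\ e%:Z + j = q * d%:Z.
  (* e is the remainder of - j modulo d. *)
  exists `|((- j) %% d%:Z)%Z|%N, (- ((- j) %/ d%:Z)%Z).
  have dn0 : d%:Z != 0 by rewrite eqz_nat -lt0n.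
  rewrite -ltz_nat gez0_abs ?modz_ge0 //; split; first by rewrite ltz_pmod.
  by rewrite mulNr; apply: (addrI (((- j) %/ d%:Z)%Z * d%:Z)); rewrite addrA -divz_eq addNr subrr.
have eb : (e <= t * d - l)%N by lia.
move: Rc; rewrite -(subnKC eb) => /(gr_mul_span oneR).
apply: (ideal_mul_sub (P := fun c => P (psi w * c))) => [|x y|x y Rx Ry].
- by rewrite mulr0.
- by rewrite mulrDr; exact: PD.
have [|||theta thetaE] := @hom_restrict (fun u => x * psi u) q.
- by move=> u v; rewrite linearD mulrDr.
- by move=> r u; rewrite linearZ /= mulrCA.
- move=> i u Gu; rewrite -jq addrCA; apply: grz_M => //.
  exact: psi_gr.
exists (theta (res (y *: w))); first exact: trace_app.
rewrite thetaE (vd_resK VD (j := t%:Z - q)).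
  by rewrite linearZ /= mulrA mulrC.
have := GW_M Ry Gw; congr GW.
rewrite mulrBl -jq; lia.
Qed.

Hypothesis noethR : noetherian R.
Hypothesis R_dim : ((2%:Z)%:E <= krull_dim R)%E.
Hypothesis R_S2 : serre R 2.

(** For w of degree i, the element phi' (x * w) is meaningful when the degree
    of x is congruent to - i modulo d. As a function of such x it is the
    multiplication by a unique element of R, by depth at least two, and this
    element is the value of the extension at w. *)
Lemma hom_extend (phi : {linear W' -> A^o}) j : hom_gr GW' j phi ->
  exists psi : {linear W -> R^o}, hom_gr GW (j * d%:Z) psi /\
    forall u, psi (ext u) = g (phi u).
Proof.
move=> phi_gr; pose phi' (w : W) : R := g (phi (res w)).
have phi'D u v : phi' (u + v) = phi' u + phi' v.
  by rewrite /phi' (vd_resD VD) linearD rmorphD.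
have phi'Z a u : phi' (g a *: u) = g a * phi' u.
  by rewrite /phi' (vd_resZ VD) linearZ rmorphM.
have phi'_gr i u : GW i u -> grz (i + j * d%:Z) (phi' u).
  move=> Gu; have [/dvdzP[i' iE]|di] := boolP (d%:Z %| i)%Z; last first.
    rewrite /phi' (vd_res_ndvd VD di Gu) linear0 rmorph0.
    exact: (gr0_mem (ring_grading R)).
  rewrite iE in Gu *; rewrite -mulrDl; apply: (ve_grz gV).
  exact: phi_gr (vd_res_gr VD Gu).
have pull m (x : R) : gr R (m * d) x -> exists a, g a = x by exact: ve_surj.
have sym i w e e' x y : GW i w -> (d%:Z %| e%:Z + i)%Z -> (d%:Z %| e'%:Z + i)%Z ->
    gr R e x -> gr R e' y -> x * phi' (y *: w) = y * phi' (x *: w).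
  move=> Gw de de' Rx Ry; apply/eqP; rewrite -subr_eq0; apply/eqP.
  (* A factor h of degree - e modulo d moves both x and y into A, over which
     phi is linear. *)
  apply: (grade0_hom oneR noethR R_dim R_S2 (e := (d.-1 * e)%N)) => h Rh.
  have Rhx : gr R (e * d) (h * x).
    have := gr_M Rh Rx; congr (gr R _ _).
    by rewrite -mulSnr prednK // mulnC.
  have [m mE] : exists m, (d.-1 * e + e' = m * d)%N.
    have /dvdnP[m mE] : (d %| d.-1 * e + e')%N; last by exists m.
    have : (d%:Z %| (d.-1 * e + e')%N%:Z)%Z; last by [].
    have -> : (d.-1 * e + e')%N%:Z = d%:Z * e%:Z + ((e'%:Z + i) - (e%:Z + i)).
      rewrite -{2}(prednK d_gt0); lia.
    by rewrite rpredD ?rpredB // dvdz_mulr.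
  have Rhy : gr R (m * d) (h * y) by rewrite -mE; exact: gr_M.
  have [a ax] := pull _ _ Rhx; have [b bY] := pull _ _ Rhy.
  rewrite mulrBr !mulrA -ax -bY -!phi'Z !scalerA ax bY.
  by rewrite -!mulrA (mulrC x y) subrr.
(* C i w r says that r is the value of the extension at w, for w of degree i.
   *)
pose C (i : int) w r := grz (i + j * d%:Z) r /\ forall e x, gr R e x ->
  (d%:Z %| e%:Z + i)%Z -> phi' (x *: w) = x * r.
have pos_deg (i : int) : exists e : nat, (d%:Z %| e.+1%:Z + i)%Z.
  have dn0 : d%:Z != 0 by rewrite eqz_nat -lt0n.
  exists (`|((- i) %% d%:Z)%Z|%N + d.-1)%N; rewrite -addnS prednK // PoszD.
  rewrite gez0_abs ?modz_ge0 //.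
  have -> : ((- i) %% d%:Z)%Z + d%:Z + i = (- ((- i) %/ d%:Z)%Z + 1) * d%:Z.
    apply: (addrI (((- i) %/ d%:Z)%Z * d%:Z)).
    by rewrite 2!addrA -divz_eq mulrDl mulNr mul1r addrA subrr add0r addrAC addNr add0r.
  by rewrite dvdz_mull.
have Cuniq i w r r' : C i w r -> C i w r' -> r = r'.
  move=> [_ Cr] [_ Cr']; have [e de] := pos_deg i.
  apply/eqP; rewrite -subr_eq0; apply/eqP.
  apply: (grade0_hom oneR noethR R_dim R_S2 (e := e.+1)) => x Rx.
  by rewrite mulrBr -(Cr _ _ Rx) // -(Cr' _ _ Rx) // subrr.
have Cex i w : GW i w -> exists r, C i w r.
  move=> Gw; have [e de] := pos_deg i.
  have [x Rx|x y Rx Ry|r Rr rE] := grade_hom oneR noethR R_dim R_S2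
      (e := e) (phi := fun x => phi' (x *: w)) (j := i + j * d%:Z).
  - by rewrite addrA; apply: phi'_gr; exact: GW_M.
  - exact: (sym i w e.+1 e.+1).
  exists r; split=> // e' x Rx de'; apply/eqP; rewrite -subr_eq0; apply/eqP.
  apply: (grade0_hom oneR noethR R_dim R_S2 (e := e.+1)) => z Rz.
  rewrite mulrBr (sym i w e.+1 e' z x) // rE // mulrCA.
  by rewrite subrr.
have C0 i : C i 0 0.
  split; first exact: (gr0_mem (ring_grading R)).
  move=> e x _ _; rewrite scaler0 mulr0 /phi' res0 linear0.
  exact: rmorph0.
have CD i u v r t : C i u r -> C i v t -> C i (u + v) (r + t).
  move=> [Rr Cr] [Rt Ct]; split; first exact: (grD_mem (ring_grading R)).
  by move=> e x Rx de; rewrite scalerDr phi'D mulrDr (Cr e) // (Ct e).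
have CM i (m : nat) u r x : gr R m x -> C i u r -> C (m%:Z + i) (x *: u) (x * r).
  move=> Rx [Rr Cr]; split; first by rewrite -addrA; exact: grz_M.
  move=> e y Ry de; rewrite scalerA mulrA (Cr (e + m)%N) //; first exact: gr_M.
  by rewrite PoszD -addrA.
pose F i w : R := xget 0 (C i (pr DW i w)).
have FC i w : C i (pr DW i w) (F i w).
  have [r Cr] := Cex i _ (pr_in DW i w).
  by rewrite /F; case: xgetP => [y -> //|/(_ r)].
have FD i u v : F i (u + v) = F i u + F i v.
  by apply: (Cuniq i (pr DW i (u + v))) => //; rewrite prD; exact: CD.
have F_hom i u r : GW i u -> C i u r -> glue DW F u = r.
  move=> Gu Cr; rewrite (glue_hom DW FD Gu); apply: (Cuniq i u) => //.
  by have := FC i u; rewrite pr_id.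
have FT u v : glue DW F (u + v) = glue DW F u + glue DW F v by exact: glueD.
have FT0 : glue DW F 0 = 0 by apply: F_hom (C0 0); exact: gr0_mem DW 0.
have [|psi psiE] := @linear_of R W (glue DW F) FT.
  move=> r u; elim/gr_ind: r => [|a b IHa IHb|m a Ra].
  - by rewrite scale0r mul0r.
  - by rewrite scalerDl FT mulrDl IHa IHb.
  elim/(grading_ind DW): u => [|u v IHu IHv|i u Gu].
  - by rewrite scaler0 FT0 mulr0.
  - by rewrite scalerDr !FT mulrDr IHu IHv.
  have [c Cc] := Cex i u Gu.
  by rewrite (F_hom i u c) // (F_hom _ _ _ (GW_M Ra Gu) (CM _ _ _ _ _ Ra Cc)).
exists psi; split=> [i u Gu|u].
  by have [c Cc] := Cex i u Gu; rewrite psiE (F_hom i u c) //; case: Cc.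
rewrite psiE; elim/(grading_ind DW'): u => [|u v IHu IHv|i u Gu].
- by rewrite ext0 FT0 linear0 rmorph0.
- by rewrite (vd_extD VD) FT IHu IHv linearD rmorphD.
have Gu' := vd_ext_gr VD Gu; have [c Cc] := Cex _ _ Gu'.
rewrite (F_hom _ _ c Gu' Cc).
have [_ /(_ 0%N 1 (gr_1 R))] := Cc; rewrite add0r dvdz_mull // => /(_ isT).
by rewrite scale1r mul1r /phi' (vd_extK VD).
Qed.

(** A nonzero component of degree t involves a nonzero homogeneous
    homomorphism over A, which extends to R, and a nonzero homogeneous element
    of W', which lies in W. Over R their degrees add up to t * d. *)
Lemma trace_sub_ideal_expe (e : \bar int) :
  (forall j u, GW j u -> u <> 0 -> forall i psi w, hom_gr GW i psi -> psi w <> 0 ->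
     forall t : nat, j + i = t%:Z * d%:Z -> (d%:Z %| j)%Z -> (e <= t%:Z%:E)%E) ->
  trace W' `<=` ideal_expe (irrelevant A) e.
Proof.
move=> he a Wa.
have low t : hcomp t a != 0 -> (e <= t%:Z%:E)%E.
  suff : hcomp t a = 0 \/ (e <= t%:Z%:E)%E by case=> // ->; rewrite eqxx.
  apply: (trace_component GW'_M DW' (P := fun x => x = 0 \/ (e <= t%:Z%:E)%E)) Wa.
  - by left.
  - by move=> u v [->|]; [rewrite add0r | right].
  move=> j psi u psi_gr Gu; have [|/eqP psiu0] := eqVneq (psi u) 0; first by left.
  right; have [phi [phi_gr phiE]] := hom_extend psi_gr.
  have ext_inj v : ext v = 0 -> v = 0 by rewrite -{2}(vd_extK VD v) => ->.
  apply: (he _ _ (vd_ext_gr VD Gu) _ _ _ (ext u) phi_gr).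
  - by move=> /ext_inj u0; apply: psiu0; rewrite u0 linear0.
  - by rewrite phiE -[0](rmorph0 g) => /(ve_inj gV).
  - by rewrite -mulrDl subrK.
  - by rewrite dvdz_mull.
have [n an] := hcomp_sumE a.
have expI m : is_ideal (ideal_exp (irrelevant A) m).
  by apply: is_ideal_exp; exact: is_ideal_irrelevant.
have in_exp m : (forall t, hcomp t a != 0 -> (m <= t)%N) -> ideal_exp (irrelevant A) m a.
  move=> hm; rewrite (an n (leqnn n)); apply: ideal_sum => // i _.
  have [->|/hm mi] := eqVneq (hcomp i a) 0; first exact: ideal_0.
  exact: gr_ideal_exp oneA _ _ _ mi (hcomp_in i a).
case: e he low => [[m|m]||] he low //=.
- by apply: in_exp => t /low; rewrite lee_fin lez_nat.
- by move=> m _; apply: in_exp => t /low.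
Qed.

End Bounds.

Lemma er_map_ceil_le (d : nat) (e : \bar int) (n : int) : (0 < d)%N ->
  (e <= (n * d%:Z)%R%:E)%E -> (er_map (ceil_div d) e <= n%:E)%E.
Proof.
move=> d0; case: e => [z||].
- by rewrite -[er_map _ _]/((ceil_div d z)%:E) !lee_fin ceil_div_le.
- by rewrite leye_eq.
- by move=> _; rewrite leNye.
Qed.

Theorem theoremB (k : fieldType) (R : gradedAlg k)
  (R_std : standard_graded R)
  (R_dim : ((2%:Z)%:E <= krull_dim R)%E)
  (R_S2 : serre R 2)
  (l : nat)
  (l_trace : ideal_exp (irrelevant R) l `<=` trace (canonical_module R))
  (l_min : forall j : nat,
     ideal_exp (irrelevant R) j `<=` trace (canonical_module R) -> (l <= j)%N)
  (d : nat) (d_gt0 : (0 < d)%N) :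
  let Rd := veronese R d_gt0 in
  ideal_expe (irrelevant Rd) (1 + ceil_div d (l%:Z - 1))%:E
    `<=` trace (canonical_module Rd) /\
  trace (canonical_module Rd) `<=`
    ideal_expe (irrelevant Rd)
      (er_map (ceil_div d) (oppe (a_inv R)) + er_map (ceil_div d) (b_inv R))%E.
Proof.
move=> Rd.
have oneR := standard_one_generated R_std; have noethR := std_noetherian R_std.
pose g : {rmorphism Rd -> R} := @veronese_val k R d d_gt0.
have gV : veronese_embedding d g by exact: veronese_val_embedding.
have oneA := embedding_one_generated gV oneR.
have noethA := embedding_noetherian d_gt0 gV noethR.
have [res [ext VD]] := canonical_veronese d_gt0 gV oneR noethR.
have DW := canonical_grading oneR noethR.
have DW' := canonical_grading oneA noethA.
have GW_M (i : nat) j r (u : canonical_module R) : gr R i r ->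
    canonical_gr j u -> canonical_gr (i%:Z + j) (r *: u) by exact: gdual_gr_M.
have GW'_M (i : nat) j r (u : canonical_module Rd) : gr Rd i r ->
    canonical_gr j u -> canonical_gr (i%:Z + j) (r *: u) by exact: gdual_gr_M.
split.
- move=> a ea; have [n an] := hcomp_sumE a; rewrite (an n (leqnn n)).
  elim/big_ind: _ => [|u v|i _]; [exact: trace0 | exact: traceD |].
  have [ie|ei] := ltrP i%:Z (1 + ceil_div d (l%:Z - 1)).
    suff -> : hcomp i a = 0 by exact: trace0.
    move: ie ea; case: (1 + _) => [m|m] //= im /ideal_exp_order; apply.
    by rewrite -ltz_nat.
  apply: (trace_contains_gr d_gt0 gV oneR DW GW_M DW' VD l_trace) (hcomp_in i a).
  move: ei; rewrite addrC -lerBrDr ceil_div_le // => ei.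
  rewrite -lez_nat PoszD PoszM; lia.
- apply: (trace_sub_ideal_expe d_gt0 gV oneR DW GW_M DW' GW'_M VD noethR R_dim R_S2).
  move=> j u Gu u0 i psi w psi_gr psiw t ijt /dvdzP[j' jE].
  have iE : i = (t%:Z - j') * d%:Z by rewrite mulrBl -ijt jE addrAC subrr add0r.
  rewrite -(subrK j' t%:Z) addrC EFinD; apply: leeD; apply: er_map_ceil_le => //.
  by rewrite -iE; apply: indeg_le; exists psi => //; exists w.
  by rewrite /a_inv oppeK -jE; apply: indeg_le; exists u.
Qed.
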